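(* Assume the light-tail condition $\mathbb E_\xi\big[\exp(\|\mathcal G(x,\xi)-\nabla f(x)\|^2/\sigma^2)\big]\le\exp(1)$ for all $x\in X$, in addition to the assumptions in the context. Let $\bar x$ be the output of the two-phase method 2-AC-SPG described in the context, with $\mathcal R$ AC-SPG runs of $k$ iterations each, post-optimization sample size $\mathcal K$, batch sizes $b_t=\max\{1,\lceil(\tfrac{11I(t-1)}8+\tfrac78)\tfrac\alpha{\gamma_t}\rceil\}$ for some $\alpha>0$, and $b_t'\ge1$ (as further specified below for Estimator II). Then with probability at least $1-(\tfrac12)^{\mathcal R}-\mathcal R\exp(-\tfrac{\lambda^2}3)$ (for $\lambda\ge0$), $$\|g_X(\bar x)\|^2\le\frac{8Q_k}{M_k}+\frac{12(1+\lambda)^2\sigma^2}{\mathcal K},$$ where $M_k:=\sum_{i=1}^m\sum_{t=2}^{s_i}(\tfrac{3t}{16}-\tfrac14)\tfrac1{\gamma_t^{(i)}}\ge\tfrac{(k-m)^2}{128\hat{\mathcal L}_{k-1}}$ and $$Q_k:=\begin{cases}\tfrac{(10+k-m)\hat{\mathcal L}D_X^2}{2}+\tfrac{k\,l\,D_X^2}{2}+\tfrac{k\sigma^2}{\alpha},&\text{when using Estimator I},\\[2pt]\tfrac{21\hat{\mathcal L}D_X^2}{4}+\tfrac{k\,l\,D_X^2}{2}+\tfrac{k\sigma^2}{\alpha},&\text{when using Estimator II with }b_t'\ge2\log_{1/\beta}(k+1).\end{cases}$$ Consequently, by setting $\mathcal R=\lceil\log_2(\tfrac2\delta)\rceil$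 and $\lambda=\sqrt{3\log\tfrac{2\lceil\log_2(2/\delta)\rceil}{\delta}}$ (for $\delta\in(0,1)$), with probability at least $1-\delta$, $$\|g_X(\bar x)\|^2\le\frac{8Q_k}{M_k}+12\Big(1+\sqrt{3\log\tfrac{2\lceil\log_2(2/\delta)\rceil}{\delta}}\Big)^2\cdot\frac{\sigma^2}{\mathcal K}.$$
   Context: $\|\cdot\|$, $\langle\cdot,\cdot\rangle$ are Euclidean; convention $\tfrac00=0$. $X\subseteq\mathbb R^n$ is a convex compact set with diameter $D_X=\max_{x,y\in X}\|x-y\|$; $f:X\to\mathbb R$ is continuously differentiable with $\|\nabla f(x)-\nabla f(y)\|\le L\|x-y\|$ for all $x,y\in X$ (hence $f(x)-f(y)-\langle\nabla f(y),x-y\rangle\le\tfrac L2\|x-y\|^2$), and, for some $l\in[0,L]$, $f(x)-f(y)-\langle\nabla f(y),x-y\rangle\ge-\tfrac l2\|x-y\|^2$ for all $x,y\in X$. Stochastic oracle: given $x\in X$ it returns $\mathcal F(x,\xi)$ and $\mathcal G(x,\xi)=\nabla\mathcal F(x,\xi)$, $\xi\in\Xi$ random; all samples are i.i.d. Assumptions, for all $x,y\in X$: $\mathbb E_\xi[\mathcal F(x,\xi)]=f(x)$, $\mathbb E_\xi[\mathcal G(x,\xi)]=\nabla f(x)$; $\mathbb E_\xi\|\mathcal G(x,\xi)-\nabla f(x)\|^2\le\sigma^2$ with $\sigma^2>0$; for each $\xi\in\Xi$ there is $\mathcal L(\xi)\ge0$ with $\|\mathcal G(x,\xi)-\mathcal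 G(y,\xi)\|\le\mathcal L(\xi)\|x-y\|$ and $\mathcal F(x,\xi)-\mathcal F(y,\xi)-\langle\mathcal G(y,\xi),x-y\rangle\le\tfrac{\mathcal L(\xi)}2\|x-y\|^2$, where $\mathcal L(\xi)\le\hat{\mathcal L}$ almost surely and $\mathbb E[\mathcal L(\xi)^2]\le\bar{\mathcal L}^2$. For $x,y\in X$: $\mathcal L_{x,y}(\xi):=\frac{2(\mathcal F(x,\xi)-\mathcal F(y,\xi)-\langle\nabla\mathcal F(y,\xi),x-y\rangle)}{\|x-y\|^2}$ and $L_{x,y}:=\frac{2(f(x)-f(y)-\langle\nabla f(y),x-y\rangle)}{\|x-y\|^2}$. Local Lipschitz estimators, from $b_t'$ i.i.d. samples $\bar\xi^t_1,\dots,\bar\xi^t_{b_t'}$ ($t\ge1$), with $0<\bar{\mathcal L}_0\le\hat{\mathcal L}$ given. Estimator I: $\bar{\mathcal L}_t:=\tfrac1{b_t'}\sum_{j=1}^{b_t'}\mathcal L_{x_t,x_{t-1}}(\bar\xi^t_j)$. Estimator II: $\bar{\mathcal L}_t:=\max\{\bar{\mathcal L}_0,\max_{1\le j\le b_t'}\mathcal L_{x_t,x_{t-1}}(\bar\xi^t_j)\}$. $\beta:=\max_{x,y\in X}\mathbb P\big(\max\{\bar{\mathcal L}_0,\mathcal L_{x,y}(\xi)\}\le\tfrac12L_{x,y}\big)<1$. AC-SPG method: given $x_0\in X$, for $t=1,\dots,k$: draw i.i.d. samples $\xi^t_1,\dots,\xi^t_{b_t}$, set $\hat G_t(x)=\tfrac1{b_t}\sum_{j=1}^{b_t}\mathcal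 G(x,\xi_j^t)$, $\gamma_t:=4\hat{\mathcal L}_{t-1}$ with $\hat{\mathcal L}_{t-1}:=\max\{\bar{\mathcal L}_0,\dots,\bar{\mathcal L}_{t-1}\}$, and $x_t=\arg\min_{x\in X}\{\langle\hat G_t(x_{t-1}),x\rangle+\tfrac{\gamma_t}2\|x_{t-1}-x\|^2\}$; then draw i.i.d. samples $\bar\xi^t_1,\dots,\bar\xi^t_{b_t'}$ and compute $\bar{\mathcal L}_t$ by the chosen estimator. Segments of an AC-SPG run of $k$ iterations: $x_0,x_1$ are in segment 1; for $t\ge2$ a new segment starts at $x_t$ whenever $\bar{\mathcal L}_t>\tfrac32\hat{\mathcal L}_{t-1}$. So $\{x_0,\dots,x_k\}=\{x_0^{(1)},x_1^{(1)},\dots,x_{s_1}^{(1)},x_1^{(2)},\dots,x_{s_2}^{(2)},\dots,x_1^{(m)},\dots,x_{s_m}^{(m)}\}$, $m$ being the number of segments ($m\le\lfloor\log_{3/2}(\hat{\mathcal L}/\bar{\mathcal L}_0)\rfloor+1$) and $s_i$ the length of segment $i$. $S(t)$ is the segment index and $I(t)$ the within-segment index of $x_t$, i.e. $x_t=x^{(S(t))}_{I(t)}$ (so $I(0)=0$, $I(1)=1$), and $\gamma^{(S(t))}_{I(t)}=\gamma_t$. Random output of a run: $W(t):=\tfrac{3I(t)}{16}-\tfrac14$ if $I(t)\ge2$ and $W(t):=0$ if $I(t)=1$; $x_{R(k)}$ is randomly selected from $\{x_1,\dots,x_{k-1}\}$ with $\mathbb P(x_{R(k)}=x_{t-1})=\big(\sum_{j=1}^k\tfrac{W(j)}{\gamma_j}\big)^{-1}\tfrac{W(t)}{\gamma_t}$.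 Projected gradient: $P_X(x,g,\gamma):=\gamma(x-x^+)$, $x^+=\arg\min_{u\in X}\{\langle g,u\rangle+\tfrac\gamma2\|x-u\|^2\}$. 2-AC-SPG method: Optimization phase: run AC-SPG independently $\mathcal R$ times from $x_0$ for $k$ iterations, and let $\bar x_r=x_{R_r}$ be the random output of run $r$. Post-optimization phase: with $\mathcal K$ new i.i.d. samples $\xi_1,\dots,\xi_{\mathcal K}$ let $\bar G_{\mathcal K}(x)=\tfrac1{\mathcal K}\sum_{j=1}^{\mathcal K}\mathcal G(x,\xi_j)$, $\bar g_X(\bar x_r)=P_X(\bar x_r,\bar G_{\mathcal K}(\bar x_r),\gamma_{R_r+1})$, and output $\bar x\in\{\bar x_1,\dots,\bar x_{\mathcal R}\}$ with $\|\bar g_X(\bar x)\|=\min_{1\le r\le\mathcal R}\|\bar g_X(\bar x_r)\|$. Define $g_X(\bar x_r):=P_X(\bar x_r,\nabla f(\bar x_r),\gamma_{R_r+1})$, and $g_X(\bar x)$ analogously. *)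

(* Defs.v *)
From HB Require Import structures.
From mathcomp Require Import all_boot all_order all_algebra.
From mathcomp Require Import all_classical all_reals all_analysis.
Set Implicit Arguments.
Unset Strict Implicit.
Unset Printing Implicit Defensive.
Import Order.TTheory GRing.Theory Num.Theory.
Import numFieldNormedType.Exports.
Local Open Scope classical_set_scope.
Local Open Scope ring_scope.

Definition dot (R : realType) (n : nat) (u v : 'rV[R]_n) : R :=
  \sum_i u 0 i * v 0 i.

(* The library norm on 'rV[R]_n is the sup norm, hence this Euclidean norm. *)
Definition enorm (R : realType) (n : nat) (u : 'rV[R]_n) : R :=
  Num.sqrt (dot u u).

Definition diam (R : realType) (n : nat) (X : set 'rV[R]_n) : R :=
  sup [set d | exists x y, [/\ X x, X y & d = enorm (x - y)]].

(* [g] is a gradient of [f : X -> R]: differentiability is relative to [X], so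
   the values of [f] and [g] outside [X] are irrelevant. *)
Definition is_gradient_on (R : realType) (n : nat) (X : set 'rV[R]_n)
    (f : 'rV[R]_n -> R) (g : 'rV[R]_n -> 'rV[R]_n) : Prop :=
  forall y, X y -> forall e : R, 0 < e ->
    \forall x \near y, X x ->
      `|f x - f y - dot (g y) (x - y)| <= e * enorm (x - y).

(* L_{x,y}; it is 0 for x = y since division by 0 returns 0. *)
Definition local_curv (R : realType) (n : nat)
    (f : 'rV[R]_n -> R) (g : 'rV[R]_n -> 'rV[R]_n) (x y : 'rV[R]_n) : R :=
  2 * (f x - f y - dot (g y) (x - y)) / enorm (x - y) ^+ 2.

Definition prox (R : realType) (n : nat) (X : set 'rV[R]_n)
    (x g : 'rV[R]_n) (gam : R) : 'rV[R]_n :=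
  let obj u := dot g u + gam / 2 * enorm (x - u) ^+ 2 in
  xget x [set u | X u /\ forall v, X v -> obj u <= obj v].

Definition proj_grad (R : realType) (n : nat) (X : set 'rV[R]_n)
    (x g : 'rV[R]_n) (gam : R) : 'rV[R]_n :=
  gam *: (x - prox X x g gam).

Definition avg_grad (R : realType) (n : nat) (Xi : Type)
    (G : 'rV[R]_n -> Xi -> 'rV[R]_n) (b : nat) (s : nat -> Xi)
    (x : 'rV[R]_n) : 'rV[R]_n :=
  b%:R^-1 *: \sum_(j < b) G x (s j).

Inductive estimator := EstimatorI | EstimatorII.

Record acspg (R : realType) (n : nat) (Xi : Type) := AcSpg {
  domain : set 'rV[R]_n;
  val_oracle : 'rV[R]_n -> Xi -> R;
  grad_oracle : 'rV[R]_n -> Xi -> 'rV[R]_n;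
  start : 'rV[R]_n;
  Lbar0 : R;
  alpha : R;
  est_batch : nat -> nat;
  est : estimator }.

(* State after iteration t: x_t, max(Lbar_0, ..., Lbar_t), I(t) and S(t). *)
Record state (R : realType) (n : nat) := State {
  iterate : 'rV[R]_n;
  Lhat : R;
  idx : nat;
  seg : nat }.

Section Run.
Context (R : realType) (n : nat) (Xi : Type) (D : acspg R n Xi).

Definition local_estimate (b : nat) (s : nat -> Xi) (x y : 'rV[R]_n) : R :=
  let Lxy j :=
    local_curv (val_oracle D ^~ (s j)) (grad_oracle D ^~ (s j)) x y in
  match est D with
  | EstimatorI => b%:R^-1 * \sum_(j < b) Lxy j
  | EstimatorII => \big[Num.max/Lbar0 D]_(j < b) Lxy j
  end.

(* b_t as a function of i = I(t-1) and gam = gamma_t *)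
Definition grad_batch (i : nat) (gam : R) : nat :=
  maxn 1 `|Num.ceil ((11 * i%:R / 8 + 7 / 8) * (alpha D / gam))|%N.

(* Iteration t; the batches are initial segments of the infinite sample
   sequences [s] (gradients) and [s'] (Lipschitz estimation). *)
Definition acspg_step (t : nat) (s s' : nat -> Xi) (st : state R n) :
    state R n :=
  let x := iterate st in
  let gam := 4 * Lhat st in
  let x' := prox (domain D) x
    (avg_grad (grad_oracle D) (grad_batch (idx st) gam) s x) gam in
  let Lbar := local_estimate (est_batch D t) s' x' x in
  let new_seg := (1 < t)%N && (3 / 2 * Lhat st < Lbar) in
  State x' (Num.max (Lhat st) Lbar)
    (if new_seg then 1%N else (idx st).+1)
    (if new_seg then (seg st).+1 else seg st).

Fixpoint acspg_run (s s' : nat -> nat -> Xi) (t : nat) : state R n :=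
  if t is t'.+1
  then acspg_step t (s t) (s' t) (acspg_run s s' t')
  else State (start D) (Lbar0 D) 0 1.

End Run.

Section Segments.
Context (R : realType) (n : nat).
Implicit Types tr : nat -> state R n.

Definition stepsize tr (t : nat) : R := 4 * Lhat (tr t.-1).

Definition nb_segs tr (k : nat) : nat := seg (tr k).

(* s_i; x_0, of index 0 in the first segment, is not counted *)
Definition seg_len tr (k i : nat) : nat :=
  count (fun t => seg (tr t) == i) (iota 1 k).

(* the t <= k with S(t) = i and I(t) = j *)
Definition seg_pos tr (k i j : nat) : nat :=
  find (fun t => (seg (tr t) == i) && (idx (tr t) == j)) (iota 0 k.+1).

Definition seg_stepsize tr (k i j : nat) : R := stepsize tr (seg_pos tr k i j).

Definition Mk tr (k : nat) : R :=
  \sum_(1 <= i < (nb_segs tr k).+1) \sum_(2 <= t < (seg_len tr k i).+1)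
    (3 * t%:R / 16 - 1 / 4) * (1 / seg_stepsize tr k i t).

Definition weight tr (t : nat) : R :=
  if (2 <= idx (tr t))%N then 3 * (idx (tr t))%:R / 16 - 1 / 4 else 0.

Definition weight_total tr (k : nat) : R :=
  \sum_(1 <= j < k.+1) weight tr j / stepsize tr j.

(* the probability of outputting x_i, i.e. t = i + 1 *)
Definition output_prob tr (k i : nat) : R :=
  (weight_total tr k)^-1 * (weight tr i.+1 / stepsize tr i.+1).

(* the projected gradient at x_i, with stepsize gamma_{i+1} *)
Definition iter_grad (X : set 'rV[R]_n) (g : 'rV[R]_n -> 'rV[R]_n) tr
    (i : nat) : 'rV[R]_n :=
  let x := iterate (tr i) in proj_grad X x (g x) (stepsize tr i.+1).

Definition Qk (e : estimator) (Lmax DX l sigma alpha : R) (k m : nat) : R :=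
  match e with
  | EstimatorI => (10 + k%:R - m%:R) * Lmax * DX ^+ 2 / 2
  | EstimatorII => 21 * Lmax * DX ^+ 2 / 4
  end + k%:R * l * DX ^+ 2 / 2 + k%:R * sigma ^+ 2 / alpha.

End Segments.

Section Probability.
Context d (Omega : measurableType d) d' (Xi : measurableType d')
        (R : realType).

Definition mutually_independent (P : probability Omega R) (J : eqType)
    (Z : J -> Omega -> Xi) : Prop :=
  forall (s : seq J) (A : J -> set Xi), uniq s ->
    (forall i, measurable (A i)) ->
    (P (\big[setI/setT]_(i <- s) (Z i @^-1` A i)) =
     \prod_(i <- s) P (Z i @^-1` A i))%E.

Definition iid (P : probability Omega R) (mu : probability Xi R) (J : eqType)
    (Z : J -> Omega -> Xi) : Prop :=
  [/\ forall i, measurable_fun setT (Z i),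
      forall i A, measurable A -> P (Z i @^-1` A) = mu A &
      mutually_independent P Z].

Definition sigma_generated (J : Type) (Z : J -> Omega -> Xi) :
    set (set Omega) :=
  <<s [set B | exists i A, measurable A /\ B = Z i @^-1` A] >>.

Definition all_samples (I : Type) (s s' : I -> nat -> nat -> Omega -> Xi)
    (z : nat -> Omega -> Xi) (j : (I * nat * nat) + (I * nat * nat) + nat) :
    Omega -> Xi :=
  match j with
  | inl (inl (r, t, i)) => s r t i
  | inl (inr (r, t, i)) => s' r t i
  | inr i => z i
  end.

(* Conditionally on the samples generating [Sig], the indices [Rout r] are
   independent, the r-th one having the law [output_prob] of its run.  This law
   exists only if its normalizing constant is nonzero; otherwise [Rout r] is
   an arbitrary index in the range. *)
Definition random_outputs (P : probability Omega R) (Sig : set (set Omega))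
    (n nr k : nat) (T : 'I_nr -> Omega -> nat -> state R n)
    (Rout : 'I_nr -> Omega -> nat) : Prop :=
  [/\ forall r w, (0 < Rout r w < k)%N,
      forall r i, measurable [set w | Rout r w = i] &
      forall (A : set Omega) (i : 'I_nr -> nat),
        Sig A -> A `<=` [set w | forall r, 0 < weight_total (T r w) k] ->
        (forall r, (0 < i r < k)%N) ->
        (P (A `&` [set w | forall r, Rout r w = i r]) =
         \int[P]_(w in A) (\prod_(r < nr) output_prob (T r w) k (i r))%:E)%E].

Definition beta_fail (n : nat) (mu : probability Xi R) (X : set 'rV[R]_n)
    (f : 'rV[R]_n -> R) (gf : 'rV[R]_n -> 'rV[R]_n)
    (F : 'rV[R]_n -> Xi -> R) (G : 'rV[R]_n -> Xi -> 'rV[R]_n) (L0 : R) : R :=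
  sup [set p | exists x y, [/\ X x, X y &
    p = fine (mu [set u | Num.max L0 (local_curv (F ^~ u) (G ^~ u) x y)
                          <= 1 / 2 * local_curv f gf x y])]].

End Probability.

(* The trajectories of the [nr] runs, as functions of the samples. *)
Definition traj (R : realType) (n : nat) (Xi Omega I : Type)
    (D : acspg R n Xi) (s s' : I -> nat -> nat -> Omega -> Xi)
    (r : I) (w : Omega) : nat -> state R n :=
  acspg_run D (fun t j => s r t j w) (fun t j => s' r t j w).

(* 8 Q_k / M_k.  Both Q_k (through m) and M_k are random and depend on the run.
   The output is compared with an unspecified run among all [nr], so neither
   the constants of the selected run nor those of a fixed run would be
   justified: the bound is the largest ratio over the runs.  A ratio with
   M_k = 0 is +oo, since 0^-1 = +oo in [\bar R]. *)
Definition runs_bound (R : realType) (nr : nat) (Q M : 'I_nr -> R) : \bar R :=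
  (\big[maxe/-oo]_(r < nr) ((8 * Q r)%:E / (M r)%:E))%E.

(* ceil(log_2(2 / delta)) *)
Definition nb_runs (R : realType) (delta : R) : nat :=
  `|Num.ceil (ln (2 / delta) / ln 2)|%N.

Definition lambda_of (R : realType) (delta : R) : R :=
  Num.sqrt (3 * ln (2 * (nb_runs delta)%:R / delta)).

(* Main.v *)
Require Import Defs.
From HB Require Import structures.
From mathcomp Require Import all_boot all_order all_algebra.
From mathcomp Require Import all_classical all_reals all_analysis.
From mathcomp Require Import measurable_realfun.
From mathcomp Require Import ring lra zify.
Set Implicit Arguments.
Unset Strict Implicit.
Unset Printing Implicit Defensive.
Import Order.TTheory GRing.Theory Num.Theory.
Import numFieldNormedType.Exports.
Local Open Scope classical_set_scope.
Local Open Scope ring_scope.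

(** The argument combines a pathwise analysis of a single run, an integration
    of this analysis against the samples, and a selection step.

    Pathwise.  One iteration is a projection, so it satisfies a three-point
    inequality ([prox_step]).  Multiplying by weights that grow by at most one
    along a segment makes the inequalities telescope in the potential
    w (f(x) - min f) + gamma/2 |x - u|^2 ([telescoped_bound]) and leaves, on the
    left, the sum over t of W(t)/gamma_t |g_X(x_{t-1})|^2.  On the right remain
    the lower curvature l, the gradient noise, and the discrepancy between the
    curvature of the step and its estimate.  Within a segment the estimate is at
    most 3/8 of the stepsize, so the proximal term pays for it; the estimates
    that open segments grow geometrically and sum up to at most three times the
    last one ([jump_sum]).  For Estimator I the error bound Q_k is random, as it
    depends on the number of segments; dividing by it is done through a quantity
    known before each iteration that decreases to 1/Q_k ([bound_inv],
    [path_bound_avg]).  For Estimator II Q_k is deterministic, and iterations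
    whose estimate misses half of the curvature are paid by the worst case
    ([path_bound_max]).

    In expectation.  The samples of an iteration are independent of the past, so
    the noise is centred and its second moment is controlled by the batch size
    ([noise_dot_mean], [noise_sqr_mean]).  Estimator I is unbiased
    ([avg_estimate_mean]); Estimator II fails with probability at most
    beta^{b'} <= 1/(k+1)^2 ([max_estimate_fail]).  In both cases the sum S above
    satisfies E[S/Q_k] <= 8/3 ([run_ratio]).

    Selection.  Given a run, its random output satisfies
    E|g_X(x_R)|^2 = S/M_k, so Markov's inequality and the independence of the
    runs show that all the runs have |g_X|^2 > (16/3) Q_k/M_k with probability
    at most 2^{-R} ([far_prob]).  The noise of the post-optimization gradients
    exceeds (1+lambda) sigma/sqrt(K) with probability at most
    2 exp(-(1+lambda)^2/3) by Pinelis' martingale argument ([batch_tail],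
    [noisy_prob]).  Outside these events, choosing the smallest noisy gradient
    costs twice the noise, and (p + 2e)^2 <= 3/2 p^2 + 12 e^2 gives the bound
    ([best_le]), since 3/2 times 16/3 is 8.  The factor 2 is absorbed in the
    shift from lambda to 1 + lambda, unless exp(-lambda^2/3) >= 1/2, where the
    claim is void ([exp_tail_le], [half_pow_union_ge1]).

    The lower bound on M_k rests on M_k being a sum over the iterations
    ([Mk_weight_total]) and on the factor 3/2 gained by Lhat at each new segment
    ([weight_total_ge]). *)

(** * Euclidean geometry *)

Section Euclid.
Context (R : realType) (n : nat).
Implicit Types u v w x y : 'rV[R]_n.

Lemma dotC u v : dot u v = dot v u.
Proof. by apply: eq_bigr => i _; rewrite mulrC. Qed.

Lemma dotDl u v w : dot (u + v) w = dot u w + dot v w.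
Proof. by rewrite -big_split; apply: eq_bigr => i _; rewrite mxE mulrDl. Qed.

Lemma dotZl a u v : dot (a *: u) v = a * dot u v.
Proof. by rewrite mulr_sumr; apply: eq_bigr => i _; rewrite mxE mulrA. Qed.

Lemma dotDr u v w : dot w (u + v) = dot w u + dot w v.
Proof. by rewrite dotC dotDl !(dotC w). Qed.

Lemma dotZr a u v : dot u (a *: v) = a * dot u v.
Proof. by rewrite dotC dotZl dotC. Qed.

Lemma dotNl u v : dot (- u) v = - dot u v.
Proof. by rewrite -scaleN1r dotZl mulN1r. Qed.

Lemma dotNr u v : dot u (- v) = - dot u v.
Proof. by rewrite dotC dotNl dotC. Qed.

Lemma dot0l u : dot 0 u = 0.
Proof. by rewrite -(scale0r 0) dotZl mul0r. Qed.

Lemma dot0r u : dot u 0 = 0.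
Proof. by rewrite dotC dot0l. Qed.

Definition dotE := (dotDl, dotDr, dotNl, dotNr, dotZl, dotZr).

Lemma dotvv_ge0 u : 0 <= dot u u.
Proof. by apply: sumr_ge0 => i _; rewrite -expr2 sqr_ge0. Qed.

Lemma enorm_ge0 u : 0 <= enorm u. Proof. exact: sqrtr_ge0. Qed.

Lemma enorm_sqr u : enorm u ^+ 2 = dot u u.
Proof. by rewrite sqr_sqrtr ?dotvv_ge0. Qed.

Lemma enorm0 : enorm (0 : 'rV[R]_n) = 0.
Proof. by rewrite /enorm dot0l sqrtr0. Qed.

Lemma enormZ a u : enorm (a *: u) = `|a| * enorm u.
Proof. by rewrite /enorm dotZl dotZr mulrA -expr2 sqrtrM ?sqr_ge0// sqrtr_sqr. Qed.

Lemma enormN u : enorm (- u) = enorm u.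
Proof. by rewrite -scaleN1r enormZ normrN1 mul1r. Qed.

Lemma enormB u v : enorm (u - v) = enorm (v - u).
Proof. by rewrite -enormN opprB. Qed.

Lemma coord_le_enorm u i : `|u 0 i| <= enorm u.
Proof.
rewrite -sqrtr_sqr ler_sqrt ?dotvv_ge0// /dot (bigD1 i)//= expr2 lerDl.
by apply: sumr_ge0 => j _; rewrite -expr2 sqr_ge0.
Qed.

Lemma enorm_eq0 u : enorm u = 0 -> u = 0.
Proof.
move=> u0; apply/rowP => i; apply/eqP; rewrite mxE -normr_le0 -u0.
exact: coord_le_enorm.
Qed.

Lemma enorm_le_coord u : enorm u <= \sum_i `|u 0 i|.
Proof.
have s0 : 0 <= \sum_i `|u 0 i| by apply: sumr_ge0.
rewrite -(ler_pXn2r (n := 2))// ?nnegrE ?enorm_ge0// enorm_sqr expr2 mulr_suml.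
apply: ler_sum => i _; rewrite (bigD1 i)//= mulrDr -normrM ler_wpDr ?ler_norm//.
by apply: mulr_ge0 => //; apply: sumr_ge0.
Qed.

Lemma dot_le_enorm u v : dot u v <= enorm u * enorm v.
Proof.
have [v0|v0] := eqVneq (enorm v) 0.
  by rewrite v0 mulr0 (enorm_eq0 v0) dot0r.
have [u0|u0] := eqVneq (enorm u) 0.
  by rewrite u0 mul0r (enorm_eq0 u0) dot0l.
have pv : 0 < enorm v by rewrite lt_neqAle eq_sym v0 enorm_ge0.
have pu : 0 < enorm u by rewrite lt_neqAle eq_sym u0 enorm_ge0.
have := dotvv_ge0 (enorm v *: u - enorm u *: v).
rewrite !dotE -!enorm_sqr (dotC v u) => h.
have {}h : 0 <= (2 * enorm v * enorm u) * (enorm u * enorm v - dot u v).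
  by apply: le_trans h _; rewrite le_eqVlt; apply/orP; left; apply/eqP; ring.
by rewrite -subr_ge0 -(pmulr_rge0 _ (_ : 0 < 2 * enorm v * enorm u))// !mulr_gt0.
Qed.

Lemma normr_dot_le u v : `|dot u v| <= enorm u * enorm v.
Proof. by rewrite ler_norml dot_le_enorm lerNl -dotNl -(enormN u) dot_le_enorm. Qed.

Lemma enorm_sqrD u v :
  enorm (u + v) ^+ 2 = enorm u ^+ 2 + 2 * dot u v + enorm v ^+ 2.
Proof. by rewrite !enorm_sqr !dotE (dotC v u); ring. Qed.

Lemma enorm_sqrB u v :
  enorm (u - v) ^+ 2 = enorm u ^+ 2 - 2 * dot u v + enorm v ^+ 2.
Proof. by rewrite enorm_sqrD enormN dotNr mulrN. Qed.

Lemma enormD u v : enorm (u + v) <= enorm u + enorm v.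
Proof.
rewrite -(ler_pXn2r (n := 2))// ?nnegrE ?addr_ge0 ?enorm_ge0//.
rewrite enorm_sqrD sqrrD; have := dot_le_enorm u v; lra.
Qed.

Lemma dot_young (e : R) u v : 0 < e ->
  - dot u v <= e^-1 * enorm u ^+ 2 + e / 4 * enorm v ^+ 2.
Proof.
move=> e0; have := dotvv_ge0 (e^-1 *: u + 2^-1 *: v).
rewrite !dotE -!enorm_sqr (dotC v u) => h.
have {}h := mulr_ge0 (ltW e0) h.
rewrite -subr_ge0; apply: le_trans h _; rewrite le_eqVlt; apply/orP; left.
by apply/eqP; field; rewrite gt_eqF.
Qed.

Lemma enorm_le_mxnorm u : enorm u <= n.+1%:R * `|u|.
Proof.
apply: le_trans (enorm_le_coord u) _.
apply: (@le_trans _ _ (n%:R * `|u|)); last by rewrite ler_wpM2r// ler_nat.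
rewrite -[X in X%:R](card_ord n) -sumr_const mulr_suml; apply: ler_sum => i _.
rewrite mul1r [`|u|]mx_normrE.
exact: (le_bigmax _ (fun ij : 'I_1 * 'I_n => `|u ij.1 ij.2|) (0, i)).
Qed.

Lemma mxnorm_le_enorm u : `|u| <= enorm u.
Proof.
rewrite [`|u|]mx_normrE; apply: bigmax_le => [|[i j] _ /=]; first exact: enorm_ge0.
by rewrite ord1 coord_le_enorm.
Qed.

(** The topology comes from the sup norm; each of the two norms bounds the other up
to a constant. *)
Lemma nbhs_enormP x (Q : set 'rV[R]_n) :
  nbhs x Q <-> exists2 e : R, 0 < e & forall y, enorm (x - y) < e -> Q y.
Proof.
split=> [/nbhs_ballP[e /= e0 eQ]|[e e0 eQ]].
  exists e => // y xy; apply: eQ; rewrite mx_norm_ball /ball_.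
  exact: le_lt_trans (mxnorm_le_enorm _) xy.
apply/nbhs_ballP; exists (e / n.+1%:R) => /=; first by rewrite divr_gt0.
move=> y; rewrite mx_norm_ball /ball_ /= => xy; apply: eQ.
by apply: le_lt_trans (enorm_le_mxnorm _) _; rewrite -ltr_pdivlMl// mulrC.
Qed.

Lemma dist_enorm_le u v : `|enorm u - enorm v| <= enorm (u - v).
Proof.
rewrite ler_norml lerNl opprB !lerBlDr; apply/andP; split.
  by rewrite enormB -[in leLHS](subrK u v) enormD.
by rewrite -[in leLHS](subrK v u) enormD.
Qed.

Lemma continuous_enormP (h : 'rV[R]_n -> R) :
  (forall x (e : R), 0 < e -> exists2 d : R, 0 < d &
     forall y, enorm (x - y) < d -> `|h x - h y| <= e) -> continuous h.
Proof.
move=> H x; apply/(@cvgrPdist_le _ _ _ _ (nbhs_filter x)) => e e0.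
by have [d d0 dH] := H x e e0; apply/nbhs_enormP; exists d.
Qed.

End Euclid.

(** * Projections and proximal steps *)

Lemma subrBB (V : zmodType) (a b c : V) : (a - b) - (a - c) = c - b.
Proof. by rewrite opprB addrC addrA subrK. Qed.

Section Proximal.
Context (R : realType) (n : nat) (X : set 'rV[R]_n).
Hypotheses (cvX : convex_set X) (cpX : compact X).
Implicit Types u v w x y g : 'rV[R]_n.

Lemma convex_setE x y (t : R) : X x -> X y -> 0 <= t <= 1 ->
  X (t *: x + (1 - t) *: y).
Proof.
move=> Xx Xy /andP[t0 t1].
pose tt : {i01 R} := Itv01 t0 t1.
have := cvX tt (mem_set Xx) (mem_set Xy).
by rewrite inE.
Qed.

(** The variational inequality that characterizes the nearest point of [X]. *)
Definition is_proj y u := X u /\ forall v, X v -> dot (y - u) (v - u) <= 0.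

(** Adding the two variational inequalities, each tested at the other point,
bounds |u1 - u2|^2 by <u1 - u2, y1 - y2>. *)
Lemma is_proj_nonexpansive y1 y2 u1 u2 : is_proj y1 u1 -> is_proj y2 u2 ->
  enorm (u1 - u2) <= enorm (y1 - y2).
Proof.
move=> [X1 P1] [X2 P2]; have [->|u0] := eqVneq (enorm (u1 - u2)) 0.
  exact: enorm_ge0.
have pu : 0 < enorm (u1 - u2) by rewrite lt_neqAle eq_sym u0 enorm_ge0.
rewrite -(ler_pM2l pu) -expr2.
apply: le_trans (dot_le_enorm (u1 - u2) (y1 - y2)).
have := P1 _ X2; have := P2 _ X1; rewrite enorm_sqr !dotE.
rewrite (dotC u2 u1) (dotC y1 u1) (dotC y2 u1) (dotC y1 u2) (dotC y2 u2); lra.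
Qed.

Lemma is_proj_id x : X x -> is_proj x x.
Proof. by move=> Xx; split=> // v _; rewrite subrr dot0l. Qed.

Lemma is_proj_uniq y u1 u2 : is_proj y u1 -> is_proj y u2 -> u1 = u2.
Proof.
move=> P1 P2; have := is_proj_nonexpansive P1 P2; rewrite subrr enorm0 => h.
by apply/eqP; rewrite -subr_eq0; apply/eqP/enorm_eq0/le_anti; rewrite h enorm_ge0.
Qed.

Lemma dot_continuous g : continuous (dot g).
Proof.
apply: continuous_enormP => x e e0.
exists (e / (enorm g + 1)); first by rewrite divr_gt0// ltr_wpDl ?enorm_ge0.
move=> y; rewrite ltr_pdivlMr ?ltr_wpDl ?enorm_ge0// => h.
rewrite -dotNr -dotDr; apply: le_trans (normr_dot_le _ _) _.
have := enorm_ge0 (x - y); have := enorm_ge0 g; nra.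
Qed.

Hypothesis X0 : X !=set0.

Lemma prox_min x g (gam : R) :
  X (prox X x g gam) /\ forall v, X v ->
    dot g (prox X x g gam) + gam / 2 * enorm (x - prox X x g gam) ^+ 2 <=
    dot g v + gam / 2 * enorm (x - v) ^+ 2.
Proof.
pose obj u := dot g u + gam / 2 * enorm (x - u) ^+ 2.
have cobj : {within X, continuous obj}.
  apply: continuous_subspaceT => u.
  have h : {for u, continuous (fun u => enorm (x - u))}.
    apply: (continuous_enormP (h := fun u => enorm (x - u))) => w e e0.
    exists e => // y /ltW; apply: le_trans; apply: le_trans (dist_enorm_le _ _) _.
    by rewrite subrBB enormB.
  have F : Filter (nbhs u) := nbhs_filter u.
  have h2 := @cvgM _ _ _ F _ _ _ _ h h.
  have h3 := @cvgM _ _ _ F _ _ _ _ (cvg_cst (gam / 2) (FF := F)) h2.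
  exact: @cvgD _ _ _ _ F _ _ _ _ (@dot_continuous g u) h3.
have [c cX cmin] := compact_EVT_min X0 cpX cobj.
rewrite /prox; case: xgetP => [u _ [Xu umin]|/(_ c)].
  by split.
move=> []; split; first exact/set_mem.
by move=> v Xv; apply: cmin; rewrite inE.
Qed.

Lemma prox_in x g gam : X (prox X x g gam).
Proof. by have [] := prox_min x g gam. Qed.

(** Minimality is tested along the segment from the minimizer u to v: with A the
scalar product to be shown nonpositive, t A <= t^2/2 |v - u|^2 for t in [0, 1],
which a positive A violates at t = min(1, A / |v - u|^2). *)
Lemma prox_is_proj x g (gam : R) : 0 < gam ->
  is_proj (x - gam^-1 *: g) (prox X x g gam).
Proof.
move=> gam0; have [Xu umin] := prox_min x g gam; set u := prox X x g gam in Xu umin *.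
split=> // v Xv; rewrite leNgt; apply/negP => A0.
pose A := dot (x - gam^-1 *: g - u) (v - u).
pose C := enorm (v - u) ^+ 2.
have C0 : 0 <= C by rewrite sqr_ge0.
pose p := dot g (v - u); pose q := dot (x - u) (v - u).
have EA : A = q - gam^-1 * p by rewrite /A addrAC dotDl dotNl dotZl.
have key (t : R) : 0 <= t <= 1 -> t * A <= t ^+ 2 / 2 * C.
  move=> t01; have := umin _ (convex_setE Xv Xu t01).
  have -> : t *: v + (1 - t) *: u = u + t *: (v - u).
    by rewrite scalerBl scale1r scalerBr addrCA addrA.
  rewrite opprD addrA (enorm_sqrB _ (t *: _)) dotDr !dotZr => h.
  rewrite -(ler_pM2l gam0) EA.
  move: h; rewrite enormZ exprMn real_normK ?num_real// -/C.
  have -> : gam * (t * (q - gam^-1 * p)) = t * (gam * q - p).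
    by field; rewrite gt_eqF.
  rewrite -/p -/q; set e1 := enorm _ ^+ 2; nra.
have [C00|C00] := eqVneq C 0.
  by have := key 1; rewrite ler01 lexx => /(_ isT); rewrite C00 mulr0 mul1r leNgt A0.
have pC : 0 < C by rewrite lt_neqAle eq_sym C00.
pose t := Num.min 1 (A / C).
have pA : 0 < A by [].
have t0 : 0 < t by rewrite /t lt_min ltr01/= divr_gt0.
have t1 : t <= 1 by rewrite /t ge_min lexx.
have tA : t * C <= A by rewrite -ler_pdivlMr// /t ge_min lexx orbT.
have /(_ (introT andP (conj (ltW t0) t1))) := key t.
rewrite expr2 -!mulrA ler_pM2l//; rewrite mulrCA; nra.
Qed.

(** The variational inequality of the projection, with the squares completed. *)
Lemma prox_three_point x g (gam : R) v : 0 < gam -> X v ->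
  dot g (prox X x g gam - v) <=
    gam / 2 * (enorm (x - v) ^+ 2 - enorm (prox X x g gam - v) ^+ 2
               - enorm (x - prox X x g gam) ^+ 2).
Proof.
move=> gam0 Xv; have [_ /(_ v Xv)] := prox_is_proj x g gam0.
set u := prox X x g gam => h.
have -> : enorm (x - v) ^+ 2 =
    enorm (x - u) ^+ 2 - 2 * dot (x - u) (v - u) + enorm (u - v) ^+ 2.
  by rewrite (enormB u) -enorm_sqrB opprB addrA subrK.
rewrite -opprB dotNr.
have {h} : gam * (dot (x - u) (v - u) - gam^-1 * dot g (v - u)) <= 0.
  rewrite pmulr_rle0//; apply: le_trans h.
  by rewrite (addrAC x) (dotDl (x - u)) dotNl dotZl.
rewrite mulrBr mulrA divff ?gt_eqF// mul1r; lra.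
Qed.

Lemma prox_lip x g1 g2 (gam : R) : 0 < gam ->
  enorm (prox X x g1 gam - prox X x g2 gam) <= gam^-1 * enorm (g1 - g2).
Proof.
move=> gam0; have := is_proj_nonexpansive (prox_is_proj x g1 gam0) (prox_is_proj x g2 gam0).
rewrite subrBB -scalerBr enormZ gtr0_norm ?invr_gt0//.
by rewrite (enormB g2).
Qed.

(** The proximal point is 1/gamma-Lipschitz in the gradient, and the gradient
mapping multiplies by gamma. *)
Lemma enorm_proj_grad_lip x g1 g2 (gam : R) : 0 < gam ->
  enorm (proj_grad X x g1 gam - proj_grad X x g2 gam) <= enorm (g1 - g2).
Proof.
move=> gam0; rewrite /proj_grad -scalerBr enormZ gtr0_norm//.
by rewrite subrBB -ler_pdivlMl// enormB prox_lip.
Qed.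

(** Composing with [proj] extends functions on [X] to the whole space. *)
Definition proj y := prox X y 0 1.

Lemma projP y : is_proj y (proj y).
Proof. by have := prox_is_proj y 0 ltr01; rewrite scaler0 subr0. Qed.

Lemma proj_in y : X (proj y). Proof. by case: (projP y). Qed.

Lemma proj_id x : X x -> proj x = x.
Proof. by move=> Xx; exact: is_proj_uniq (projP x) (is_proj_id Xx). Qed.

Lemma proj_lip y1 y2 : enorm (proj y1 - proj y2) <= enorm (y1 - y2).
Proof. exact: is_proj_nonexpansive (projP y1) (projP y2). Qed.

Lemma prox_proj x g (gam : R) : 0 < gam -> prox X x g gam = proj (x - gam^-1 *: g).
Proof. by move=> gam0; exact: is_proj_uniq (prox_is_proj x g gam0) (projP _). Qed.

End Proximal.

Section Diameter.
Context (R : realType) (n : nat) (X : set 'rV[R]_n).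
Hypothesis (cpX : compact X).

Lemma enorm_le_diam x y : X x -> X y -> enorm (x - y) <= diam X.
Proof.
move=> Xx Xy.
have /ex_strict_bound_gt0[M M0 HM] := compact_bounded cpX.
apply: sup_ubound; last by exists x, y.
exists (n.+1%:R * (M + M)) => _ [a [b [Xa Xb ->]]].
apply: le_trans (enorm_le_mxnorm _) _; rewrite ler_wpM2l//.
apply: le_trans (ler_normB _ _) _; apply: lerD; exact/ltW/HM.
Qed.

Lemma diam_ge0 x : X x -> 0 <= diam X.
Proof. by move=> Xx; have := enorm_le_diam Xx Xx; apply/le_trans/enorm_ge0. Qed.

End Diameter.

(** * Segments of a run *)

Section SegmentCombinatorics.
Context (R : realType) (n : nat) (tr : nat -> state R n) (ns : nat -> bool).
(* [ns t] holds when a new segment starts at time [t]. *)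
Hypotheses (idx0 : idx (tr 0) = 0%N) (seg0 : seg (tr 0) = 1%N).
Hypothesis idxS : forall t, idx (tr t.+1) = if ns t.+1 then 1%N else (idx (tr t)).+1.
Hypothesis segS : forall t, seg (tr t.+1) = if ns t.+1 then (seg (tr t)).+1 else seg (tr t).
Hypothesis ns1 : ns 1 = false.

Lemma idx_gt0 t : (0 < t)%N -> (0 < idx (tr t))%N.
Proof. by case: t => // t _; rewrite idxS; case: ifP. Qed.

Lemma seg_gt0 t : (0 < seg (tr t))%N.
Proof. by elim: t => [|t IH]; rewrite ?seg0// segS; case: ifP. Qed.

(** Every iteration increases the position by one, unless it resets the position
to one and increases the segment. *)
Lemma idx_seg_le t : (idx (tr t) + seg (tr t) <= t.+1)%N.
Proof.
elim: t => [|t IH]; first by rewrite idx0 seg0.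
rewrite idxS segS; case: ifP => [nst|_]; last by rewrite addSn ltnS.
have t0 : (0 < t)%N by case: t nst {IH} => //; rewrite ns1.
by have := idx_gt0 t0; lia.
Qed.

Lemma idx_le t : (idx (tr t) <= t)%N.
Proof. by have := idx_seg_le t; have := seg_gt0 t; lia. Qed.

Lemma seg_le t : (0 < t)%N -> (seg (tr t) <= t)%N.
Proof. by move=> t0; have := idx_seg_le t; have := idx_gt0 t0; lia. Qed.

Lemma good_steps_mono t : (t - seg (tr t) <= t.+1 - seg (tr t.+1))%N.
Proof. by rewrite segS; case: ifP => _; have := seg_gt0 t; lia. Qed.

(** The pair (segment, position) increases lexicographically, so it identifies
the iteration. *)
Lemma seg_idx_lt s t : (s < t)%N ->
  (seg (tr s) < seg (tr t))%N \/
  seg (tr s) = seg (tr t) /\ (idx (tr s) < idx (tr t))%N.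
Proof.
elim: t => // t IH; rewrite ltnS leq_eqVlt => /predU1P[->|/IH].
  by rewrite idxS segS; case: ifP => _; [left|right].
by rewrite idxS segS; case: ifP => _ [|[-> ]]; [left|left|left|right]; lia.
Qed.

Lemma seg_posE K t : (t <= K)%N -> seg_pos tr K (seg (tr t)) (idx (tr t)) = t.
Proof.
move=> tK; rewrite /seg_pos -(cat_take_drop t (iota 0 K.+1)) find_cat.
rewrite take_iota drop_iota size_iota add0n.
have -> : minn t K.+1 = t by lia.
case: hasP => [[s]|_].
  rewrite mem_iota add0n /= => st /andP[/eqP e1 /eqP e2].
  by have [|[_]] := seg_idx_lt st; rewrite ?e1 ?e2 ltnn.
have -> : (K.+1 - t = (K - t).+1)%N by lia.
by rewrite /= !eqxx/= addn0.
Qed.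

Lemma seg_lenS k i : seg_len tr k.+1 i = (seg_len tr k i + (seg (tr k.+1) == i))%N.
Proof. by rewrite /seg_len -[in LHS](addn1 k) iotaD count_cat /= addn0 add1n. Qed.

Lemma seg_len_eq0 k i : (seg (tr k) < i)%N -> seg_len tr k i = 0%N.
Proof.
elim: k => // k IH; rewrite seg_lenS segS; case: ifP => _ h.
  by rewrite IH 1?ltn_eqF//; lia.
by rewrite IH ?ltn_eqF.
Qed.

Lemma seg_lenE t : seg_len tr t (seg (tr t)) = idx (tr t).
Proof.
elim: t => [|t IH]; first by rewrite idx0.
rewrite seg_lenS eqxx segS idxS addn1; case: ifP => _; last by rewrite IH.
by rewrite seg_len_eq0.
Qed.

Lemma sum_by_seg K (psi : nat -> nat -> R) i k : (k <= K)%N ->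
  \sum_(1 <= t < k.+1 | seg (tr t) == i) psi t (idx (tr t)) =
  \sum_(1 <= j < (seg_len tr k i).+1) psi (seg_pos tr K i j) j.
Proof.
elim: k => [_|k IH kK]; first by rewrite !big_geq.
rewrite big_mkcond big_nat_recr//= -big_mkcond /= IH ?(ltnW kK)// seg_lenS.
case: eqP => [e|_]; last by rewrite addn0 addr0.
rewrite addn1 [RHS]big_nat_recr//=; congr (_ + _).
have -> : (seg_len tr k i).+1 = idx (tr k.+1).
  by rewrite -seg_lenE e seg_lenS e eqxx addn1.
by rewrite -e seg_posE.
Qed.

Lemma seg_le_mono s t : (s <= t)%N -> (seg (tr s) <= seg (tr t))%N.
Proof. by rewrite leq_eqVlt => /predU1P[->//|/seg_idx_lt[/ltnW|[->]]]. Qed.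

(** Summing over the segments or over the iterations is the same: a time is
determined by its segment and its position in the segment, and the first
iterate of a segment has weight zero. *)
Lemma Mk_weight_total k : Mk tr k = weight_total tr k.
Proof.
pose psi t j : R := (if (2 <= j)%N then 3 * j%:R / 16 - 1 / 4 else 0) / stepsize tr t.
transitivity (\sum_(1 <= i < (nb_segs tr k).+1)
    \sum_(1 <= t < k.+1 | seg (tr t) == i) psi t (idx (tr t))).
  rewrite /Mk; apply: eq_bigr => i _; rewrite (@sum_by_seg k psi i k)//.
  case: (seg_len tr k i) => [|s]; first by rewrite !big_geq.
  rewrite [RHS]big_ltn// {1}/psi /= mul0r add0r. apply: eq_big_nat => j.
  by move=> /andP[j2 _]; rewrite /psi j2; congr (_ * _); rewrite div1r.
under eq_bigr do rewrite big_mkcond.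
rewrite exchange_big /weight_total; apply: eq_big_nat => t /andP[t1 tk] /=.
rewrite -/(psi t (idx (tr t))) -big_mkcond /= -big_filter.
have -> : [seq i <- index_iota 1 (nb_segs tr k).+1 | seg (tr t) == i] = [:: seg (tr t)].
  rewrite (@eq_filter _ _ (pred1 (seg (tr t)))); last by move=> i; rewrite /= eq_sym.
  rewrite filter_pred1_uniq ?iota_uniq// mem_index_iota seg_gt0/= ltnS.
  by rewrite seg_le_mono// -ltnS.
by rewrite big_seq1.
Qed.

Hypothesis Lhat0 : 0 < Lhat (tr 0).
Hypothesis LhatS : forall t, Lhat (tr t) <= Lhat (tr t.+1).
Hypothesis Lhat_jump : forall t, ns t.+1 -> 3 / 2 * Lhat (tr t) <= Lhat (tr t.+1).

Lemma Lhat_mono s t : (s <= t)%N -> Lhat (tr s) <= Lhat (tr t).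
Proof.
elim: t => [|t IH]; first by rewrite leqn0 => /eqP->.
rewrite leq_eqVlt => /predU1P[->//|]; rewrite ltnS => /IH h.
exact: le_trans h (LhatS t).
Qed.

Lemma Lhat_gt0 t : 0 < Lhat (tr t).
Proof. exact: lt_le_trans Lhat0 (Lhat_mono (leq0n t)). Qed.

Lemma stepsize_gt0 t : 0 < stepsize tr t.
Proof. by rewrite /stepsize mulr_gt0// Lhat_gt0. Qed.

Lemma weight_ge0 t : 0 <= weight tr t.
Proof.
rewrite /weight; case: ifP => // h.
have : 2 <= (idx (tr t))%:R :> R by rewrite (ler_nat _ 2).
lra.
Qed.

(** A new segment multiplies the stepsize by 3/2, so the contributions of the
earlier segments to the total weight are amplified geometrically; this is what
keeps the bound independent of the number of segments.  The invariant tracks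
the current segment (of length [u + 1]) apart from the earlier ones ([v]), and
both inductive steps rest on (u + v)^2 <= 3 u^2 + 3/2 v^2. *)
Lemma weight_total_ge k : (0 < k)%N ->
  (k%:R - (seg (tr k))%:R) ^+ 2 / (128 * Lhat (tr k.-1)) <= weight_total tr k.
Proof.
pose u t : R := (idx (tr t))%:R - 1; pose m t : R := t%:R - (seg (tr t))%:R.
pose v t := m t - u t.
have wS t : weight_total tr t.+1 = weight_total tr t + weight tr t.+1 / (4 * Lhat (tr t)).
  by rewrite /weight_total big_nat_recr.
have sqD (a b : R) : (a + b) ^+ 2 <= 3 * a ^+ 2 + 3 / 2 * b ^+ 2.
  have := sqr_ge0 (2 * a - b); rewrite !expr2; nra.
have step t : (0 < t)%N ->
  3 * u t ^+ 2 + u t + 3 / 2 * v t ^+ 2 <= 128 * weight_total tr t * Lhat (tr t) ->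
  m t.+1 ^+ 2 <= 128 * weight_total tr t.+1 * Lhat (tr t) /\
  3 * u t.+1 ^+ 2 + u t.+1 + 3 / 2 * v t.+1 ^+ 2 <=
    128 * weight_total tr t.+1 * Lhat (tr t.+1).
  move=> t0 IH; have L0 := Lhat_gt0 t; have L1 := LhatS t.
  have u0 : 0 <= u t by rewrite subr_ge0 (ler_nat _ 1) idx_gt0.
  have w0 : 0 <= weight_total tr t.
    apply: sumr_ge0 => j _; apply: divr_ge0; first exact: weight_ge0.
    exact/ltW/stepsize_gt0.
  have := wS t; rewrite /weight; move: (Lhat_jump (t := t)).
  have mE : m t = u t + v t by rewrite /v addrC subrK.
  have := sqD (u t) (v t); rewrite -mE.
  rewrite /v /u /m idxS segS; case nst: (ns t.+1) => sq.
    move=> /(_ isT) Lj; rewrite /= mul0r addr0 => ->.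
    have -> : t.+1%:R - (seg (tr t)).+1%:R = m t by rewrite /m -!natr1; ring.
    rewrite subrr expr0n /= mulr0 !add0r subr0.
    move: sq IH u0; rewrite /v /u /m => sq IH u0; split; first by lra.
    have h : 128 * weight_total tr t * (3 / 2 * Lhat (tr t)) <=
      128 * weight_total tr t * Lhat (tr t.+1) by rewrite ler_wpM2l// mulr_ge0.
    lra.
  move=> _; rewrite ltnS idx_gt0// => e.
  have eE : 128 * weight_total tr t.+1 * Lhat (tr t) =
     128 * weight_total tr t * Lhat (tr t) + 6 * (idx (tr t)).+1%:R - 8.
    by rewrite e; field; rewrite gt_eqF.
  have h : 128 * weight_total tr t.+1 * Lhat (tr t) <=
      128 * weight_total tr t.+1 * Lhat (tr t.+1).
    rewrite ler_wpM2l// mulr_ge0// e addr_ge0//.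
    apply: divr_ge0; last by rewrite mulr_ge0// ltW.
    have : 2 <= (idx (tr t)).+1%:R :> R by rewrite (ler_nat _ 2) ltnS idx_gt0.
    lra.
  move: IH u0 sq eE h; rewrite /v /u /m -[t.+1%:R]natr1 -[(idx (tr t)).+1%:R]natr1.
  set I := (idx _)%:R; set S := (seg _)%:R; set T := t%:R.
  move: (128 * weight_total tr t.+1 * Lhat (tr t)) => x.
  move: (128 * weight_total tr t * Lhat (tr t)) => y.
  move: (128 * weight_total tr t.+1 * Lhat (tr t.+1)) => z.
  move=> IH u0 sq eE h.
  have sq' := sqD I (T - S - (I - 1)).
  split; nra.
case: k => // k _; rewrite -pred_Sn ler_pdivrMr ?mulr_gt0 ?Lhat_gt0// mulrCA mulrA.
case: k => [|k].
  rewrite segS ns1 seg0 subrr expr0n /= /weight_total big_nat1 /weight idxS ns1 idx0.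
  by rewrite /= mul0r mulr0 mul0r.
suff inv t : (0 < t)%N ->
    3 * u t ^+ 2 + u t + 3 / 2 * v t ^+ 2 <= 128 * weight_total tr t * Lhat (tr t).
  by have [] := step k.+1 isT (inv k.+1 isT).
elim: t => // -[_ _|t IHt _]; last by have [] := step t.+1 isT (IHt isT).
rewrite /u /v /m /u idxS segS ns1 idx0 seg0 /weight_total big_nat1 /weight idxS ns1 idx0.
by rewrite !subrr /= mul0r mulr0 mul0r expr0n /= !mulr0 !addr0.
Qed.

End SegmentCombinatorics.

(** * Descent in one iteration *)

Section ProximalStep.
Context (R : realType) (n : nat) (X : set 'rV[R]_n).
Context (f : 'rV[R]_n -> R) (gf : 'rV[R]_n -> 'rV[R]_n) (l : R).
Hypotheses (cvX : convex_set X) (cpX : compact X) (l0 : 0 <= l).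
Hypothesis lower_curv : forall x y, X x -> X y ->
  - (l / 2) * enorm (x - y) ^+ 2 <= f x - f y - dot (gf y) (x - y).

(** L_{x,y} |x - y|^2, which avoids the division in L_{x,y}. *)
Definition curv (x y : 'rV[R]_n) : R := 2 * (f x - f y - dot (gf y) (x - y)).

(** The three-point inequality is used against u with weight 1 and against the
previous iterate with weight w - 1, so that the lower curvature is paid only
once; by Young's inequality a quarter of the proximal term absorbs the part of
the noise that is correlated with the step. *)
Lemma prox_step (x u dlt : 'rV[R]_n) (gam w : R) :
  let x' := prox X x (gf x + dlt) gam in
  X x -> X u -> 0 < gam -> 1 <= w ->
  w * (f x' - f u) - (w - 1) * (f x - f u) + gam / 2 * enorm (x' - u) ^+ 2 <=
  gam / 2 * enorm (x - u) ^+ 2 + l / 2 * diam X ^+ 2 - dot dlt (x - u)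
  + w * (enorm dlt ^+ 2 / gam)
  + (w * curv x' x / 2 - (3 * w / 4 - 1 / 2) * gam * enorm (x' - x) ^+ 2).
Proof.
move=> x' Xx Xu gam0 w1.
have X0 : X !=set0 by exists x.
have := prox_three_point cvX cpX X0 x (gf x + dlt) gam0 Xu.
have := prox_three_point cvX cpX X0 x (gf x + dlt) gam0 Xx.
rewrite -/x' subrr enorm0 expr0n /= sub0r (enormB x x').
rewrite !dotDl => px pu.
have lc := lower_curv Xu Xx.
have lD : l / 2 * enorm (u - x) ^+ 2 <= l / 2 * diam X ^+ 2.
  rewrite ler_wpM2l ?divr_ge0//; apply: lerXn2r.
  - by rewrite nnegrE enorm_ge0.
  - by rewrite nnegrE (diam_ge0 cpX Xx).
  - exact: enorm_le_diam.
have yg : - dot dlt (x' - x) <= enorm dlt ^+ 2 / gam + gam / 4 * enorm (x' - x) ^+ 2.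
  by have := dot_young dlt (x' - x) gam0; rewrite (mulrC gam^-1).
have e1 : dot (gf x) (x' - u) = dot (gf x) (x' - x) - dot (gf x) (u - x).
  by rewrite -dotNr -dotDr opprB addrA subrK.
have e2 : dot dlt (x' - u) = dot dlt (x' - x) + dot dlt (x - u).
  by rewrite -dotDr addrA subrK.
move: px pu lc lD yg; rewrite {}e1 {}e2 /curv.
move: (dot (gf x) (x' - x)) (dot (gf x) (u - x)) (dot dlt (x' - x)) (dot dlt (x - u)).
move=> a b c e.
move: (enorm (x' - x) ^+ 2) (enorm (x - u) ^+ 2) (enorm (x' - u) ^+ 2).
move=> dd xu x'u; move: (enorm dlt ^+ 2 / gam) (diam X ^+ 2) (enorm (u - x) ^+ 2).
move=> N D2 ux px pu lc lD yg.
have h1 : (w - 1) * (a + c) <= (w - 1) * (- gam * dd).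
  by rewrite ler_wpM2l ?subr_ge0//; lra.
have h2 : w * - c <= w * (N + gam / 4 * dd) by rewrite ler_wpM2l//; lra.
lra.
Qed.

(** The exact and the noisy gradient mappings differ by at most the noise, and
(p + q)^2 <= 3/2 p^2 + 3 q^2. *)
Lemma proj_grad_le (x dlt : 'rV[R]_n) (gam : R) : X x -> 0 < gam ->
  enorm (proj_grad X x (gf x) gam) ^+ 2 / gam <=
  3 / 2 * gam * enorm (prox X x (gf x + dlt) gam - x) ^+ 2
  + 3 * (enorm dlt ^+ 2 / gam).
Proof.
move=> Xx gam0; have X0 : X !=set0 by exists x.
set d := enorm (prox X x _ gam - x).
have h : enorm (proj_grad X x (gf x) gam) <= gam * d + enorm dlt.
  rewrite -[X in enorm X <= _](subrK (proj_grad X x (gf x + dlt) gam)).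
  apply: le_trans (enormD _ _) _; rewrite addrC lerD//.
    by rewrite /proj_grad enormZ gtr0_norm// enormB.
  apply: le_trans (enorm_proj_grad_lip cvX cpX X0 _ _ _ gam0) _.
  by rewrite opprD addrA subrr sub0r enormN.
have h0 := enorm_ge0 (proj_grad X x (gf x) gam).
have d0 : 0 <= d := enorm_ge0 _; have e0 := enorm_ge0 dlt.
rewrite ler_pdivrMr// mulrDl -!mulrA mulVf ?gt_eqF// mulr1.
have := mulr_ge0 (ltW gam0) d0; move: h h0 e0; rewrite mulrA.
set G := enorm _; set e := enorm dlt => h h0 e0 gd0.
have : G ^+ 2 <= (gam * d + e) ^+ 2 by rewrite ler_pXn2r// nnegrE; lra.
have := sqr_ge0 (gam * d - 2 * e); rewrite !expr2; nra.
Qed.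

(** What the proximal term has to absorb: the curvature of the step, and a
multiple of the gradient mapping that is added to the left-hand side. *)
Definition excess (rho w W gam : R) (x x' : 'rV[R]_n) : R :=
  w * curv x' x / 2 - (3 * w / 4 - 1 / 2 - 3 / 2 * rho * W) * gam * enorm (x' - x) ^+ 2.

Lemma prox_step_grad (x u dlt : 'rV[R]_n) (gam w rho W : R) :
  let x' := prox X x (gf x + dlt) gam in
  X x -> X u -> 0 < gam -> 1 <= w -> 0 <= rho -> 0 <= W ->
  w * (f x' - f u) - (w - 1) * (f x - f u) + gam / 2 * enorm (x' - u) ^+ 2
  + rho * (W / gam * enorm (proj_grad X x (gf x) gam) ^+ 2) <=
  gam / 2 * enorm (x - u) ^+ 2 + l / 2 * diam X ^+ 2 - dot dlt (x - u)
  + (w + 3 * rho * W) * (enorm dlt ^+ 2 / gam) + excess rho w W gam x x'.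
Proof.
move=> x' Xx Xu gam0 w1 rho0 W0.
have := prox_step dlt Xx Xu gam0 w1; have := proj_grad_le dlt Xx gam0.
rewrite -/x' /excess.
have -> : W / gam * enorm (proj_grad X x (gf x) gam) ^+ 2 =
    W * (enorm (proj_grad X x (gf x) gam) ^+ 2 / gam) by ring.
move: (_ / gam) (_ / gam) => G N hG.
have := ler_wpM2l (mulr_ge0 rho0 W0) hG.
move: (curv _ _) (enorm (x' - x) ^+ 2) (enorm (x - u) ^+ 2) (enorm (x' - u) ^+ 2) => *.
lra.
Qed.

End ProximalStep.

(** * Pathwise bound of a run *)

Section RunAnalysis.
Context (R : realType) (n : nat) (X : set 'rV[R]_n).
Context (f : 'rV[R]_n -> R) (gf : 'rV[R]_n -> 'rV[R]_n) (l : R).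
Hypotheses (cvX : convex_set X) (cpX : compact X) (l0 : 0 <= l).
Hypothesis lower_curv : forall x y, X x -> X y ->
  - (l / 2) * enorm (x - y) ^+ 2 <= f x - f y - dot (gf y) (x - y).

Context (tr : nat -> state R n) (ns : nat -> bool).
Context (dlt : nat -> 'rV[R]_n) (Lb : nat -> R).
(* [dlt t] is the gradient noise and [Lb t] the estimate of iteration [t]. *)
Let x_ t := iterate (tr t).
Hypothesis X_0 : X (iterate (tr 0)).
Hypothesis trS : forall t, iterate (tr t.+1) =
  prox X (iterate (tr t)) (gf (iterate (tr t)) + dlt t.+1) (stepsize tr t.+1).
Hypothesis LhatS : forall t, Lhat (tr t.+1) = Num.max (Lhat (tr t)) (Lb t.+1).
Hypothesis nsE : forall t, ns t = (1 < t)%N && (3 / 2 * Lhat (tr t.-1) < Lb t).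
Hypotheses (idx0 : idx (tr 0) = 0%N) (seg0 : seg (tr 0) = 1%N).
Hypothesis idxS : forall t, idx (tr t.+1) = if ns t.+1 then 1%N else (idx (tr t)).+1.
Hypothesis segS : forall t, seg (tr t.+1) = if ns t.+1 then (seg (tr t)).+1 else seg (tr t).
Hypothesis L0_gt0 : 0 < Lhat (tr 0).

Let ns1 : ns 1 = false. Proof. by rewrite nsE. Qed.
Let LhatS_le t : Lhat (tr t) <= Lhat (tr t.+1).
Proof. by rewrite LhatS le_max lexx. Qed.
Let Lpos := Lhat_gt0 L0_gt0 LhatS_le.
Let gpos := stepsize_gt0 L0_gt0 LhatS_le.

Let X_ t : X (x_ t).
Proof.
elim: t => // t IH; rewrite /x_ trS; apply: prox_in => //.
by exists (x_ 0).
Qed.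

Let Lhat_jump t : ns t.+1 -> 3 / 2 * Lhat (tr t) <= Lhat (tr t.+1).
Proof. by rewrite nsE LhatS le_max => /andP[_ /ltW ->]; rewrite orbT. Qed.

Lemma Lb_le_Lhat t : Lb t.+1 <= Lhat (tr t.+1).
Proof. by rewrite LhatS le_max lexx orbT. Qed.

(** An estimate that opens a segment exceeds 3/2 times all the previous ones, so
the sum is dominated by its last term. *)
Lemma jump_sum k :
  \sum_(1 <= t < k.+1) (if (t == 1)%N || ns t then Num.max 0 (Lb t) else 0)
    <= 3 * Lhat (tr k).
Proof.
elim: k => [|k IH]; first by rewrite big_geq// mulr_ge0// ltW.
rewrite big_nat_recr//=; have L1 := LhatS_le k; have := Lb_le_Lhat k.
have Lk := Lpos k; have Lk1 := Lpos k.+1.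
case: eqP => [[k0]|_] /= h.
  by rewrite k0 big_geq// add0r ge_max; apply/andP; split; move: h Lk Lk1; rewrite k0; lra.
case nsk: (ns k.+1); last by lra.
have := nsk; rewrite nsE /= => /andP[_ j].
rewrite max_r; first by lra.
lra.
Qed.

(** As [w] grows by at most one, the potential w (f(x) - min f) + gamma/2 |x - u|^2
telescopes; the increments of the stepsize are charged to the diameter. *)
Lemma telescoped_bound (u : 'rV[R]_n) (rho : R) (r w W : nat -> R) k :
  X u -> (forall x, X x -> f u <= f x) -> 0 <= rho ->
  (forall t, 0 <= r t) -> (forall t, (0 < t)%N -> r t.+1 <= r t) ->
  w 1 = 1 -> (forall t, (0 < t)%N -> 1 <= w t) ->
  (forall t, (0 < t)%N -> w t.+1 - 1 <= w t) -> (forall t, 0 <= W t) ->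
  rho * \sum_(1 <= t < k.+2)
     r t * (W t / stepsize tr t * enorm (iter_grad X gf tr t.-1) ^+ 2) <=
  r 1%N * (stepsize tr k.+1 / 2 * diam X ^+ 2) +
  \sum_(1 <= t < k.+2) r t * (l / 2 * diam X ^+ 2 - dot (dlt t) (x_ t.-1 - u)
     + (w t + 3 * rho * W t) * (enorm (dlt t) ^+ 2 / stepsize tr t)
     + excess f gf rho (w t) (W t) (stepsize tr t) (x_ t.-1) (x_ t)).
Proof.
move=> Xu fmin rho0 r0 rS w1 wge wS W0.
pose Sg t := W t / stepsize tr t * enorm (iter_grad X gf tr t.-1) ^+ 2.
pose Er t := l / 2 * diam X ^+ 2 - dot (dlt t) (x_ t.-1 - u)
     + (w t + 3 * rho * W t) * (enorm (dlt t) ^+ 2 / stepsize tr t)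
     + excess f gf rho (w t) (W t) (stepsize tr t) (x_ t.-1) (x_ t).
rewrite -[leRHS]/(_ + \sum_(1 <= t < k.+2) r t * Er t).
rewrite -[leLHS]/(rho * \sum_(1 <= t < k.+2) r t * Sg t).
have D0 : 0 <= diam X ^+ 2 by rewrite sqr_ge0.
have step t : w t.+1 * (f (x_ t.+1) - f u) - (w t.+1 - 1) * (f (x_ t) - f u)
    + stepsize tr t.+1 / 2 * enorm (x_ t.+1 - u) ^+ 2 + rho * Sg t.+1 <=
    stepsize tr t.+1 / 2 * enorm (x_ t - u) ^+ 2 + Er t.+1.
  have := @prox_step_grad R n X f gf l cvX cpX l0 lower_curv (x_ t) u (dlt t.+1)
    (stepsize tr t.+1) (w t.+1) rho (W t.+1) (X_ t) Xu (gpos _) (wge t.+1 isT) rho0 (W0 _).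
  by rewrite -trS /Sg /Er /iter_grad /=; lra.
clearbody Sg Er.
have De t : enorm (x_ t - u) ^+ 2 <= diam X ^+ 2.
  apply: lerXn2r; first by rewrite nnegrE enorm_ge0.
    by rewrite nnegrE (diam_ge0 cpX Xu).
  exact: enorm_le_diam.
have fu t : 0 <= f (x_ t) - f u by rewrite subr_ge0; exact/fmin/X_.
suff : rho * \sum_(1 <= t < k.+2) r t * Sg t + r k.+1 * (w k.+1 * (f (x_ k.+1) - f u))
       + r k.+1 * (stepsize tr k.+1 / 2 * enorm (x_ k.+1 - u) ^+ 2) <=
       r 1%N * (stepsize tr k.+1 / 2 * diam X ^+ 2) +
       \sum_(1 <= t < k.+2) r t * Er t.
  apply: le_trans; rewrite -addrA lerDl addr_ge0//.
    by rewrite !mulr_ge0//; have := wge k.+1 isT; lra.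
  by rewrite mulr_ge0// mulr_ge0 ?sqr_ge0// divr_ge0// ltW.
elim: k => [|k IH].
  rewrite !big_nat1; have := ler_wpM2l (r0 1%N) (step 0%N); rewrite w1 subrr mul0r subr0.
  have : r 1%N * (stepsize tr 1 / 2 * enorm (x_ 0 - u) ^+ 2) <=
         r 1%N * (stepsize tr 1 / 2 * diam X ^+ 2).
    by rewrite ler_wpM2l// ler_wpM2l// divr_ge0// ltW.
  rewrite !mulrDr mul1r (mulrCA rho); lra.
rewrite big_nat_recr//= [X in _ <= _ + X]big_nat_recr//= mulrDr.
have := ler_wpM2l (r0 k.+2) (step k.+1); rewrite !(mulrDr (r _)) !mulrN (mulrCA _ rho).
have h1 : r k.+2 * ((w k.+2 - 1) * (f (x_ k.+1) - f u)) <=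
          r k.+1 * (w k.+1 * (f (x_ k.+1) - f u)).
  rewrite !mulrA ler_wpM2r//; apply: le_trans (ler_wpM2l (r0 _) (wS k.+1 isT)) _.
  by rewrite ler_wpM2r ?rS//; have := wge k.+1 isT; lra.
have h2 : r k.+2 * (stepsize tr k.+2 / 2 * enorm (x_ k.+1 - u) ^+ 2) <=
   r k.+1 * (stepsize tr k.+1 / 2 * enorm (x_ k.+1 - u) ^+ 2) +
   r 1%N * ((stepsize tr k.+2 - stepsize tr k.+1) / 2 * diam X ^+ 2).
  have g12 : stepsize tr k.+1 <= stepsize tr k.+2 by rewrite /stepsize ler_pM2l.
  have r1 : r k.+1 <= r 1%N.
    by elim: (k) => // j IHj; apply: le_trans IHj; exact: rS.
  have a1 : r k.+2 * (stepsize tr k.+2 / 2 * enorm (x_ k.+1 - u) ^+ 2) <=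
            r k.+1 * (stepsize tr k.+2 / 2 * enorm (x_ k.+1 - u) ^+ 2).
    by rewrite ler_wpM2r ?rS// mulr_ge0 ?sqr_ge0// divr_ge0// ltW.
  have a2 : r k.+1 * ((stepsize tr k.+2 - stepsize tr k.+1) / 2 * enorm (x_ k.+1 - u) ^+ 2) <=
            r 1%N * ((stepsize tr k.+2 - stepsize tr k.+1) / 2 * diam X ^+ 2).
    apply: ler_pM => //; last by rewrite ler_wpM2l// divr_ge0// subr_ge0.
    by rewrite mulr_ge0 ?sqr_ge0// divr_ge0// subr_ge0.
  by move: a1 a2; rewrite mulrBl mulrBl mulrBr; lra.
move: h2; rewrite mulrBl mulrBl mulrBr; lra.
Qed.

Let idx_pos := idx_gt0 idxS.
Let wt_ge0 t : 0 <= weight tr t := weight_ge0 tr t.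

Lemma weight_bad t : idx (tr t) = 1%N -> weight tr t = 0.
Proof. by rewrite /weight => ->. Qed.

Lemma weight_good t : (2 <= idx (tr t))%N ->
  weight tr t = 3 * (idx (tr t))%:R / 16 - 1 / 4.
Proof. by rewrite /weight => ->. Qed.

(** The batch sizes are proportional to this coefficient over the stepsize. *)
Definition batch_coef t : R := 11 * (idx (tr t.-1))%:R / 8 + 7 / 8.
Let prefactor t : R := (idx (tr t.-1)).+1%:R.

(** The factor 31/22 gives both sides the same slope in the position [idx]. *)
Lemma noise_coef_le (rho w : R) t : (0 < t)%N -> 0 <= rho <= 5 / 3 -> w <= prefactor t ->
  w + 3 * rho * weight tr t <= 31 / 22 * batch_coef t.
Proof.
case: t => // t _ /andP[r0 r1]; rewrite /prefactor /batch_coef /= => wp.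
have w0 := wt_ge0 t.+1.
have h : 3 * rho * weight tr t.+1 <= 5 * weight tr t.+1 by rewrite ler_wpM2r//; lra.
have i0 : 0 <= (idx (tr t))%:R :> R by [].
move: wp; rewrite -[X in _ <= X -> _]natr1 => wp.
have [i2|i2] := leqP 2 (idx (tr t.+1)).
  have e := weight_good i2; move: i2 e; rewrite idxS; case: (ns t.+1) => //.
  rewrite ltnS => i1 e.
  have : 1 <= (idx (tr t))%:R :> R by rewrite (ler_nat _ 1).
  by move: h; rewrite e -natr1; lra.
rewrite weight_bad ?mulr0 ?addr0; last first.
  by move: i2 (idx_pos (ltn0Sn t)); case: (idx _) => [//|[//|?]].
lra.
Qed.

Let dd t := enorm (x_ t - x_ t.-1) ^+ 2.
Let cv t := curv f gf (x_ t) (x_ t.-1).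

Let dd_ge0 t : 0 <= dd t. Proof. exact: sqr_ge0. Qed.
Let dd_le t : dd t <= diam X ^+ 2.
Proof.
apply: lerXn2r; rewrite ?nnegrE ?enorm_ge0 ?(diam_ge0 cpX X_0)//.
exact: enorm_le_diam.
Qed.

(** Within a segment the estimate is at most 3/8 of the stepsize and the proximal
term pays for it; where a segment opens the weight vanishes, and the estimate
itself remains.  The difference between curvature and estimate is kept, because
it vanishes in expectation. *)
Lemma excess_avg t : (0 < t)%N ->
  excess f gf (5 / 3) (prefactor t) (weight tr t) (stepsize tr t) (x_ t.-1) (x_ t) <=
  prefactor t / 2 * (cv t - Lb t * dd t) +
  prefactor t * (diam X ^+ 2 / 2) * (if (t == 1)%N || ns t then Num.max 0 (Lb t) else 0).
Proof.
case: t => // t _; rewrite /excess -/(cv _) -/(dd _).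
have gE : stepsize tr t.+1 = 4 * Lhat (tr t) by [].
have g0 := gpos t.+1; have p1 : 1 <= prefactor t.+1 by rewrite /prefactor (ler_nat _ 1).
have d0 := dd_ge0 t.+1.
suff : prefactor t.+1 * Lb t.+1 * dd t.+1 / 2 -
   (3 * prefactor t.+1 / 4 - 1 / 2 - 3 / 2 * (5 / 3) * weight tr t.+1) * stepsize tr t.+1 * dd t.+1
   <= prefactor t.+1 * (diam X ^+ 2 / 2) *
     (if (t.+1 == 1)%N || ns t.+1 then Num.max 0 (Lb t.+1) else 0) by lra.
set C := if _ then _ else _.
have [bad|] := boolP ((t.+1 == 1)%N || ns t.+1).
  have -> : weight tr t.+1 = 0.
    apply: weight_bad; rewrite idxS; case: (ns t.+1) bad => //; rewrite orbF.
    by move=> /eqP[->]; rewrite idx0.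
  have -> : C = Num.max 0 (Lb t.+1) by rewrite /C bad.
  have h : Lb t.+1 * dd t.+1 <= Num.max 0 (Lb t.+1) * diam X ^+ 2.
    apply: (@le_trans _ _ (Num.max 0 (Lb t.+1) * dd t.+1)).
      by rewrite ler_wpM2r// le_max lexx orbT.
    by rewrite ler_wpM2l// le_max lexx.
  have := ler_wpM2l (_ : 0 <= prefactor t.+1 / 2) h.
  have := mulr_ge0 (ltW g0) d0.
  move=> gd /(_ _) h2; have {h2} := h2 ltac:(lra).
  have : 0 <= (3 * prefactor t.+1 / 4 - 1 / 2) * (stepsize tr t.+1 * dd t.+1).
    by rewrite mulr_ge0//; lra.
  lra.
rewrite negb_or /C => /andP[t1 /negbTE nst]; rewrite nst orbF (negbTE t1) mulr0.
have t2 : (1 < t.+1)%N by move: t1; case: (t).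
have Lb_le : Lb t.+1 <= 3 / 8 * stepsize tr t.+1.
  by move: nst; rewrite nsE t2 /= => /negbT; rewrite -leNgt gE; lra.
have i2 : (2 <= idx (tr t.+1))%N by rewrite idxS nst ltnS idx_pos.
rewrite weight_good// idxS nst -/(prefactor t.+1).
have h : prefactor t.+1 * (Lb t.+1 * dd t.+1) <=
    prefactor t.+1 * (3 / 8 * stepsize tr t.+1 * dd t.+1).
  by rewrite ler_wpM2l ?ler_wpM2r//; lra.
have gd := mulr_ge0 (ltW g0) d0.
have := mulr_ge0 (_ : 0 <= prefactor t.+1) gd.
move=> /(_ ltac:(lra)) pgd.
move: h pgd gd; move: (prefactor _) (stepsize _ _) (dd _) (Lb _) => p g d b; lra.
Qed.

(** If the estimate reaches half of the curvature, the proximal term pays as for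
the average; otherwise the curvature is replaced by its upper bound. *)
Lemma excess_max (Lmax : R) t : (0 < t)%N -> 0 < Lb t -> 0 <= Lmax ->
  cv t <= Lmax * dd t ->
  excess f gf 1 (idx (tr t))%:R (weight tr t) (stepsize tr t) (x_ t.-1) (x_ t) <=
  (if (2 * Lb t * dd t < cv t)%R then t%:R * (Lmax / 2 * diam X ^+ 2) else 0) +
  diam X ^+ 2 * (if (t == 1)%N || ns t then Num.max 0 (Lb t) else 0).
Proof.
case: t => // t _ Lb0 Lmax0 cvL; rewrite /excess -/(cv _) -/(dd _).
have gE : stepsize tr t.+1 = 4 * Lhat (tr t) by [].
have g0 := gpos t.+1; have d0 := dd_ge0 t.+1; have d1 := dd_le t.+1.
set w : R := (idx (tr t.+1))%:R.
have w1 : 1 <= w by rewrite (ler_nat _ 1) idx_pos.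
have w0 : 0 <= w := le_trans ler01 w1.
have cvL' : cv t.+1 / 2 <= Lmax / 2 * dd t.+1.
  by move: cvL; move: (cv _) (dd _) => a b; lra.
have wt : w <= t.+1%:R by rewrite ler_nat (idx_le idx0 seg0 idxS segS ns1).
have gd := mulr_ge0 (ltW g0) d0.
set good := ~~ ((t.+1 == 1)%N || ns t.+1).
have slack : 0 <= (3 * w / 4 - 1 / 2 - 3 / 2 * 1 * weight tr t.+1 - good%:R * (3 / 8 * w))
     * (stepsize tr t.+1 * dd t.+1).
  apply: mulr_ge0 => //; rewrite /good.
  have [bad|] := boolP ((t.+1 == 1)%N || ns t.+1).
    rewrite /= mul0r weight_bad; first by lra.
    rewrite idxS; case: (ns t.+1) bad => //; rewrite orbF.
    by move=> /eqP[->]; rewrite idx0.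
  rewrite negb_or => /andP[t1 /negbTE nst].
  have i2 : (2 <= idx (tr t.+1))%N.
    by rewrite idxS nst ltnS idx_pos//; move: t1; case: (t).
  rewrite weight_good// -/w /=; have : 2 <= w by rewrite (ler_nat _ 2).
  lra.
case: ifPn => [fail|]; last rewrite -leNgt => ok.
  have h1 : w * (cv t.+1 / 2) <= t.+1%:R * (Lmax / 2 * diam X ^+ 2).
    apply: (@le_trans _ _ (w * (Lmax / 2 * dd t.+1))).
      by rewrite ler_wpM2l.
    apply: ler_pM => //.
      by rewrite mulr_ge0// divr_ge0.
    by rewrite ler_wpM2l// divr_ge0.
  have h2 : 0 <= diam X ^+ 2 *
      (if (t.+1 == 1)%N || ns t.+1 then Num.max 0 (Lb t.+1) else 0).
    by rewrite mulr_ge0 ?sqr_ge0//; case: ifP => //; rewrite le_max lexx.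
  have h3 : 0 <= good%:R * (3 / 8 * w) * (stepsize tr t.+1 * dd t.+1).
    by rewrite mulr_ge0// mulr_ge0// mulr_ge0// divr_ge0.
  move: slack h1 h2 h3; move: (if _ then _ else 0) (_ * (Lmax / 2 * _)) => C T.
  move: (good%:R) (stepsize _ _) (dd _) (weight _ _) (cv _) (diam X ^+ 2).
  by move=> *; lra.
rewrite add0r; move: slack; rewrite /good.
have [bad|] := boolP ((t.+1 == 1)%N || ns t.+1).
  have -> : w = 1.
    rewrite /w idxS; case: (ns t.+1) bad => //; rewrite orbF.
    by move=> /eqP[->]; rewrite idx0.
  move=> slack; rewrite (max_r (ltW Lb0)).
  have := ler_wpM2l (ltW Lb0) d1; move: ok slack; rewrite /= mul0r subr0.
  move: (stepsize _ _) (dd _) (weight _ _) (cv _) (diam X ^+ 2) (Lb _).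
  by move=> *; lra.
rewrite negb_or => /andP[t1 /negbTE nst]; rewrite mulr0 /= mul1r => slack.
have t2 : (1 < t.+1)%N by move: t1; case: (t).
have Lb_le : Lb t.+1 <= 3 / 8 * stepsize tr t.+1.
  by move: nst; rewrite nsE t2 /= => /negbT; rewrite -leNgt gE; lra.
have h : cv t.+1 / 2 <= 3 / 8 * stepsize tr t.+1 * dd t.+1.
  have := ler_wpM2r d0 Lb_le; lra.
have := ler_wpM2l w0 h; move: slack.
move: (stepsize _ _) (dd _) (weight _ _) (cv _) => *; lra.
Qed.

(** Summed over [t] and divided by the total weight, this is the expectation of
the squared gradient mapping at the random output. *)
Definition grad_sq_term t : R :=
  weight tr t / stepsize tr t * enorm (iter_grad X gf tr t.-1) ^+ 2.

Let noise_le (rho w : R) t : (0 < t)%N -> 0 <= rho <= 5 / 3 -> w <= prefactor t ->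
  (w + 3 * rho * weight tr t) * (enorm (dlt t) ^+ 2 / stepsize tr t) <=
  31 / 22 * batch_coef t * (enorm (dlt t) ^+ 2 / stepsize tr t).
Proof.
move=> t0 rho0 wp; rewrite ler_wpM2r ?noise_coef_le//.
by rewrite divr_ge0 ?sqr_ge0// ltW.
Qed.

Let gam_le (Lmax : R) k : Lhat (tr k.+1) <= Lmax ->
  stepsize tr k.+1 / 2 * diam X ^+ 2 <= 2 * Lmax * diam X ^+ 2.
Proof.
move=> LL; rewrite ler_wpM2r ?sqr_ge0// /stepsize /=.
by have := LhatS_le k; lra.
Qed.

Section AverageEstimator.
Context (Lmax B : R).
Let a : R := Lmax * diam X ^+ 2 / 2.
Let A : R := 10 * a + B.
Hypotheses (Lmax0 : 0 < Lmax) (B_ge0 : 0 <= B) (A_gt0 : 0 < A).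

(** The reciprocal of the error bound, computed from the segments seen so far:
it is known before iteration [t], and can only decrease. *)
Definition bound_inv t : R := (10 * a + B + a * (t.-1 - seg (tr t.-1))%:R)^-1.

Let a_ge0 : 0 <= a. Proof. by rewrite divr_ge0// mulr_ge0// ?sqr_ge0 ?ltW. Qed.

Let den_gt0 (N : nat) : 0 < A + a * N%:R.
Proof. by rewrite ltr_wpDr// mulr_ge0. Qed.

Lemma bound_inv_gt0 t : 0 < bound_inv t.
Proof. by rewrite invr_gt0. Qed.

Lemma bound_invS t : (0 < t)%N -> bound_inv t.+1 <= bound_inv t.
Proof.
case: t => // t _; rewrite /bound_inv lef_pV2 ?posrE// lerD2l ler_wpM2l// ler_nat.
exact: (good_steps_mono idx0 seg0 segS ns1).
Qed.

Lemma bound_inv_le t : bound_inv t <= A^-1.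
Proof. by rewrite lef_pV2 ?posrE// lerDl mulr_ge0. Qed.

(** Dividing by the error bound through [bound_inv] is possible because it
decreases in [t].  The constant 3 collects the estimates that open segments:
their prefactor is at most the number of steps that stay within a segment plus
ten, which [bound_inv] compensates. *)
Lemma path_bound_avg k u :
  X u -> (forall x, X x -> f u <= f x) -> Lhat (tr k.+1) <= Lmax ->
  5 / 3 * (\sum_(1 <= t < k.+2) grad_sq_term t) * bound_inv k.+2 <=
  A^-1 * (4 * a) + 3 +
  \sum_(1 <= t < k.+2) bound_inv t *
    (l / 2 * diam X ^+ 2 - dot (dlt t) (x_ t.-1 - u)
     + 31 / 22 * batch_coef t * (enorm (dlt t) ^+ 2 / stepsize tr t)
     + prefactor t / 2 * (cv t - Lb t * dd t)).
Proof.
move=> Xu fmin LL.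
have b0 t : 0 <= bound_inv t := ltW (bound_inv_gt0 t).
have p1 t : 1 <= prefactor t by rewrite (ler_nat _ 1).
have pS t : (0 < t)%N -> prefactor t.+1 - 1 <= prefactor t.
  case: t => // t _; rewrite /prefactor /= -[X in X - 1]natr1 addrK ler_nat idxS.
  by case: (ns _).
have r53 : 0 <= 5 / 3 :> R by lra.
have := @telescoped_bound u (5 / 3) bound_inv prefactor (weight tr) k Xu fmin r53 b0 bound_invS.
have p11 : prefactor 1%N = 1 by rewrite /prefactor idx0.
move=> /(_ p11 (fun t _ => p1 t) pS wt_ge0) main.
pose C t : R := if (t == 1)%N || ns t then Num.max 0 (Lb t) else 0.
have C0 t : 0 <= C t by rewrite /C; case: ifP => // _; rewrite le_max lexx.
have sumC : Lmax^-1 * \sum_(1 <= t < k.+2) C t <= 3.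
  rewrite ler_pdivrMl//; apply: le_trans (jump_sum k.+1) _.
  by rewrite mulrC ler_wpM2r.
have pC t : (0 < t)%N -> bound_inv t * (prefactor t * (diam X ^+ 2 / 2) * C t) <= Lmax^-1 * C t.
  case: t => // t _.
  have -> : bound_inv t.+1 * (prefactor t.+1 * (diam X ^+ 2 / 2) * C t.+1) =
    bound_inv t.+1 * (prefactor t.+1 * a) * (Lmax^-1 * C t.+1).
    by rewrite /a; field; rewrite gt_eqF.
  rewrite -[leRHS]mul1r ler_wpM2r//; first by rewrite mulr_ge0// invr_ge0 ltW.
  rewrite /bound_inv mulrC ler_pdivrMr ?den_gt0// mul1r /= /prefactor /=.
  have h : (idx (tr t)).+1%:R <= 10 + (t - seg (tr t))%:R :> R.
    rewrite -[X in X + _]/(10%:R) -natrD ler_nat.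
    have := idx_seg_le idx0 seg0 idxS segS ns1 t.
    by move: (idx _) (seg _) => i s; clear; lia.
  by have := ler_wpM2r a_ge0 h; move: B_ge0; lra.
have lhs : 5 / 3 * (\sum_(1 <= t < k.+2) grad_sq_term t) * bound_inv k.+2 <=
  5 / 3 * \sum_(1 <= t < k.+2) bound_inv t * grad_sq_term t.
  rewrite -mulrA ler_wpM2l// mulr_suml; apply: ler_sum_nat => t /andP[t1 tk].
  rewrite mulrC ler_wpM2r//.
    by rewrite /grad_sq_term mulr_ge0 ?sqr_ge0// divr_ge0// ltW.
  have : (t <= k.+2)%N by apply: ltnW.
  elim: (k.+2) => [|j IH]; first by move: t1; case: (t).
  rewrite leq_eqVlt => /predU1P[->//|]; rewrite ltnS => tj.
  by apply: le_trans (bound_invS _) (IH tj); apply: leq_trans t1 tj.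
apply: le_trans lhs _; apply: le_trans main _.
have -> : bound_inv 1 = A^-1 by rewrite /bound_inv /= sub0n mulr0 addr0.
have g1 : A^-1 * (stepsize tr k.+1 / 2 * diam X ^+ 2) <= A^-1 * (4 * a).
  rewrite ler_wpM2l ?invr_ge0 ?(ltW A_gt0)//; apply: le_trans (gam_le LL) _.
  by rewrite /a; lra.
rewrite -addrA lerD// addrC.
have : \sum_(1 <= t < k.+2) Lmax^-1 * C t <= 3 by rewrite -mulr_sumr.
rewrite -(lerD2l (\sum_(1 <= t < k.+2) bound_inv t *
    (l / 2 * diam X ^+ 2 - dot (dlt t) (x_ t.-1 - u)
     + 31 / 22 * batch_coef t * (enorm (dlt t) ^+ 2 / stepsize tr t)
     + prefactor t / 2 * (cv t - Lb t * dd t)))).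
apply: le_trans; rewrite -big_split /=; apply: ler_sum_nat => t /andP[t1 tk].
apply: (@le_trans _ _ (bound_inv t *
    (l / 2 * diam X ^+ 2 - dot (dlt t) (x_ t.-1 - u)
     + 31 / 22 * batch_coef t * (enorm (dlt t) ^+ 2 / stepsize tr t)
     + prefactor t / 2 * (cv t - Lb t * dd t)) +
    bound_inv t * (prefactor t * (diam X ^+ 2 / 2) * C t))); last by rewrite lerD2l pC.
rewrite -mulrDr ler_wpM2l// -[leRHS]addrA lerD//; last exact: excess_avg.
by rewrite lerD2l noise_le// lexx andbT.
Qed.

End AverageEstimator.

(** The prefactor can be the position itself, which is one wherever a segment
opens, so that the opening estimates contribute only a constant. *)
Lemma path_bound_max (Lmax : R) k u :
  X u -> (forall x, X x -> f u <= f x) -> Lhat (tr k.+1) <= Lmax ->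
  (forall t, (0 < t)%N -> 0 < Lb t) -> 0 <= Lmax ->
  (forall t, (0 < t)%N -> cv t <= Lmax * dd t) ->
  \sum_(1 <= t < k.+2) grad_sq_term t <=
  5 * Lmax * diam X ^+ 2 +
  \sum_(1 <= t < k.+2)
    (l / 2 * diam X ^+ 2 - dot (dlt t) (x_ t.-1 - u)
     + 31 / 22 * batch_coef t * (enorm (dlt t) ^+ 2 / stepsize tr t)
     + (if (2 * Lb t * dd t < cv t)%R then t%:R * (Lmax / 2 * diam X ^+ 2) else 0)).
Proof.
move=> Xu fmin LL Lb0 Lm0 cvL.
pose w t : R := (idx (tr t))%:R.
have w11 : w 1%N = 1 by rewrite /w idxS ns1 idx0.
have w1 t : (0 < t)%N -> 1 <= w t by move=> t0; rewrite /w (ler_nat _ 1) idx_pos.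
have wS t : (0 < t)%N -> w t.+1 - 1 <= w t.
  move=> t0; rewrite /w idxS; case: (ns _); first by rewrite subrr.
  by rewrite -[X in X - 1]natr1 addrK.
have := @telescoped_bound u 1 (fun=> 1) w (weight tr) k Xu fmin ler01
  (fun=> ler01) (fun _ _ => lexx _) w11 w1 wS wt_ge0.
under eq_bigr do rewrite mul1r; under [X in _ <= _ + X]eq_bigr do rewrite mul1r.
rewrite !mul1r => main; apply: le_trans main _.
pose C t : R := if (t == 1)%N || ns t then Num.max 0 (Lb t) else 0.
have sumC : \sum_(1 <= t < k.+2) diam X ^+ 2 * C t <= 3 * Lmax * diam X ^+ 2.
  rewrite -mulr_sumr mulrC ler_wpM2r ?sqr_ge0//.
  by apply: le_trans (jump_sum k.+1) _; rewrite ler_wpM2l.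
have g1 := gam_le LL.
set bigS := (X in _ <= _ + X).
suff : \sum_(1 <= t < k.+2) (l / 2 * diam X ^+ 2 - dot (dlt t) (x_ t.-1 - u)
     + (w t + 3 * 1 * weight tr t) * (enorm (dlt t) ^+ 2 / stepsize tr t)
     + excess f gf 1 (w t) (weight tr t) (stepsize tr t) (x_ t.-1) (x_ t)) <=
   bigS + \sum_(1 <= t < k.+2) diam X ^+ 2 * C t by lra.
rewrite /bigS -big_split /=; apply: ler_sum_nat => t /andP[t1 tk].
rewrite -[leRHS]addrA lerD//; last by apply: excess_max => //; [exact: Lb0|exact: cvL].
rewrite lerD2l noise_le//; first by apply/andP; split; lra.
rewrite /w /prefactor ler_nat; case: t t1 {tk} => // t _; rewrite idxS.
by case: (ns _).
Qed.

End RunAnalysis.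

(** * Measurability of vector-valued functions *)

Section MeasurableChoice.
Context d (T : measurableType d) d' (U : measurableType d').

Lemma measurable_countable_choice (C : countType) (N : T -> C) (h : C -> T -> U) :
  (forall c, measurable [set w | N w = c]) ->
  (forall c, measurable_fun setT (h c)) -> measurable_fun setT (fun w => h (N w) w).
Proof.
move=> mN mh _ B mB; rewrite setTI.
have -> : (fun w => h (N w) w) @^-1` B =
    \bigcup_c ([set w | N w = c] `&` (h c @^-1` B)).
  by apply/seteqP; split=> [w Bw|w [c _ [/= <-]]//]; exists (N w).
apply: countable_bigcupT_measurable; first exact: countableP.
by move=> c; apply: measurableI => //; rewrite -[X in measurable X]setTI; exact: mh.
Qed.

Lemma measurable_nat_choice (N : T -> nat) (h : nat -> T -> U) :
  measurable_fun setT N ->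
  (forall j, measurable_fun setT (h j)) -> measurable_fun setT (fun w => h (N w) w).
Proof.
move=> mN; apply: measurable_countable_choice => c.
by rewrite -[X in measurable X]setTI; apply: (mN measurableT [set c]).
Qed.

End MeasurableChoice.

Section MeasurableReal.
Context d (T : measurableType d) (R : realType).
Implicit Types f g : T -> R.

Lemma measurable_floor_fiber f c : measurable_fun setT f ->
  measurable [set w | Num.floor (f w) = c].
Proof.
move=> mf.
have -> : [set w | Num.floor (f w) = c] = f @^-1` `[c%:~R, (c + 1)%:~R[%classic.
  by apply/seteqP; split=> w /=; rewrite in_itv /= -floor_eq => /eqP.
by rewrite -[X in measurable X]setTI; exact: mf.
Qed.

Lemma measurable_ceil d' (U : measurableType d') (h : int -> U) f :
  measurable_fun setT f -> measurable_fun setT (fun w => h (Num.ceil (f w))).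
Proof.
move=> mf.
have -> : (fun w => h (Num.ceil (f w))) = (fun w => h (- Num.floor (- f w))).
  by apply/funext => w; rewrite ceilNfloor.
apply: (@measurable_countable_choice _ _ _ _ int (fun w => Num.floor (- f w))
  (fun c _ => h (- c))) => c; last exact: measurable_cst.
by apply: measurable_floor_fiber; exact: measurable_funN.
Qed.

(** x / (x^2 + 1/m) is continuous and tends to the inverse of x, including at 0
where both are 0. *)
Lemma measurable_funV f : measurable_fun setT f -> measurable_fun setT (fun w => (f w)^-1).
Proof.
move=> mf; apply: (measurableT_comp (f := fun x : R => x^-1)) => //.
pose h (m : nat) (x : R) : R := x / (x ^+ 2 + harmonic m).
have h0 m (x : R) : x ^+ 2 + harmonic m != 0 :> R.
  by rewrite gt_eqF// ltr_wpDl ?sqr_ge0// /harmonic invr_gt0.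
apply: (@measurable_fun_cvg _ _ _ _ h).
  move=> m; apply: continuous_measurable_fun => x; apply: cvgM; first exact: cvg_id.
  apply: cvgV => //; apply: cvgD; last exact: cvg_cst.
  exact: (@exprn_continuous R 2 x).
move=> x _; have [->|x0] := eqVneq x 0.
  rewrite invr0 /h; apply: cvg_near_cst; near=> m; by rewrite mul0r.
have -> : x^-1 = x / (x ^+ 2 + 0) by rewrite addr0; field.
apply: cvgM; first exact: cvg_cst.
apply: cvgV; first by rewrite addr0 sqrf_eq0.
by apply: cvgD; [exact: cvg_cst|exact: cvg_harmonic].
Unshelve. all: by end_near. Qed.

Lemma measurable_fun_div f g : measurable_fun setT f -> measurable_fun setT g ->
  measurable_fun setT (fun w => f w / g w).
Proof. by move=> mf mg; apply: measurable_funM => //; exact: measurable_funV. Qed.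

Lemma measurable_fun_sqrt f : measurable_fun setT f ->
  measurable_fun setT (fun w => Num.sqrt (f w)).
Proof.
move=> mf; apply: (measurableT_comp (f := @Num.sqrt R)) => //.
by apply: continuous_measurable_fun; exact: sqrt_continuous.
Qed.

Lemma measurable_set_le f g : measurable_fun setT f -> measurable_fun setT g ->
  measurable [set w | f w <= g w].
Proof.
move=> mf mg; rewrite -[X in measurable X]setTI.
have := measurable_fun_ler mf mg measurableT (Y := [set true]).
by apply.
Qed.

Lemma measurable_set_lt f g : measurable_fun setT f -> measurable_fun setT g ->
  measurable [set w | f w < g w].
Proof.
move=> mf mg; rewrite -[X in measurable X]setTI.
have := measurable_fun_ltr mf mg measurableT (Y := [set true]).
by apply.
Qed.

End MeasurableReal.

Section MeasurableVector.
Context d (T : measurableType d) (R : realType) (n : nat).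
Implicit Types (f g : T -> 'rV[R]_n).

Definition vmeasurable f := forall i, measurable_fun setT (fun w => f w 0 i).

Lemma vmeasurable_cst v : vmeasurable (fun=> v).
Proof. by move=> i; exact: measurable_cst. Qed.

Lemma vmeasurableD f g : vmeasurable f -> vmeasurable g -> vmeasurable (fun w => f w + g w).
Proof.
move=> mf mg i; under eq_fun do rewrite mxE.
exact: measurable_funD (mf i) (mg i).
Qed.

Lemma vmeasurableZ (a : T -> R) f : measurable_fun setT a -> vmeasurable f ->
  vmeasurable (fun w => a w *: f w).
Proof.
move=> ma mf i; under eq_fun do rewrite mxE.
exact: measurable_funM ma (mf i).
Qed.

Lemma vmeasurableN f : vmeasurable f -> vmeasurable (fun w => - f w).
Proof.
move=> mf i; under eq_fun do rewrite mxE.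
exact: measurable_funN (mf i).
Qed.

Lemma vmeasurableB f g : vmeasurable f -> vmeasurable g -> vmeasurable (fun w => f w - g w).
Proof. by move=> mf mg; apply: vmeasurableD => //; exact: vmeasurableN. Qed.

Lemma vmeasurable_sum (I : Type) (s : seq I) (F : I -> T -> 'rV[R]_n) :
  (forall i, vmeasurable (F i)) -> vmeasurable (fun w => \sum_(i <- s) F i w).
Proof.
move=> mF i; under eq_fun do rewrite summxE.
by apply: measurable_sum => j; exact: mF.
Qed.

Lemma measurable_dot f g : vmeasurable f -> vmeasurable g ->
  measurable_fun setT (fun w => dot (f w) (g w)).
Proof.
by move=> mf mg; apply: measurable_sum => i; exact: measurable_funM (mf i) (mg i).
Qed.

Lemma measurable_enorm f : vmeasurable f -> measurable_fun setT (fun w => enorm (f w)).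
Proof. by move=> mf; apply: measurable_fun_sqrt; exact: measurable_dot. Qed.

Lemma vmeasurable_nat_choice (N : T -> nat) (h : nat -> T -> 'rV[R]_n) :
  measurable_fun setT N -> (forall j, vmeasurable (h j)) ->
  vmeasurable (fun w => h (N w) w).
Proof.
by move=> mN mh i; apply: (measurable_nat_choice (h := fun j w => h j w 0 i)) => // j; exact: mh.
Qed.

(** Stated with the Euclidean norm, in which the Lipschitz estimates are given. *)
Definition econtinuous (h : 'rV[R]_n -> R) := forall x (e : R), 0 < e ->
  exists2 r : R, 0 < r & forall y, enorm (x - y) < r -> `|h x - h y| <= e.

(** A function that is continuous in a vector and measurable in a parameter is
measurable along every measurable vector: the vector is rounded to a grid,
which takes countably many values, and the mesh is sent to zero. *)
Lemma measurable_caratheodory (h : 'rV[R]_n -> T -> R) (x : T -> 'rV[R]_n) :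
  (forall v, measurable_fun setT (h v)) -> (forall w, econtinuous (h ^~ w)) ->
  vmeasurable x -> measurable_fun setT (fun w => h (x w) w).
Proof.
move=> mh ch mx.
pose code (m : nat) w : 'rV[int]_n := \row_i Num.floor (x w 0 i * m.+1%:R).
pose decode (m : nat) (c : 'rV[int]_n) : 'rV[R]_n := \row_i ((c 0 i)%:~R / m.+1%:R).
apply: (@measurable_fun_cvg _ _ _ _ (fun m w => h (decode m (code m w)) w)).
  move=> m; apply: (@measurable_countable_choice _ _ _ _ _ (code m)
    (fun c => h (decode m c))) => // c.
  have -> : [set w | code m w = c] =
      \bigcap_(i in [set: 'I_n]) [set w | Num.floor (x w 0 i * m.+1%:R) = c 0 i].
    apply/seteqP; split=> w /= => [<- i _ /=|H]; first by rewrite mxE.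
    by apply/rowP => i; rewrite mxE; exact: H.
  apply: fin_bigcap_measurable => [|i _]; first exact: finite_finset.
  apply: measurable_floor_fiber; apply: measurable_funM; first exact: mx.
  exact: measurable_cst.
move=> w _; apply/cvgrPdist_le => e e0.
have [r r0 hr] := ch w (x w) e e0.
near=> m; apply: hr.
apply: (@le_lt_trans _ _ (n%:R * m.+1%:R^-1)).
  apply: le_trans (enorm_le_coord _) _.
  rewrite -[X in X%:R](card_ord n) -sumr_const mulr_suml; apply: ler_sum => i _.
  rewrite mul1r !mxE; set a := x w 0 i; set q := m.+1%:R.
  have q0 : 0 < q :> R by [].
  have /andP[] := floor_itv (a * q); rewrite -!ler_pdivrMr// => h1 h2.
  rewrite ger0_norm ?subr_ge0// lerBlDr -[X in _ <= X + _]mul1r -mulrDl.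
  rewrite ler_pdivlMr// (le_trans (ltW h2))// intrD addrC.
  by rewrite lexx.
have : n%:R * harmonic m < r; last by [].
near: m.
have : (fun m => n%:R * harmonic m) @ \oo --> n%:R * (0 : R).
  by apply: cvgM; [exact: cvg_cst|exact: cvg_harmonic].
rewrite mulr0 => /cvgrPdist_lt /(_ r r0); apply: filterS => m.
rewrite sub0r normrN; apply: le_lt_trans; exact: ler_norm.
Unshelve. all: by end_near. Qed.

Lemma vmeasurable_caratheodory (h : 'rV[R]_n -> T -> 'rV[R]_n) (x : T -> 'rV[R]_n) :
  (forall v, vmeasurable (h v)) -> (forall w i, econtinuous (fun v => h v w 0 i)) ->
  vmeasurable x -> vmeasurable (fun w => h (x w) w).
Proof.
move=> mh ch mx i; apply: (@measurable_caratheodory (fun v w => h v w 0 i)) => //.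
by move=> v; exact: mh.
Qed.

Lemma lipschitz_econtinuous (h : 'rV[R]_n -> R) (K : R) :
  (forall x y, `|h x - h y| <= K * enorm (x - y)) -> econtinuous h.
Proof.
move=> hK x e e0; have K1 : 0 < `|K| + 1 by rewrite ltr_wpDl.
exists (e / (`|K| + 1)) => [|y]; first by rewrite divr_gt0.
rewrite ltr_pdivlMr// => xy; apply: le_trans (hK x y) _; apply: le_trans (ltW xy).
by rewrite mulrC ler_wpM2l ?enorm_ge0//; have := ler_norm K; lra.
Qed.

End MeasurableVector.

Lemma vmeasurable_comp d1 d2 (T1 : measurableType d1) (T2 : measurableType d2)
    (R : realType) n (f : T2 -> 'rV[R]_n) (g : T1 -> T2) :
  vmeasurable f -> measurable_fun setT g -> vmeasurable (fun w => f (g w)).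
Proof. by move=> mf mg i; apply: (measurableT_comp (mf i) mg). Qed.

Lemma measurable_bool_nat d1 (U : measurableType d1) (R : realType) (p : U -> bool) :
  measurable [set w | p w] -> measurable_fun setT (fun w => (p w)%:R : R).
Proof.
move=> mp; have e w : (p w)%:R = \1_[set w | p w] w :> R by rewrite indicE mem_setE.
by under eq_fun do rewrite e; exact: measurable_indic.
Qed.

Lemma measurable_andb d1 (U : measurableType d1) (p q : U -> bool) :
  measurable [set w | p w] -> measurable [set w | q w] -> measurable [set w | p w && q w].
Proof.
move=> mp mq; have -> : [set w | p w && q w] = [set w | p w] `&` [set w | q w].
  by apply/seteqP; split=> [w /andP[]|w [? ?]] //=; apply/andP.
exact: measurableI.
Qed.

Lemma measurable_forall d1 (U : measurableType d1) (I : finType) (p : I -> U -> bool) :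
  (forall i, measurable [set w | p i w]) -> measurable [set w | [forall i, p i w]].
Proof.
move=> mp; have -> : [set w | [forall i, p i w]] = \bigcap_(i in [set: I]) [set w | p i w].
  by apply/seteqP; split=> [w /forallP pw i _|w pw] /=; [exact: pw|apply/forallP => i; exact: pw].
by apply: fin_bigcap_measurable => //; exact: finite_finset.
Qed.

Lemma measurable_exists d1 (U : measurableType d1) (I : finType) (p : I -> U -> bool) :
  (forall i, measurable [set w | p i w]) -> measurable [set w | [exists i, p i w]].
Proof.
move=> mp; have -> : [set w | [exists i, p i w]] = \bigcup_(i in [set: I]) [set w | p i w].
  by apply/seteqP; split=> [w /existsP[i pw]|w [i _ pw]] /=; [exists i|apply/existsP; exists i].
by apply: fin_bigcup_measurable => //; exact: finite_finset.
Qed.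

(** * Sigma-algebras of independent samples *)

Section Freezing.
Context d (Om : measurableType d) (R : realType) (P : probability Om R).
Context d1 (T1 : measurableType d1) d2 (T2 : measurableType d2).
Context (X1 : {mfun Om >-> T1}) (X2 : {mfun Om >-> T2}).
Hypothesis indep : forall A B, measurable A -> measurable B ->
  P (X1 @^-1` A `&` X2 @^-1` B) = (P (X1 @^-1` A) * P (X2 @^-1` B))%E.

Let X12 w := (X1 w, X2 w).
Let mX12 : measurable_fun setT X12.
Proof. exact: measurable_fun_pair. Qed.
Let X12m : {mfun Om >-> (T1 * T2)%type} := HB.pack X12 (isMeasurableFun.Build _ _ _ _ _ mX12).

Let joint_law (A : set (T1 * T2)) : measurable A ->
  ((distribution P X1 \x distribution P X2) A = distribution P X12m A)%E.
Proof.
by apply: product_measure_unique => B C mB mC; rewrite -indep.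
Qed.

(** The joint law of independent variables is the product of their laws, so by
Fubini's theorem the second one is integrated out with the first one frozen. *)
Lemma freeze_ge0 (h : T1 -> T2 -> \bar R) :
  measurable_fun setT (fun p : T1 * T2 => h p.1 p.2) ->
  (forall x y, (0 <= h x y)%E) ->
  (\int[P]_w h (X1 w) (X2 w) =
   \int[P]_w \int[distribution P X2]_y h (X1 w) y)%E.
Proof.
move=> mh h0; pose f p := h p.1 p.2.
transitivity (\int[distribution P X12m]_p f p)%E.
  by rewrite ge0_integral_distribution// => -[]; rewrite /f.
transitivity (\int[(distribution P X1 \x distribution P X2)%E]_p f p)%E.
  by apply: eq_measure_integral => A mA _; exact/esym/joint_law.
rewrite fubini_tonelli1//; last by move=> -[]; rewrite /f.
rewrite ge0_integral_distribution//.
  by apply: measurable_fun_fubini_tonelli_F => // -[]; rewrite /f.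
by move=> x; apply: integral_ge0 => y _; exact: h0.
Qed.

Lemma freeze_integrable (h : T1 -> T2 -> R) (H : Om -> R) :
  measurable_fun setT (fun p : T1 * T2 => h p.1 p.2) ->
  P.-integrable setT (EFin \o H) ->
  (forall w, (\int[distribution P X2]_y `|h (X1 w) y|%:E <= (H w)%:E)%E) ->
  P.-integrable setT (fun w => (h (X1 w) (X2 w))%:E).
Proof.
move=> mh iH hH; apply/integrableP; split.
  by apply/measurable_EFinP; exact: (measurableT_comp mh mX12).
under eq_integral do rewrite abse_EFin.
rewrite (freeze_ge0 (h := fun x y => `|h x y|%:E)) //; last first.
  by apply/measurable_EFinP; apply: measurableT_comp mh.
apply: (@le_lt_trans _ _ (\int[P]_w (H w)%:E)%E); last first.
  have /fin_numP[_] := integrable_fin_num measurableT iH.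
  by rewrite ltey => ->.
apply: ge0_le_integral => //.
- by move=> w _; apply: integral_ge0.
- apply: (measurableT_comp (f := fun x => \int[distribution P X2]_y `|h x y|%:E)%E) => //.
  apply: (measurable_fun_fubini_tonelli_F (fun p => `|h p.1 p.2|%:E)) => //.
  by apply/measurable_EFinP; apply: measurableT_comp mh.
- exact: measurable_int iH.
Qed.

Lemma freeze_integral (h : T1 -> T2 -> R) (H : Om -> R) :
  measurable_fun setT (fun p : T1 * T2 => h p.1 p.2) ->
  P.-integrable setT (EFin \o H) ->
  (forall w, (\int[distribution P X2]_y `|h (X1 w) y|%:E <= (H w)%:E)%E) ->
  (\int[P]_w (h (X1 w) (X2 w))%:E =
   \int[P]_w \int[distribution P X2]_y (h (X1 w) y)%:E)%E.
Proof.
move=> mh iH hH; pose f p := (h p.1 p.2)%:E.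
have mf : measurable_fun setT f by apply/measurable_EFinP.
have ih := freeze_integrable mh iH hH.
have i12 : (distribution P X1 \x distribution P X2)%E.-integrable setT f.
  apply/integrableP; split=> //.
  rewrite (eq_measure_integral (distribution P X12m)); last by move=> A mA _; exact: joint_law.
  rewrite ge0_integral_distribution//; last by apply: measurableT_comp.
  by have /integrableP[] := ih.
transitivity (\int[distribution P X12m]_p f p)%E; first by rewrite integral_distribution.
transitivity (\int[(distribution P X1 \x distribution P X2)%E]_p f p)%E.
  by apply: eq_measure_integral => A mA _; exact/esym/joint_law.
rewrite -integral12_prod_meas1// integral_distribution//.
  exact: (measurable_fubini_F i12).
have := integrable_fubini_F i12.
set g := fubini_F _ _ => ig.
have mg : measurable_fun setT g by exact: measurable_int ig.
apply/integrableP; split; first exact: measurableT_comp.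
have /integrableP[_] := ig.
rewrite ge0_integral_distribution//.
by apply: measurableT_comp.
Qed.

End Freezing.

Section SampleIndependence.
Context d (Om : measurableType d) d' (Xi : measurableType d') (R : realType).
Context (P : probability Om R) (mu : probability Xi R) (J : eqType).
Context (Z : J -> Om -> Xi).

(** Generators of the events that depend only on the samples indexed by [S]. *)
Definition gen (S : set J) : set (set Om) :=
  [set B | exists i A, [/\ S i, measurable A & B = Z i @^-1` A]].

(** Another family of generators, which is closed under intersection. *)
Definition cyl (S : set J) : set (set Om) :=
  [set B | exists (s : seq J) A, [/\ forall i, i \in s -> S i, forall i, measurable (A i) &
     B = [set w | forall i : J, i \in s -> A i (Z i w)]]].

Lemma cyl_setI_closed S : setI_closed (cyl S).
Proof.
move=> _ _ [s1 [A1 [sS1 mA1 ->]]] [s2 [A2 [sS2 mA2 ->]]].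
exists (s1 ++ s2), (fun i => (if i \in s1 then A1 i else setT) `&`
                             (if i \in s2 then A2 i else setT)); split.
- by move=> i; rewrite mem_cat => /orP[/sS1|/sS2].
- by move=> i; apply: measurableI; case: ifP.
apply/seteqP; split=> [w [H1 H2] i|w H].
  by rewrite mem_cat => _; split; case: ifP => // iS; [exact: H1|exact: H2].
by split=> i iS; have := H i; rewrite mem_cat iS ?orbT => /(_ isT) [].
Qed.

Lemma gen_sub_cyl S : gen S `<=` cyl S.
Proof.
move=> _ [i [A [Si mA ->]]]; exists [:: i], (fun=> A); split=> //.
  by move=> j; rewrite inE => /eqP->.
by apply/seteqP; split=> [w ? j|w]; [rewrite inE => /eqP->|apply; rewrite inE].
Qed.

Lemma cyl_sub_sigma_gen S : cyl S `<=` <<s gen S >>.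
Proof.
move=> _ [s [A [sS mA ->]]].
elim: s sS => [_|i s IH sS].
  have -> : [set w : Om | forall i, i \in [::] -> A i (Z i w)] = setT.
    by apply/seteqP; split.
  exact: (@measurableT _ (g_sigma_algebraType (gen S))).
have -> : [set w | forall j, j \in i :: s -> A j (Z j w)] =
    (Z i @^-1` A i) `&` [set w | forall j, j \in s -> A j (Z j w)].
  apply/seteqP; split=> [w H|w [H1 H2] j]; last by rewrite inE => /predU1P[->|/H2].
  by split=> [|j js]; apply: H; rewrite inE ?eqxx// js orbT.
have h1 : <<s gen S >> (Z i @^-1` A i).
  by apply: sub_sigma_algebra; exists i, (A i); split=> //; apply: sS; rewrite inE eqxx.
have h2 := IH (fun j js => sS j (introT orP (or_intror js))).
have := @measurableI _ (g_sigma_algebraType (gen S)) _ _ h1 h2.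
by [].
Qed.

Lemma sigma_gen_cyl S : <<s gen S >> = <<s cyl S >>.
Proof.
apply/seteqP; split; apply: smallest_sub; try exact: smallest_sigma_algebra.
  by apply: subset_trans (@gen_sub_cyl S) _; exact: sub_sigma_algebra.
exact: cyl_sub_sigma_gen.
Qed.

Lemma sub_sigma_gen S S' : S `<=` S' -> <<s gen S >> `<=` <<s gen S' >>.
Proof.
move=> SS; apply: smallest_sub; first exact: smallest_sigma_algebra.
move=> B [i [A [Si mA ->]]]; apply: sub_sigma_algebra; exists i, A; split=> //.
exact: SS.
Qed.

Hypothesis iidZ : iid P mu Z.

Let mZ i : measurable_fun setT (Z i). Proof. by case: iidZ. Qed.

Lemma gen_measurable S : gen S `<=` measurable.
Proof.
by move=> _ [i [A [Si mA ->]]]; rewrite -[X in measurable X]setTI; exact: mZ.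
Qed.

Lemma sigma_gen_measurable S : <<s gen S >> `<=` measurable.
Proof.
apply: smallest_sub; first exact: sigma_algebra_measurable.
exact: gen_measurable.
Qed.

Let cyl_prob (s : seq J) (A : J -> set Xi) : uniq s -> (forall i, measurable (A i)) ->
  (P [set w | forall i, i \in s -> A i (Z i w)] = \prod_(i <- s) P (Z i @^-1` A i))%E.
Proof.
move=> us mA; case: iidZ => _ _ /(_ s A us mA) <-; congr (P _).
apply/funext => w; apply/propext; elim: s {us} => [|i s IH].
  by rewrite big_nil; split.
rewrite big_cons; split=> [H|[H1 H2] j].
  split; first by apply: H; rewrite inE eqxx.
  by apply/IH => j js; apply: H; rewrite inE js orbT.
by rewrite inE => /predU1P[->//|js]; apply: (IH.2 H2).
Qed.

Lemma cyl_independent S1 S2 B1 B2 : S1 `&` S2 = set0 -> cyl S1 B1 -> cyl S2 B2 ->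
  P (B1 `&` B2) = (P B1 * P B2)%E.
Proof.
move=> S12 [s1 [A1 [sS1 mA1 ->]]] [s2 [A2 [sS2 mA2 ->]]].
have undupE (s : seq J) (A' : J -> set Xi) :
    [set w | forall i, i \in s -> A' i (Z i w)] =
    [set w | forall i, i \in undup s -> A' i (Z i w)].
  by apply/seteqP; split=> w H i; [rewrite mem_undup|rewrite -mem_undup]; exact: H.
rewrite (undupE s1) (undupE s2).
pose A i := if i \in s1 then A1 i else A2 i.
have mA i : measurable (A i) by rewrite /A; case: ifP.
have disj i : i \in s2 -> i \in s1 = false.
  move=> i2; apply/negP => i1; suff : (S1 `&` S2) i by rewrite S12.
  by split; [exact: sS1|exact: sS2].
have -> : [set w | forall i, i \in undup s1 -> A1 i (Z i w)] `&`
    [set w | forall i, i \in undup s2 -> A2 i (Z i w)] =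
    [set w | forall i, i \in undup s1 ++ undup s2 -> A i (Z i w)].
  apply/seteqP; split=> [w [H1 H2] i|w H].
    rewrite mem_cat /A => /orP[]; rewrite mem_undup => iS.
      by rewrite iS; apply: H1; rewrite mem_undup.
    by rewrite disj//; apply: H2; rewrite mem_undup.
  split=> i iS; have := H i; rewrite mem_cat iS ?orbT => /(_ isT);
    move: iS; rewrite mem_undup /A => iS; first by rewrite iS.
  by rewrite disj.
rewrite cyl_prob//; last first.
  rewrite cat_uniq !undup_uniq andbT /=; apply/hasPn => i; rewrite !mem_undup => i2.
  by rewrite disj.
rewrite big_cat /= !cyl_prob ?undup_uniq//; congr (_ * _)%E.
  by apply: eq_big_seq => i; rewrite mem_undup /A => ->.
by apply: eq_big_seq => i; rewrite mem_undup /A => /disj ->.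
Qed.

Let extend (G : set (set Om)) (B : set Om) : setI_closed G -> G setT ->
  G `<=` measurable -> measurable B ->
  (forall A, G A -> P (A `&` B) = (P A * P B)%E) ->
  forall A, <<s G >> A -> P (A `&` B) = (P A * P B)%E.
Proof.
move=> GI GT Gm mB GB A sA.
have PBfin : P B \is a fin_num by exact: fin_num_measure.
have PB0 : 0 <= fine (P B) by rewrite fine_ge0.
have cov : \bigcup_(k : nat) [set: Om] = setT by apply/seteqP; split=> // w _; exists 0%N.
have := @g_sigma_algebra_measure_unique _ R Om G Gm (fun=> setT) (fun=> GT)
  cov (mrestr P mB) (mscale (NngNum PB0) P) GI _ _ A sA.
have scE C : mscale (NngNum PB0) P C = (P C * P B)%E by rewrite /mscale /= fineK// muleC.
move=> H; apply: etrans (H _ _) (scE A) => [C GC|_].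
  exact: etrans (GB C GC) (esym (scE C)).
by rewrite /= /mrestr setTI ltey_eq PBfin.
Qed.

Lemma cyl_setT S : cyl S setT.
Proof. by exists [::], (fun=> setT); split=> //; apply/seteqP; split. Qed.

Lemma cyl_measurable S : cyl S `<=` measurable.
Proof. by apply: subset_trans (@cyl_sub_sigma_gen S) _; exact: sigma_gen_measurable. Qed.

(** Independence passes from cylinders to the generated sigma-algebras one factor
at a time, by uniqueness of measures on a class closed under intersection. *)
Lemma sigma_gen_independent S1 S2 A B : S1 `&` S2 = set0 ->
  <<s gen S1 >> A -> <<s gen S2 >> B -> P (A `&` B) = (P A * P B)%E.
Proof.
move=> S12; rewrite !sigma_gen_cyl => sA sB.
have mB : measurable B.
  by apply: (@sigma_gen_measurable S2); rewrite sigma_gen_cyl.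
apply: (extend (@cyl_setI_closed S1) (cyl_setT S1) (@cyl_measurable S1)) => // A' cA'.
rewrite setIC muleC.
apply: (extend (@cyl_setI_closed S2) (cyl_setT S2) (@cyl_measurable S2)) => //.
  exact: cyl_measurable cA'.
by move=> B' cB'; rewrite setIC muleC; exact: cyl_independent S12 cA' cB'.
Qed.

End SampleIndependence.

(** * Functions of the samples *)

Section KnownFunctions.
Context d (Om : measurableType d) d' (Xi : measurableType d') (R : realType).
Context (P : probability Om R) (mu : probability Xi R) (J : eqType).
Context (Z : J -> Om -> Xi).
Hypothesis iidZ : iid P mu Z.

Local Notation algebra S := (g_sigma_algebraType (gen Z S)).

(** Measurability for the sigma-algebra of the samples indexed by [S]. *)
Definition known (S : set J) d2 (U : measurableType d2) (h : Om -> U) : Prop :=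
  @measurable_fun _ _ (algebra S) U setT h.

Definition vknown (S : set J) n (h : Om -> 'rV[R]_n) : Prop :=
  @vmeasurable _ (algebra S) R n h.

Lemma knownW S S' d2 (U : measurableType d2) (h : Om -> U) :
  S `<=` S' -> known S h -> known S' h.
Proof. by move=> SS hS mT B mB; apply: (sub_sigma_gen SS); exact: hS. Qed.

Lemma vknownW S S' n (h : Om -> 'rV[R]_n) : S `<=` S' -> vknown S h -> vknown S' h.
Proof. by move=> SS hS i; exact: knownW SS (hS i). Qed.

Lemma known_measurable S d2 (U : measurableType d2) (h : Om -> U) :
  known S h -> measurable_fun setT h.
Proof.
move=> hS _ B mB; rewrite setTI; apply: (sigma_gen_measurable iidZ (S := S)).
have := hS measurableT B mB; rewrite setTI.
by [].
Qed.

Lemma known_sample S i : S i -> known S (Z i).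
Proof.
move=> Si _ B mB; rewrite setTI; apply: sub_sigma_algebra.
by exists i, B.
Qed.

Let id_measurable S : measurable_fun setT (idfun : Om -> algebra S).
Proof. by move=> _ B mB; rewrite setTI; exact: (sigma_gen_measurable iidZ (S := S)). Qed.

Let id_mfun S : {mfun Om >-> algebra S} :=
  HB.pack (idfun : Om -> algebra S) (isMeasurableFun.Build _ _ _ _ _ (@id_measurable S)).

Let Z_measurable (i : J) : measurable_fun setT (Z i).
Proof. by case: iidZ. Qed.

Let Z_mfun (i : J) : {mfun Om >-> Xi} :=
  HB.pack (Z i) (isMeasurableFun.Build _ _ _ _ _ (Z_measurable i)).

Lemma known_mul_expectation S1 S2 (f g : Om -> R) : S1 `&` S2 = set0 ->
  known S1 f -> known S2 g -> (forall w, 0 <= f w) -> (forall w, 0 <= g w) ->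
  (\int[P]_w (f w * g w)%:E = (\int[P]_w (f w)%:E) * (\int[P]_w (g w)%:E))%E.
Proof.
move=> S12 kf kg f0 g0.
have ind A B : measurable A -> measurable B ->
    P (id_mfun S1 @^-1` A `&` id_mfun S2 @^-1` B) =
    (P (id_mfun S1 @^-1` A) * P (id_mfun S2 @^-1` B))%E.
  by move=> mA mB; exact: (sigma_gen_independent iidZ S12 mA mB).
have := freeze_ge0 ind (h := fun x y => (f x * g y)%:E).
rewrite /= => ->; last 2 first.
- apply/measurable_EFinP; apply: measurable_funM.
    exact: (measurableT_comp (f := f : algebra S1 -> R) kf measurable_fst).
  exact: (measurableT_comp (f := g : algebra S2 -> R) kg measurable_snd).
- by move=> x y; rewrite lee_fin mulr_ge0.
have mf := known_measurable kf; have mg := known_measurable kg.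
under eq_integral => w _.
  under eq_integral do rewrite EFinM.
  rewrite ge0_integralZl//; last 3 first.
  - by apply/measurable_EFinP.
  - by move=> y _; rewrite lee_fin.
  - by rewrite lee_fin.
  rewrite ge0_integral_distribution//; last by apply/measurable_EFinP.
  over.
rewrite /=.
rewrite ge0_integralZr//=.
- by apply/measurable_EFinP.
- by move=> w _; rewrite lee_fin.
- by apply: integral_ge0 => w _; rewrite lee_fin.
Qed.

(** By induction: the product of the remaining factors is known from the union of
their samples, which is disjoint from those of the first factor. *)
Lemma known_prod_expectation (I : eqType) (s : seq I) (S : I -> set J) (Y : I -> Om -> R) :
  uniq s -> (forall i j, i != j -> S i `&` S j = set0) ->
  (forall i, known (S i) (Y i)) -> (forall i w, 0 <= Y i w) ->
  (\int[P]_w (\prod_(i <- s) Y i w)%:E = \prod_(i <- s) \int[P]_w (Y i w)%:E)%E.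
Proof.
move=> us Sd kY Y0; elim: s us => [_|i s IH /= /andP[nis us]].
  under eq_integral do rewrite big_nil.
  by rewrite big_nil integral_cst// mul1e; exact: probability_setT.
under eq_integral do rewrite big_cons.
rewrite big_cons -IH//.
pose U := [set j | exists2 i', i' \in s & S i' j].
rewrite (known_mul_expectation (S1 := S i) (S2 := U))//.
- apply/seteqP; split=> // j [Sij [i' i's Si'j]].
  have ii' : i != i' by apply: contraNneq nis => ->.
  by rewrite -(Sd _ _ ii').
- apply: measurable_prod => i' i's.
  by apply: knownW (kY i') => j Sj; exists i'.
- by move=> w; apply: prodr_ge0.
Qed.

Section Fresh.
Context (S : set J) (j : J) (h : Om -> Xi -> R).
Hypothesis Sj : ~ S j.
Hypothesis mh : measurable_fun setT (fun p : algebra S * Xi => h p.1 p.2).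

Let ind A B : measurable A -> measurable B ->
    P (id_mfun S @^-1` A `&` Z_mfun j @^-1` B) =
    (P (id_mfun S @^-1` A) * P (Z_mfun j @^-1` B))%E.
Proof.
move=> mA mB; apply: (sigma_gen_independent iidZ (S1 := S) (S2 := [set j])) => //.
  by apply/seteqP; split=> // i /= [Si ij]; apply: Sj; rewrite -ij.
by apply: sub_sigma_algebra; exists j, B.
Qed.

Let law (g : Xi -> \bar R) : (\int[distribution P (Z_mfun j)]_u g u = \int[mu]_u g u)%E.
Proof.
apply: eq_measure_integral => A mA _.
by case: iidZ => _ /(_ j A mA).
Qed.

Lemma fresh_integrable (H : Om -> R) : P.-integrable setT (EFin \o H) ->
  (forall w, (\int[mu]_u `|h w u|%:E <= (H w)%:E)%E) ->
  P.-integrable setT (fun w => (h w (Z j w))%:E).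
Proof.
move=> iH hH; apply: (freeze_integrable ind mh iH) => w.
by rewrite law; exact: hH.
Qed.

(** A sample outside [S] is independent of everything that [h] knows, and can be
integrated out first. *)
Lemma fresh_eq (H m : Om -> R) : P.-integrable setT (EFin \o H) ->
  (forall w, (\int[mu]_u `|h w u|%:E <= (H w)%:E)%E) ->
  (forall w, (\int[mu]_u (h w u)%:E = (m w)%:E)%E) ->
  \int[P]_w h w (Z j w) = \int[P]_w m w.
Proof.
move=> iH hH hm; congr fine.
rewrite (freeze_integral ind mh iH); last by move=> w; rewrite law; exact: hH.
by apply: eq_integral => w _; rewrite law hm.
Qed.

Lemma fresh_le (H : Om -> R) : (forall w u, 0 <= h w u) ->
  P.-integrable setT (EFin \o H) ->
  (forall w, (\int[mu]_u (h w u)%:E <= (H w)%:E)%E) ->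
  P.-integrable setT (fun w => (h w (Z j w))%:E) /\
  \int[P]_w h w (Z j w) <= \int[P]_w H w.
Proof.
move=> h0 iH hH.
have hH' w : (\int[mu]_u `|h w u|%:E <= (H w)%:E)%E.
  by under eq_integral do rewrite ger0_norm//; exact: hH.
have i1 := fresh_integrable iH hH'; split=> //.
apply: fine_le; [exact: integrable_fin_num|exact: integrable_fin_num|].
rewrite (freeze_integral ind mh iH); last by move=> w; rewrite law; exact: hH'.
apply: ge0_le_integral => //.
- by move=> w _; rewrite law; apply: integral_ge0 => u _; rewrite lee_fin.
- under eq_fun do rewrite law.
  apply: (@known_measurable S); rewrite /known.
  apply: (measurable_fun_fubini_tonelli_F (fun p : algebra S * Xi => (h p.1 p.2)%:E)).
    exact/measurable_EFinP.
  by move=> p; rewrite lee_fin.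
- exact: measurable_int iH.
- by move=> w _; rewrite law; exact: hH.
Qed.

End Fresh.

End KnownFunctions.

(** * Exponential inequalities *)

Section MonotoneByDerivative.
Context (R : realType).
Implicit Types (f g : R -> R) (a b x : R).

Let der f x a := is_derive x (1 : R) f a.

Let derD f g x a b : der f x a -> der g x b -> der (fun y => f y + g y) x (a + b).
Proof. by move=> hf hg; exact: is_deriveD. Qed.

Let derM f g x a b : der f x a -> der g x b ->
  der (fun y => f y * g y) x (f x * b + g x * a).
Proof. by move=> hf hg; exact: is_deriveM. Qed.

Let derZ f x a c : der f x a -> der (fun y => c * f y) x (c * a).
Proof. by move=> hf; exact: is_deriveZ. Qed.

Let derX x k : der (fun y => y ^+ k.+1) x (k.+1%:R * x ^+ k).
Proof.
have := @is_deriveX R R (@idfun R) k.+1 x 1 1 (is_derive_id x 1).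
have -> : (@idfun R : R -> R) ^+ k.+1 = (fun y => y ^+ k.+1).
  by apply/funext => y; rewrite exprfctE.
by rewrite /GRing.scale /= mulr1.
Qed.

Let derid x : der (fun y => y) x 1. Proof. exact: is_derive_id. Qed.

Let derE x : der expR x (expR x). Proof. exact: is_derive_expR. Qed.

Let derEN x : der (fun y => expR (- y)) x (- expR (- x)).
Proof.
have h : is_derive x (1 : R) (-%R : R -> R) (-1) by exact: is_deriveNid.
have := @is_derive1_comp R expR -%R x (expR (- x)) (-1) _ h.
by rewrite mulrN1; apply; exact: is_derive_expR.
Qed.

Let der_cont f (df : R -> R) : (forall x, der f x (df x)) -> continuous f.
Proof.
by move=> hf x; apply/differentiable_continuous/derivable1_diffP; case: (hf x).
Qed.

Let der_le f (df : R -> R) a b : (forall x, der f x (df x)) ->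
  (forall x, a <= x <= b -> 0 <= df x) -> a <= b -> f a <= f b.
Proof.
move=> hf df0 ab.
have [c cab e] := MVT_segment ab (fun x _ => hf x)
  (continuous_subspaceT (der_cont hf)).
rewrite -subr_ge0 e mulr_ge0 ?subr_ge0// df0//.
Qed.

(** Hyperbolic cosine and sine. *)
Definition ch x := (expR x + expR (- x)) / 2.
Definition sh x := (expR x - expR (- x)) / 2.

Let der_ch x : der ch x (sh x).
Proof.
have := derZ 2^-1 (derD (derE x) (derEN x)).
by rewrite mulrC -/(sh x) (_ : (fun y => _) = ch)//; apply/funext => y; rewrite mulrC.
Qed.

Let der_sh x : der sh x (ch x).
Proof.
have := derZ 2^-1 (derD (derE x) (derZ (-1) (derEN x))).
rewrite mulrC mulN1r opprK -/(ch x) (_ : (fun y => _) = sh)//.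
by apply/funext => y; rewrite mulN1r mulrC.
Qed.

Lemma ch_ge1 x : 1 <= ch x.
Proof. by rewrite /ch; have := expR_ge1Dx x; have := expR_ge1Dx (- x); lra. Qed.

Lemma chN x : ch (- x) = ch x.
Proof. by rewrite /ch opprK addrC. Qed.

Lemma sh_le_ch x : `|sh x| <= ch x.
Proof.
rewrite ler_norml /sh /ch; have := expR_gt0 x; have := expR_gt0 (- x).
by move=> *; apply/andP; split; lra.
Qed.

Lemma sh0 : sh 0 = 0. Proof. by rewrite /sh oppr0 subrr mul0r. Qed.
Lemma ch0 : ch 0 = 1. Proof. by rewrite /ch oppr0 expR0; lra. Qed.

Lemma chD x y : ch (x + y) = ch x * ch y + sh x * sh y.
Proof. by rewrite /ch /sh opprD !expRD; field. Qed.

Lemma sh_ge_id x : 0 <= x -> x <= sh x.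
Proof.
move=> x0; have := @der_le (fun y => sh y + -1 * y) (fun y => ch y + -1 * 1) 0 x.
rewrite /= sh0 mulr0 addr0 (mulN1r x) subr_ge0; apply=> // y; last by rewrite mulr1 subr_ge0 ch_ge1.
exact: derD (der_sh y) (derZ (-1) (derid y)).
Qed.

Lemma sh_le_xch x : 0 <= x -> sh x <= x * ch x.
Proof.
move=> x0; have := @der_le (fun y => y * ch y + -1 * sh y)
  (fun y => y * sh y + ch y * 1 + -1 * ch y) 0 x.
rewrite /= sh0 mulr0 mul0r addr0 (mulN1r (sh x)) subr_ge0; apply=> // y.
  exact: derD (derM (derid y) (der_ch y)) (derZ (-1) (der_sh y)).
move=> /andP[y0 _]; rewrite mulr1 mulN1r addrK mulr_ge0//.
exact: le_trans (sh_ge_id y0).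
Qed.

Lemma ch_le x y : 0 <= x <= y -> ch x <= ch y.
Proof.
move=> /andP[x0 xy]; apply: (der_le der_ch) => // z /andP[xz _].
by apply: le_trans (sh_ge_id _); exact: le_trans xz.
Qed.

(** Monotonicity of sinh(x)/x, with the denominators cleared. *)
Lemma sh_ratio x y : 0 <= x <= y -> sh x * y <= sh y * x.
Proof.
move=> /andP[x0 xy].
have := @der_le (fun z => x * sh z + - sh x * z) (fun z => x * ch z + - sh x * 1) x y.
rewrite /= (mulNr _ x) (mulNr _ y) [x * sh x]mulrC subrr => h.
have {}h : 0 <= x * sh y - sh x * y.
  apply: h => // z; first exact: derD (derZ x (der_sh z)) (derZ (- sh x) (derid z)).
  move=> /andP[xz _]; rewrite mulr1 subr_ge0; apply: le_trans (sh_le_xch x0) _.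
  by rewrite ler_wpM2l// ch_le// x0.
by move: h; rewrite subr_ge0 (mulrC x).
Qed.

(** By convexity of cosh(sqrt v), its tangent at v = c^2 lies below the curve. *)
Lemma ch_sqr_tangent c y : 0 < c -> 0 <= y ->
  ch c + (y ^+ 2 - c ^+ 2) * (sh c / (2 * c)) <= ch y.
Proof.
move=> c0 y0; set k := sh c / (2 * c).
have kE : k * c * 2 = sh c by rewrite /k; field; rewrite gt_eqF.
pose f z := ch z + - k * z ^+ 2; pose df z := sh z + - k * (2 * z ^+ 1).
have df_ z : der f z (df z) by exact: derD (der_ch z) (derZ (- k) (derX z 1)).
suff : f c <= f y by rewrite /f; lra.
have [cy|yc] := leP c y.
  apply: (der_le df_) => // z /andP[cz _]; rewrite /df expr1.
  have := @sh_ratio c z; rewrite (ltW c0) cz -kE => /(_ isT) h.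
  have {}h : (2 * k * z) * c <= sh z * c by lra.
  by move: h; rewrite ler_pM2r//; lra.
rewrite -lerN2; pose g z := -1 * f z.
suff : g y <= g c by rewrite /g !mulN1r.
apply: (@der_le g (fun z => -1 * df z)) => //; last exact: ltW.
  by move=> z; exact: derZ.
move=> z /andP[yz zc]; rewrite /df expr1.
have := @sh_ratio z c; rewrite (le_trans y0 yz) zc -kE => /(_ isT) h.
have {}h : sh z * c <= (2 * k * z) * c by lra.
by move: h; rewrite ler_pM2r//; lra.
Qed.

Lemma sh_sub_le x : 0 <= x -> ch x - expR x + x <= 0 /\ ch x - expR x + x = x - sh x.
Proof.
move=> x0; have e : ch x - expR x + x = x - sh x by rewrite /ch /sh; lra.
by rewrite e; split=> //; rewrite subr_le0 sh_ge_id.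
Qed.

(** Hyperbolic law of cosines, against the Taylor expansion in [p]: by convexity
of cosh(sqrt v) it suffices to look at p = a b and p = - a b. *)
Lemma ch_step a b c p : 0 <= a -> 0 <= b -> 0 <= c -> `|p| <= a * b ->
  c ^+ 2 = a ^+ 2 + 2 * p + b ^+ 2 ->
  ch c <= ch a + p * (sh a / a) + ch a * (expR b - 1 - b).
Proof.
move=> a0 b0 c0 pab cE; have [_ eb] := sh_sub_le b0.
have eb' : expR b - 1 - b = ch b - 1 + (sh b - b) by lra.
have sb := sh_ge_id b0; have cha := ch_ge1 a; have chb := ch_ge1 b.
have [pl pu] : - (a * b) <= p /\ p <= a * b by move: pab; rewrite ler_norml => /andP.
have [ea|an0] := eqVneq a 0.
  have p0 : p = 0 by move: pl pu; rewrite ea mul0r; lra.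
  have -> : c = b.
    apply/eqP; rewrite -(eqrXn2 (n := 2))//; move: cE; rewrite ea p0 => ->.
    by rewrite expr0n /= mulr0 !add0r.
  by rewrite p0 mul0r addr0 ea ch0 eb'; lra.
have ap : 0 < a by rewrite lt_neqAle eq_sym an0.
have [eb0|bn0] := eqVneq b 0.
  have p0 : p = 0 by move: pl pu; rewrite eb0 mulr0; lra.
  have -> : c = a.
    apply/eqP; rewrite -(eqrXn2 (n := 2))//; move: cE; rewrite eb0 p0 => ->.
    by rewrite expr0n /= mulr0 !addr0.
  by rewrite p0 mul0r addr0 eb0 expR0; lra.
have bp : 0 < b by rewrite lt_neqAle eq_sym bn0.
pose th := (1 + p / (a * b)) / 2.
have ab0 : 0 < a * b by rewrite mulr_gt0.
have th0 : 0 <= th.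
  have : -1 <= p / (a * b) by rewrite ler_pdivlMr// mulN1r.
  by rewrite /th; lra.
have th1 : th <= 1.
  have : p / (a * b) <= 1 by rewrite ler_pdivrMr// mul1r.
  by rewrite /th; lra.
have pE : p = (2 * th - 1) * (a * b) by rewrite /th; field; rewrite !gt_eqF.
(* c^2 is the convex combination of (a + b)^2 and (a - b)^2 with weights th and
   1 - th; the tangent at c^2 is averaged over these two points. *)
have law : ch c <= ch a * ch b + (2 * th - 1) * (sh a * sh b).
  have [->|cn0] := eqVneq c 0.
    rewrite ch0; have sa := sh_le_ch a; have sb' := sh_le_ch b.
    have h1 : ch (a + b) >= 1 := ch_ge1 _; have h2 : ch (a + - b) >= 1 := ch_ge1 _.
    move: h1 h2; rewrite !chD chN (_ : sh (- b) = - sh b); last by rewrite /sh opprK; lra.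
    by move=> h1 h2; nra.
  have cp : 0 < c by rewrite lt_neqAle eq_sym cn0.
  have t1 := ch_sqr_tangent cp (addr_ge0 a0 b0).
  have t2 := ch_sqr_tangent cp (normr_ge0 (a - b)).
  have chabs x : ch `|x| = ch x by case: (ger0P x) => // _; rewrite chN.
  rewrite chabs real_normK ?num_real// in t2.
  have sE : ((a + b) ^+ 2 - c ^+ 2) * th + ((a - b) ^+ 2 - c ^+ 2) * (1 - th) = 0.
    by rewrite cE pE; ring.
  have r1 := ler_wpM2l th0 t1.
  have th1' : 0 <= 1 - th by lra.
  have r2 := ler_wpM2l th1' t2.
  move: r1 r2; set k := sh c / _; rewrite !mulrDr !chD chN.
  rewrite (_ : sh (- b) = - sh b); last by rewrite /sh opprK; lra.
  move=> r1 r2.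
  have e0 : th * (((a + b) ^+ 2 - c ^+ 2) * k) + (1 - th) * (((a - b) ^+ 2 - c ^+ 2) * k) = 0.
    by rewrite -[RHS](mul0r k) -sE; ring.
  lra.
apply: le_trans law _; rewrite eb'.
have -> : p * (sh a / a) = (2 * th - 1) * b * sh a.
  by rewrite pE; field; rewrite gt_eqF.
have sa := sh_le_ch a; have sa0 : 0 <= sh a := le_trans a0 (sh_ge_id a0).
have sal : sh a <= ch a by apply: le_trans (ler_norm _) sa.
have h1 : sh a * (sh b - b) * (2 * th - 1) <= sh a * (sh b - b).
  have w0 : 0 <= sh a * (sh b - b) by rewrite mulr_ge0 ?subr_ge0.
  have th2 : 2 * th - 1 <= 1 by lra.
  by have := ler_wpM2l w0 th2; rewrite mulr1.
have h2 : sh a * (sh b - b) <= ch a * (sh b - b) by rewrite ler_wpM2r ?subr_ge0.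
lra.
Qed.

(* The quintic Taylor polynomial, with a leading term large enough to dominate
   the exponential up to 16/9. *)
Let Q x := 1 + x + 2^-1 * x ^+ 2 + 6^-1 * x ^+ 3 + 24^-1 * x ^+ 4 + 120^-1 * x ^+ 5
  + (20 * 25)^-1 * x ^+ 6.

Let dQ x : R := 0 + 1 + 2^-1 * (2%:R * x ^+ 1) + 6^-1 * (3%:R * x ^+ 2)
  + 24^-1 * (4%:R * x ^+ 3) + 120^-1 * (5%:R * x ^+ 4) + (20 * 25)^-1 * (6%:R * x ^+ 5).

Let der_Q x : der Q x (dQ x).
Proof.
have d1 : der (fun=> 1 : R) x 0 by exact: is_derive_cst.
exact: derD (derD (derD (derD (derD (derD d1 (derid x)) (derZ _ (derX x 1)))
  (derZ _ (derX x 2))) (derZ _ (derX x 3))) (derZ _ (derX x 4))) (derZ _ (derX x 5)).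
Qed.

Let expR_le_Q x : 0 <= x <= 16 / 9 -> expR x <= Q x.
Proof.
move=> /andP[x0 x1].
have := @der_le (fun y => Q y * expR (- y))
  (fun y => Q y * - expR (- y) + expR (- y) * dQ y) 0 x.
have Q0 : Q 0 = 1 by rewrite /Q !expr0n /= !mulr0 !addr0.
rewrite oppr0 expR0 Q0 mulr1 => h.
have {}h : 1 <= Q x * expR (- x).
  apply: h x0 => y; first exact: derM (der_Q y) (derEN y).
  move=> /andP[y0 yx].
  have -> : Q y * - expR (- y) + expR (- y) * dQ y =
      expR (- y) * (y ^+ 5 * (6 * (20 * 25)^-1 - 120^-1 - (20 * 25)^-1 * y)).
    by rewrite /Q /dQ; field.
  apply: mulr_ge0; first exact: expR_ge0.
  apply: mulr_ge0; first exact: exprn_ge0.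
  lra.
have := ler_wpM2l (expR_ge0 x) h; rewrite mulr1 mulrCA (@expRxMexpNx_1 R) mulr1.
by [].
Qed.

Let expR_ge_cubic (u : R) : 0 <= u -> 1 + u + 2^-1 * u ^+ 2 + 6^-1 * u ^+ 3 <= expR u.
Proof.
move=> u0; pose q y : R := 1 + y + 2^-1 * y ^+ 2 + 6^-1 * y ^+ 3.
pose dq y : R := 0 + 1 + 2^-1 * (2%:R * y ^+ 1) + 6^-1 * (3%:R * y ^+ 2).
have der_q y : der q y (dq y).
  have d1 : der (fun=> 1 : R) y 0 by exact: is_derive_cst.
  exact: derD (derD (derD d1 (derid y)) (derZ _ (derX y 1))) (derZ _ (derX y 2)).
have := @der_le (fun y => -1 * (q y * expR (- y)))
  (fun y => -1 * (q y * - expR (- y) + expR (- y) * dq y)) 0 u.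
have q0 : q 0 = 1 by rewrite /q !expr0n /= !mulr0 !addr0.
rewrite oppr0 expR0 q0 !mulr1 => h.
have {}h : -1 <= -1 * (q u * expR (- u)).
  apply: h u0 => y; first exact: derZ (derM (der_q y) (derEN y)).
  move=> /andP[y0 yx].
  have -> : -1 * (q y * - expR (- y) + expR (- y) * dq y) =
      expR (- y) * (6^-1 * y ^+ 3) by rewrite /q /dq; field.
  by rewrite mulr_ge0 ?expR_ge0// mulr_ge0 ?exprn_ge0.
have {}h : q u * expR (- u) <= 1 by lra.
have := ler_wpM2l (expR_ge0 u) h; rewrite mulr1 mulrCA (@expRxMexpNx_1 R) mulr1.
by [].
Qed.

(** Up to 16/9 Taylor polynomials suffice: the difference is x^2 times the sum of
a square and a nonnegative polynomial.  Beyond 16/9 the quadratic exceeds x. *)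
Lemma expR_sub_le x : 0 <= x -> expR x - x <= expR (9 / 16 * x ^+ 2).
Proof.
move=> x0; have [x1|x1] := leP x (16 / 9); last first.
  have : expR x <= expR (9 / 16 * x ^+ 2) by rewrite ler_expR expr2; nra.
  lra.
have := expR_le_Q (introT andP (conj x0 x1)).
have u0 : 0 <= 9 / 16 * x ^+ 2 by rewrite mulr_ge0// sqr_ge0.
have := expR_ge_cubic u0; rewrite /Q => h1 h2.
apply: le_trans (_ : _ <= Q x - x) _; first by rewrite /Q; lra.
apply: le_trans h1; rewrite -subr_ge0 /Q.
pose c2 : R := (9 / 16) ^+ 2 / 2 - 24^-1 - 9^-1; pose c3 : R := (9 / 16) ^+ 3 / 6 - (20 * 25)^-1.
have -> : 1 + 9 / 16 * x ^+ 2 + 2^-1 * (9 / 16 * x ^+ 2) ^+ 2 +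
    6^-1 * (9 / 16 * x ^+ 2) ^+ 3 -
    (1 + x + 2^-1 * x ^+ 2 + 6^-1 * x ^+ 3 + 24^-1 * x ^+ 4 +
     120^-1 * x ^+ 5 + (20 * 25)^-1 * x ^+ 6 - x) =
    x ^+ 2 * ((4^-1 - 3^-1 * x) ^+ 2 + x ^+ 2 * (c2 - 120^-1 * x + x ^+ 2 * c3)).
  by rewrite /c2 /c3; field.
have c2_ge : 200^-1 <= c2 by rewrite /c2; lra.
have c3_ge : 40^-1 <= c3 by rewrite /c3; lra.
clearbody c2 c3.
apply: mulr_ge0; first exact: sqr_ge0.
apply: addr_ge0; first exact: sqr_ge0.
apply: mulr_ge0; first exact: sqr_ge0.
have h := ler_wpM2l (sqr_ge0 x) c3_ge; have := sqr_ge0 (x - 6^-1).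
move: h; rewrite !expr2; nra.
Qed.

(** The tangent at q z lies below the exponential at 0 and at z. *)
Lemma expR_convex_comb (q z : R) : 0 <= q <= 1 -> expR (q * z) <= 1 - q + q * expR z.
Proof.
move=> /andP[q0 q1]; set e := expR (q * z).
have e0 : 0 <= e := expR_ge0 _.
have h1 : e * (1 + (1 - q) * z) <= expR z.
  have -> : expR z = e * expR ((1 - q) * z) by rewrite -expRD; congr expR; ring.
  by rewrite ler_wpM2l// expR_ge1Dx.
have h2 : e * (1 - q * z) <= 1.
  rewrite -[leRHS](@expRxMexpNx_1 R (q * z)) ler_wpM2l//.
  exact: expR_ge1Dx.
have := ler_wpM2l q0 h1; have q1' : 0 <= 1 - q by lra.
have := ler_wpM2l q1' h2; lra.
Qed.

(** Sub-Gaussian bound for the nonlinear part of the exponential, in a form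
that can be integrated against exp(x^2) - the light tail of the noise: small
[t] by the previous inequality, large [t] by Young's. *)
Lemma expR_sub_light_tail (t : R) : 0 <= t -> exists2 q : R, 0 <= q <= 1 &
  forall x, 0 <= x ->
    expR (t * x) - t * x <= expR (3 / 4 * t ^+ 2) * (1 - q + q * expR (x ^+ 2 - 1)).
Proof.
move=> t0; have [ts|tl] := leP (9 / 16 * t ^+ 2) 1.
  have q0 : 0 <= 9 / 16 * t ^+ 2 by rewrite mulr_ge0// sqr_ge0.
  exists (9 / 16 * t ^+ 2) => [|x x0]; first by rewrite q0 ts.
  apply: le_trans (expR_sub_le (mulr_ge0 t0 x0)) _.
  have := expR_convex_comb (x ^+ 2 - 1) (introT andP (conj q0 ts)).
  set w := 1 - _ + _ => hw.
  apply: (@le_trans _ _ (expR (9 / 16 * t ^+ 2) * w)).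
    have -> : 9 / 16 * (t * x) ^+ 2 = 9 / 16 * t ^+ 2 + 9 / 16 * t ^+ 2 * (x ^+ 2 - 1).
      by ring.
    by rewrite expRD ler_wpM2l ?expR_ge0.
  rewrite ler_wpM2r//; first exact: le_trans (expR_ge0 _) hw.
  by rewrite ler_expR; have := sqr_ge0 t; lra.
exists (2 / 3) => [|x x0]; first by apply/andP; split; lra.
have q01 : ((0 : R) <= 2 / 3) && ((2 / 3 : R) <= 1) by apply/andP; split; lra.
have := expR_convex_comb (x ^+ 2 - 1) q01; set w := 1 - _ + _ => hw.
have tx0 := mulr_ge0 t0 x0.
apply: (@le_trans _ _ (expR (3 / 4 * t ^+ 2) * expR (2 / 3 * (x ^+ 2 - 1)))).
  apply: (@le_trans _ _ (expR (t * x))); first by lra.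
  rewrite -expRD ler_expR; have := sqr_ge0 (3 * t - 4 * x); rewrite !expr2.
  by move: tl; rewrite expr2; lra.
by rewrite ler_wpM2l ?expR_ge0.
Qed.

End MonotoneByDerivative.

(** * Measurability of the method *)

Section OracleMeasurability.
Context (R : realType) (n : nat) d' (Xi : measurableType d') (D : acspg R n Xi).
Let X := domain D.
Let F := val_oracle D.
Let G := grad_oracle D.
Hypotheses (cvX : convex_set X) (cpX : compact X) (X0 : X !=set0).

(** Differentiability is only relative to [X]; the projection turns it into
continuity on the whole space. *)
Lemma gradient_econtinuous (g : 'rV[R]_n -> R) (gg : 'rV[R]_n -> 'rV[R]_n) :
  is_gradient_on X g gg -> econtinuous (fun v => g (proj X v)).
Proof.
move=> hg v e e0; have Xv := proj_in cvX cpX X0 v.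
have [d d0 hd] := (nbhs_enormP _ _).1 (hg _ Xv 1 ltr01).
set y := proj X v in Xv hd *; pose c := 1 + enorm (gg y).
have c0 : 0 < c by rewrite ltr_wpDr ?enorm_ge0.
exists (Num.min d (e / c)) => [|x]; first by rewrite lt_min d0 divr_gt0.
rewrite lt_min => /andP[xd xe].
have xy : enorm (y - proj X x) <= enorm (v - x) by exact: proj_lip.
have := hd (proj X x) (le_lt_trans xy xd) (proj_in cvX cpX X0 x).
rewrite mul1r (enormB _ y) => h.
have h2 := normr_dot_le (gg y) (proj X x - y).
have h3 : enorm (y - proj X x) * c <= e.
  by rewrite -ler_pdivlMr//; exact: le_trans xy (ltW xe).
rewrite distrC.
have -> : g (proj X x) - g y =
   g (proj X x) - g y - dot (gg y) (proj X x - y) + dot (gg y) (proj X x - y) by rewrite subrK.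
apply: le_trans (ler_normD _ _) _; apply: le_trans (lerD h h2) _.
by rewrite (enormB (proj X x)); apply: le_trans h3; rewrite /c mulrDr mulr1 (mulrC (enorm (gg y))).
Qed.

Lemma lipschitz_coord_econtinuous (gg : 'rV[R]_n -> 'rV[R]_n) (C : R) i :
  (forall x y, X x -> X y -> enorm (gg x - gg y) <= C * enorm (x - y)) ->
  econtinuous (fun v => gg (proj X v) 0 i).
Proof.
move=> hg; apply: (@lipschitz_econtinuous _ _ _ `|C|) => x y.
have -> : gg (proj X x) 0 i - gg (proj X y) 0 i = (gg (proj X x) - gg (proj X y)) 0 i.
  by rewrite !mxE.
apply: le_trans (coord_le_enorm _ _) _.
apply: le_trans (hg _ _ (proj_in cvX cpX X0 x) (proj_in cvX cpX X0 y)) _.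
apply: (@le_trans _ _ (`|C| * enorm (proj X x - proj X y))).
  by rewrite ler_wpM2r ?enorm_ge0// ler_norm.
by rewrite ler_wpM2l// proj_lip.
Qed.

Lemma proj_econtinuous i : econtinuous (fun v => proj X v 0 i).
Proof.
apply: (@lipschitz_coord_econtinuous id 1) => x y _ _.
by rewrite mul1r.
Qed.

Hypothesis mF : forall x, X x -> measurable_fun setT (F x).
Hypothesis mG : forall x i, X x -> measurable_fun setT (fun u => G x u 0 i).
Hypothesis gradF : forall u, is_gradient_on X (F ^~ u) (G ^~ u).
Context (Lxi : Xi -> R).
Hypothesis lipG : forall u x y, X x -> X y ->
  enorm (G x u - G y u) <= Lxi u * enorm (x - y).

Section Along.
Context d (T : measurableType d).
Context (x : T -> 'rV[R]_n) (u : T -> Xi).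
Hypotheses (mx : vmeasurable x) (Xx : forall w, X (x w)) (mu : measurable_fun setT u).

Let projx w : proj X (x w) = x w. Proof. exact: proj_id. Qed.

Lemma measurable_gradient_fun (g : 'rV[R]_n -> R) (gg : 'rV[R]_n -> 'rV[R]_n) :
  is_gradient_on X g gg -> measurable_fun setT (fun w => g (x w)).
Proof.
move=> hg; under eq_fun do rewrite -projx.
apply: (@measurable_caratheodory _ _ _ _ (fun v _ => g (proj X v))) => //.
by move=> w; exact: gradient_econtinuous hg.
Qed.

Lemma vmeasurable_lipschitz (gg : 'rV[R]_n -> 'rV[R]_n) (C : R) :
  (forall x y, X x -> X y -> enorm (gg x - gg y) <= C * enorm (x - y)) ->
  vmeasurable (fun w => gg (x w)).
Proof.
move=> hg; rewrite (_ : (fun w => gg (x w)) = (fun w => gg (proj X (x w)))); last first.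
  by apply/funext => w; rewrite projx.
apply: (@vmeasurable_caratheodory _ _ _ _ (fun v _ => gg (proj X v))) => //.
- by move=> v; exact: vmeasurable_cst.
- by move=> w i; exact: lipschitz_coord_econtinuous hg.
Qed.

Lemma measurable_val_oracle : measurable_fun setT (fun w => F (x w) (u w)).
Proof.
under eq_fun do rewrite -projx.
apply: (@measurable_caratheodory _ _ _ _ (fun v w => F (proj X v) (u w))) => //.
  by move=> v; apply: measurableT_comp (mF _) mu; exact: proj_in.
by move=> w; exact: gradient_econtinuous (gradF (u w)).
Qed.

Lemma vmeasurable_grad_oracle : vmeasurable (fun w => G (x w) (u w)).
Proof.
rewrite (_ : (fun w => _) = (fun w => G (proj X (x w)) (u w))); last first.
  by apply/funext => w; rewrite projx.
apply: (@vmeasurable_caratheodory _ _ _ _ (fun v w => G (proj X v) (u w))) => //.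
  by move=> v i; apply: (measurableT_comp (mG i _) mu); exact: proj_in.
by move=> w i; apply: (@lipschitz_coord_econtinuous (G ^~ (u w)) (Lxi (u w))) => *; exact: lipG.
Qed.

End Along.

Section RunMeasurability.
Context d (T : measurableType d).

Lemma vmeasurable_prox (x g : T -> 'rV[R]_n) (gam : T -> R) :
  vmeasurable x -> vmeasurable g -> measurable_fun setT gam -> (forall w, 0 < gam w) ->
  vmeasurable (fun w => prox X (x w) (g w) (gam w)).
Proof.
move=> mx mg mgam gam0.
rewrite (_ : (fun w => _) = (fun w => proj X (x w - (gam w)^-1 *: g w))); last first.
  by apply/funext => w; rewrite prox_proj.
apply: (@vmeasurable_caratheodory _ _ _ _ (fun v _ => proj X v)).
- by move=> v; exact: vmeasurable_cst.
- by move=> w i; exact: proj_econtinuous.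
- by apply: vmeasurableB => //; apply: vmeasurableZ => //; exact: measurable_funV.
Qed.

Lemma measurable_nat_fun d2 (U : measurableType d2) (g : nat -> U) (N : T -> nat) :
  measurable_fun setT N -> measurable_fun setT (fun w => g (N w)).
Proof.
by move=> mN; apply: (measurable_nat_choice (h := fun j _ => g j)).
Qed.

Lemma measurable_bigmax (a : R) (b : nat) (h : nat -> T -> R) :
  (forall j, measurable_fun setT (h j)) ->
  measurable_fun setT (fun w => \big[Num.max/a]_(j < b) h j w).
Proof.
elim: b h => [|b IH] h mh.
  by under eq_fun do rewrite big_ord0; exact: measurable_cst.
under eq_fun do rewrite big_ord_recl /=.
by apply: measurable_maxr => //; apply: (IH (fun j => h j.+1)).
Qed.

Lemma measurable_local_estimate b (s : nat -> T -> Xi) (x y : T -> 'rV[R]_n) :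
  (forall j, measurable_fun setT (s j)) -> vmeasurable x -> vmeasurable y ->
  (forall w, X (x w)) -> (forall w, X (y w)) ->
  measurable_fun setT (fun w => local_estimate D b (fun j => s j w) (x w) (y w)).
Proof.
move=> ms mx my Xx Xy.
have mL j : measurable_fun setT (fun w =>
    local_curv (F ^~ (s j w)) (G ^~ (s j w)) (x w) (y w)).
  apply: measurable_fun_div.
    apply: measurable_funM; first exact: measurable_cst.
    apply: measurable_funB; last first.
      apply: measurable_dot; last exact: vmeasurableB.
      exact: vmeasurable_grad_oracle.
    by apply: measurable_funB; exact: measurable_val_oracle.
  by apply: measurable_funX; apply: measurable_enorm; exact: vmeasurableB.
rewrite /local_estimate; case: (est D).
  by apply: measurable_funM; [exact: measurable_cst|exact: measurable_sum].
by apply: (measurable_bigmax (Lbar0 D) b (h := fun j w =>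
  local_curv (F ^~ (s j w)) (G ^~ (s j w)) (x w) (y w))).
Qed.

Lemma vmeasurable_avg_grad b (s : nat -> T -> Xi) (x : T -> 'rV[R]_n) :
  (forall j, measurable_fun setT (s j)) -> vmeasurable x -> (forall w, X (x w)) ->
  vmeasurable (fun w => avg_grad G b (fun j => s j w) (x w)).
Proof.
move=> ms mx Xx; apply: vmeasurableZ; first exact: measurable_cst.
by apply: vmeasurable_sum => j; exact: vmeasurable_grad_oracle.
Qed.

Definition state_measurable (st : T -> state R n) :=
  [/\ vmeasurable (fun w => iterate (st w)), measurable_fun setT (fun w => Lhat (st w)),
      measurable_fun setT (fun w => idx (st w)) & measurable_fun setT (fun w => seg (st w))].

Lemma measurable_grad_batch (i : T -> nat) (gam : T -> R) :
  measurable_fun setT i -> measurable_fun setT gam ->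
  measurable_fun setT (fun w => grad_batch D (i w) (gam w)).
Proof.
move=> mi mgam; rewrite /grad_batch.
apply: (@measurable_ceil _ _ _ _ nat (fun c => maxn 1 `|c|%N)).
apply: measurable_funM; last by apply: measurable_fun_div => //; exact: measurable_cst.
by apply: (measurable_nat_fun (fun j : nat => (11 * j%:R / 8 + 7 / 8 : R))).
Qed.

Lemma acspg_step_measurable t (s s' : nat -> T -> Xi) (st : T -> state R n) :
  (forall j, measurable_fun setT (s j)) -> (forall j, measurable_fun setT (s' j)) ->
  (forall w, X (iterate (st w))) -> (forall w, 0 < Lhat (st w)) ->
  state_measurable st ->
  state_measurable (fun w =>
    acspg_step D t (fun j => s j w) (fun j => s' j w) (st w)).
Proof.
move=> ms ms' Xx L0 [mx mL mi msg].
have mgam : measurable_fun setT (fun w => 4 * Lhat (st w)).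
  by apply: measurable_funM => //; exact: measurable_cst.
have gam0 w : 0 < 4 * Lhat (st w) by rewrite mulr_gt0.
pose g w := avg_grad G (grad_batch D (idx (st w)) (4 * Lhat (st w)))
  (fun j => s j w) (iterate (st w)).
have mg : vmeasurable g.
  apply: (vmeasurable_nat_choice
    (h := fun b w => avg_grad G b (fun j => s j w) (iterate (st w)))).
    exact: measurable_grad_batch.
  by move=> b; exact: vmeasurable_avg_grad.
pose x' w := prox X (iterate (st w)) (g w) (4 * Lhat (st w)).
have mx' : vmeasurable x' by exact: vmeasurable_prox.
have Xx' w : X (x' w) by exact: prox_in.
pose Lb w := local_estimate D (est_batch D t) (fun j => s' j w) (x' w) (iterate (st w)).
have mLb : measurable_fun setT Lb by exact: measurable_local_estimate.
pose ns w := (1 < t)%N && (3 / 2 * Lhat (st w) < Lb w).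
have mns : measurable_fun setT ns.
  apply: measurable_and; first exact: measurable_cst.
  apply: measurable_fun_ltr => //.
  by apply: measurable_funM => //; exact: measurable_cst.
have msucc N : measurable_fun setT N -> measurable_fun setT (fun w : T => (N w).+1).
  by move=> mN; exact: (measurable_nat_fun S).
split=> //.
- exact: measurable_maxr.
- apply: measurable_fun_ifT; [exact: mns|exact: measurable_cst|exact: msucc].
- apply: measurable_fun_ifT; [exact: mns|exact: msucc|exact: msg].
Qed.

End RunMeasurability.

End OracleMeasurability.

(** * Expectations *)

Section Expectation.
Context d (T : measurableType d) (R : realType) (P : probability T R).
Implicit Types f g : T -> R.

Definition itg f := P.-integrable setT (fun w => (f w)%:E).
Definition mean f : R := \int[P]_w f w.

Lemma itg_measurable f : itg f -> measurable_fun setT f.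
Proof. by move=> /measurable_int /measurable_EFinP. Qed.

Lemma int_mean f : itg f -> (\int[P]_w (f w)%:E = (mean f)%:E)%E.
Proof. by move=> hf; rewrite fineK//; exact: integrable_fin_num. Qed.

Lemma itg_le f g : measurable_fun setT f -> (forall w, `|f w| <= g w) -> itg g -> itg f.
Proof.
move=> mf fg ig; apply: le_integrable ig => //; first exact/measurable_EFinP.
by move=> w _; rewrite lee_fin; apply: le_trans (fg w) _; exact: ler_norm.
Qed.

Lemma itg_cst (c : R) : itg (fun=> c).
Proof.
apply: measurable_bounded_integrable => //.
  by rewrite [X in (X < _)%E](@probability_setT _ _ _ P) ltry.
exact: bounded_cst.
Qed.

Lemma itg_bounded f M : measurable_fun setT f -> (forall w, `|f w| <= M) -> itg f.
Proof. by move=> mf fM; apply: itg_le mf fM _; exact: itg_cst. Qed.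

Lemma itgD f g : itg f -> itg g -> itg (fun w => f w + g w).
Proof. by move=> hf hg; exact: (integrableD measurableT hf hg). Qed.

Lemma itgZ (c : R) f : itg f -> itg (fun w => c * f w).
Proof. by move=> hf; exact: (integrableZl measurableT c hf). Qed.

Lemma itgN f : itg f -> itg (fun w => - f w).
Proof. by move=> hf; under [X in itg X]funext do rewrite -mulN1r; exact: itgZ. Qed.

Lemma itgB f g : itg f -> itg g -> itg (fun w => f w - g w).
Proof. by move=> hf hg; apply: itgD => //; exact: itgN. Qed.

Lemma itg_sum (I : Type) (s : seq I) (h : I -> T -> R) :
  (forall i, itg (h i)) -> itg (fun w => \sum_(i <- s) h i w).
Proof.
move=> hh; elim: s => [|i s IH].
  by under [X in itg X]funext do rewrite big_nil; exact: itg_cst.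
by under [X in itg X]funext do rewrite big_cons; exact: itgD.
Qed.

Lemma itg_norm f : itg f -> itg (fun w => `|f w|).
Proof. by move=> hf; exact: (integrable_abse hf). Qed.

Lemma eq_mean f g : f =1 g -> mean f = mean g.
Proof. by move=> /funext ->. Qed.

Lemma meanD f g : itg f -> itg g -> mean (fun w => f w + g w) = mean f + mean g.
Proof. exact: RintegralD. Qed.

Lemma meanB f g : itg f -> itg g -> mean (fun w => f w - g w) = mean f - mean g.
Proof. exact: RintegralB. Qed.

Lemma meanZ (c : R) f : itg f -> mean (fun w => c * f w) = c * mean f.
Proof. exact: RintegralZl. Qed.

Lemma mean_cst (c : R) : mean (fun=> c) = c.
Proof.
by rewrite /mean Rintegral_cst// [X in fine X](@probability_setT _ _ _ P) mulr1.
Qed.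

Lemma mean_sum (I : Type) (s : seq I) (h : I -> T -> R) : (forall i, itg (h i)) ->
  mean (fun w => \sum_(i <- s) h i w) = \sum_(i <- s) mean (h i).
Proof.
move=> hh; elim: s => [|i s IH].
  by rewrite (eq_mean (g := fun=> 0)) ?mean_cst ?big_nil// => w; rewrite big_nil.
rewrite big_cons -IH -meanD//; last exact: itg_sum.
by apply: eq_mean => w; rewrite big_cons.
Qed.

Lemma mean_le f g : itg f -> itg g -> (forall w, f w <= g w) -> mean f <= mean g.
Proof. by move=> hf hg fg; apply: le_Rintegral. Qed.

Lemma mean_ge0 f : (forall w, 0 <= f w) -> 0 <= mean f.
Proof. by move=> f0; apply: Rintegral_ge0. Qed.

Lemma mean_le_ae f g : itg f -> itg g -> {ae P, forall w, f w <= g w} ->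
  mean f <= mean g.
Proof.
move=> hf hg fg; rewrite -lee_fin -!int_mean//.
pose h w := Num.max (f w) (g w).
have mf := itg_measurable hf; have mg := itg_measurable hg.
have -> : (\int[P]_w (g w)%:E = \int[P]_w (h w)%:E)%E.
  apply: ae_eq_integral => //.
  - exact/measurable_EFinP.
  - by apply/measurable_EFinP; exact: measurable_maxr.
  - by apply: filterS fg => w fgw _; rewrite /h max_r.
apply: le_integral => //.
  apply: (@itg_le _ (fun w => `|f w| + `|g w|)).
  - exact: measurable_maxr.
  - move=> w; rewrite /h; case: (leP (f w) (g w)) => _; first by rewrite lerDr.
    by rewrite lerDl.
  - by apply: itgD; exact: itg_norm.
by move=> w _; rewrite lee_fin /h le_max lexx.
Qed.

Lemma itg_ge0_le f (c : R) : measurable_fun setT f -> (forall w, 0 <= f w) ->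
  (\int[P]_w (f w)%:E <= c%:E)%E -> itg f /\ mean f <= c.
Proof.
move=> mf f0 hc.
have hf : itg f.
  apply/integrableP; split; first exact/measurable_EFinP.
  under eq_integral do rewrite abse_EFin ger0_norm//.
  exact: le_lt_trans hc (ltry _).
by split=> //; rewrite -lee_fin -int_mean.
Qed.

End Expectation.

Lemma mean_indic d1 (U : measurableType d1) (R : realType) (Q : probability U R) (p : U -> bool) :
  measurable [set u | p u] ->
  itg Q (fun u => (p u)%:R) /\ mean Q (fun u => (p u)%:R) = fine (Q [set u | p u]).
Proof.
move=> mp; have e u : (p u)%:R = \1_[set u | p u] u :> R.
  by rewrite indicE mem_setE.
have i1 : itg Q (fun u => (p u)%:R).
  apply: (@itg_bounded _ _ _ _ _ 1) => [|u]; last by case: (p u); rewrite ?normr1 ?normr0.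
  by under eq_fun do rewrite e; exact: measurable_indic.
split=> //; rewrite /mean /Rintegral; congr fine.
under eq_integral do rewrite e.
by rewrite integral_indic// setIT.
Qed.

Lemma itg_le_ae d1 (U : measurableType d1) (R : realType) (Q : probability U R) (g h : U -> R) :
  measurable_fun setT g -> (forall u, 0 <= g u) -> itg Q h ->
  {ae Q, forall u, g u <= h u} -> itg Q g /\ mean Q g <= mean Q h.
Proof.
move=> mg g0 ih gh; suff ig : itg Q g by split=> //; exact: mean_le_ae.
have ih' := itg_norm ih.
suff [] : itg Q g /\ mean Q g <= mean Q (fun u => `|h u|) by [].
apply: itg_ge0_le => //; rewrite -int_mean//; apply: ae_ge0_le_integral => //.
- by move=> u _; rewrite lee_fin.
- exact/measurable_EFinP.
- exact: measurable_int ih'.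
- by apply: filterS gh => u hu _; rewrite lee_fin; apply: le_trans hu (ler_norm _).
Qed.

Section FreshMean.
Context d (Om : measurableType d) d' (Xi : measurableType d') (R : realType).
Context (P : probability Om R) (mu : probability Xi R) (J : eqType).
Context (Z : J -> Om -> Xi).
Hypothesis iidZ : iid P mu Z.
Context (S : set J) (j : J) (h : Om -> Xi -> R).
Hypothesis Sj : ~ S j.
Hypothesis mh : measurable_fun setT (fun p : g_sigma_algebraType (gen Z S) * Xi => h p.1 p.2).

Lemma fresh_mean_eq (H m : Om -> R) : itg P H ->
  (forall w, itg mu (h w)) -> (forall w, mean mu (fun u => `|h w u|) <= H w) ->
  (forall w, mean mu (h w) = m w) ->
  itg P (fun w => h w (Z j w)) /\ mean P (fun w => h w (Z j w)) = mean P m.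
Proof.
move=> iH ih hH hm.
have hH' w : (\int[mu]_u `|h w u|%:E <= (H w)%:E)%E.
  by rewrite int_mean; [rewrite lee_fin|exact: itg_norm].
split; first exact: (fresh_integrable iidZ Sj mh iH hH').
apply: (fresh_eq iidZ Sj mh iH hH') => w.
by rewrite int_mean// hm.
Qed.

Lemma fresh_mean_le (H : Om -> R) : (forall w u, 0 <= h w u) -> itg P H ->
  (forall w, itg mu (h w)) -> (forall w, mean mu (h w) <= H w) ->
  itg P (fun w => h w (Z j w)) /\ mean P (fun w => h w (Z j w)) <= mean P H.
Proof.
move=> h0 iH ih hH.
by apply: (fresh_le iidZ Sj mh h0 iH) => w; rewrite int_mean// lee_fin.
Qed.

End FreshMean.

(** * Averages of fresh samples *)

Lemma known_nat_fun d (Om : measurableType d) d' (Xi : measurableType d') (J : eqType)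
    (Z : J -> Om -> Xi) (S : set J) d2 (U : measurableType d2) (g : nat -> U) (N : Om -> nat) :
  known Z S N -> known Z S (fun w => g (N w)).
Proof. by move=> kN; exact: (measurable_nat_fun g kN). Qed.

Lemma mul_le_sqr_sum (R : realType) (a b V : R) : 0 <= a -> b <= V ->
  a * b <= a ^+ 2 + V ^+ 2.
Proof.
move=> a0 bV; apply: (@le_trans _ _ (a * V)); first by rewrite ler_wpM2l.
have := sqr_ge0 (a - V); have := sqr_ge0 a; have := sqr_ge0 V; rewrite !expr2; lra.
Qed.

Section BatchNoise.
Context d (Om : measurableType d) d' (Xi : measurableType d') (R : realType) (n : nat).
Context (P : probability Om R) (mu : probability Xi R) (J : eqType).
Context (Z : J -> Om -> Xi).
Hypothesis iidZ : iid P mu Z.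
(* [e x u] is the error at the point x made with the sample u. *)
Context (X : set 'rV[R]_n) (e : 'rV[R]_n -> Xi -> 'rV[R]_n) (sigma : R).
Hypothesis me : forall d1 (T : measurableType d1) (x : T -> 'rV[R]_n) (u : T -> Xi),
  vmeasurable x -> (forall w, X (x w)) -> measurable_fun setT u ->
  vmeasurable (fun w => e (x w) (u w)).
Hypothesis e_mean : forall x i, X x ->
  itg mu (fun u => e x u 0 i) /\ mean mu (fun u => e x u 0 i) = 0.
Hypothesis e_var : forall x, X x ->
  itg mu (fun u => enorm (e x u) ^+ 2) /\ mean mu (fun u => enorm (e x u) ^+ 2) <= sigma ^+ 2.

Let e_dot x v : X x -> itg mu (fun u => dot (e x u) v) /\ mean mu (fun u => dot (e x u) v) = 0.
Proof.
move=> Xx; have h i : itg mu (fun u => e x u 0 i * v 0 i) /\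
    mean mu (fun u => e x u 0 i * v 0 i) = 0.
  have [h1 h2] := e_mean i Xx.
  under [X in itg _ X]funext do rewrite mulrC.
  under [X in mean _ X]funext do rewrite mulrC.
  by split; [exact: itgZ|rewrite meanZ// h2 mulr0].
split; first by apply: itg_sum => i; case: (h i).
rewrite mean_sum => [|i]; last by case: (h i).
by apply: big1 => i _; case: (h i).
Qed.

Let me1 x : X x -> vmeasurable (e x).
Proof.
by move=> Xx; apply: (@me _ Xi (fun=> x) id) => //; exact: vmeasurable_cst.
Qed.

(* The point is known from [S0]; the samples [idxs] are fresh. *)
Context (S0 : set J) (idxs : nat -> J) (x : Om -> 'rV[R]_n).
Hypotheses (fresh : forall i, ~ S0 (idxs i)) (idxs_inj : injective idxs).
Hypotheses (kx : vknown Z S0 x) (Xx : forall w, X (x w)).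

Definition upto j : set J := S0 `|` [set idxs i | i in [set i | (i < j)%N]].

Let upto_sub j : S0 `<=` upto j. Proof. by move=> ?; left. Qed.

Let upto_mono i j : (i <= j)%N -> upto i `<=` upto j.
Proof.
move=> ij q [|[r /= ri <-]]; [by left|right; exists r => //=].
exact: leq_trans ij.
Qed.

Let upto_fresh j : ~ upto j (idxs j).
Proof. by move=> [/fresh//|[i /= ij /idxs_inj ei]]; rewrite ei ltnn in ij. Qed.

Let e_known i j : (i < j)%N -> vknown Z (upto j) (fun w => e (x w) (Z (idxs i) w)).
Proof.
move=> ij; apply: (@me _ (g_sigma_algebraType (gen Z (upto j)))) => //.
  exact: vknownW (@upto_sub j) kx.
by apply: known_sample; right; exists i.
Qed.

Local Notation alg j := (g_sigma_algebraType (gen Z (upto j))).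

Let fst_known j d2 (U : measurableType d2) (h : Om -> U) : known Z (upto j) h ->
  measurable_fun setT (fun p : alg j * Xi => h p.1).
Proof. by move=> kh; exact: (measurableT_comp kh measurable_fst). Qed.

Let fst_vknown j (h : Om -> 'rV[R]_n) : vknown Z (upto j) h ->
  vmeasurable (fun p : alg j * Xi => h p.1).
Proof. by move=> kh i; exact: fst_known (kh i). Qed.

Let e_joint j : vmeasurable (fun p : alg j * Xi => e (x p.1) p.2).
Proof.
apply: me; [|by move=> p; exact: Xx|exact: measurable_snd].
by apply: fst_vknown; exact: vknownW (@upto_sub j) kx.
Qed.

Section WeightedBatch.
Context (c : Om -> R) (C : R) (b : Om -> nat).
Hypotheses (kc : known Z S0 c) (c0 : forall w, 0 <= c w) (cC : forall w, c w <= C).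
Hypothesis kb : known Z S0 b.

(** The batch size [b] is random; [j] is a deterministic bound that makes the
range of the sum fixed. *)
Definition batch_sum j w :=
  \sum_(i < j) (if (i < b w)%N then e (x w) (Z (idxs i) w) else 0).

Lemma batch_sum_known j : vknown Z (upto j) (batch_sum j).
Proof.
elim: j => [|j IH].
  by move=> i; under eq_fun do rewrite /batch_sum big_ord0; exact: measurable_cst.
move=> i; rewrite /batch_sum; under eq_fun do rewrite big_ord_recr /=.
apply: (@vmeasurableD _ (alg j.+1) R n (batch_sum j)
  (fun w => if (j < b w)%N then e (x w) (Z (idxs j) w) else 0)).
  exact: vknownW (upto_mono (leqnSn j)) IH.
apply: (@vmeasurable_nat_choice _ (alg j.+1) R n b
  (fun m w => if (j < m)%N then e (x w) (Z (idxs j) w) else 0)).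
  exact: knownW (@upto_sub j.+1) kb.
by move=> m; case: (j < m)%N; [exact: e_known|exact: vmeasurable_cst].
Qed.

Let cS j : known Z (upto j) c. Proof. exact: knownW (@upto_sub j) kc. Qed.
Let bS j : known Z (upto j) b. Proof. exact: knownW (@upto_sub j) kb. Qed.

Let c_min_itg (q : Om -> nat) m : known Z S0 q ->
  itg P (fun w => c w * sigma ^+ 2 * (minn m (q w))%:R).
Proof.
move=> kq; apply: (@itg_bounded _ _ _ _ _ (C * sigma ^+ 2 * m%:R)).
  apply: (known_measurable iidZ (S := S0)).
  apply: measurable_funM; last exact: (known_nat_fun (fun q => (minn m q)%:R : R)).
  by apply: measurable_funM => //; exact: measurable_cst.
move=> w; rewrite ger0_norm; last by rewrite mulr_ge0// mulr_ge0// sqr_ge0.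
apply: ler_pM.
- by rewrite mulr_ge0// sqr_ge0.
- by [].
- by rewrite ler_wpM2r ?sqr_ge0.
- by rewrite ler_nat geq_minl.
Qed.

(** Fresh centred samples are orthogonal: the weighted second moment of the sum
grows by at most one variance per sample. *)
Lemma batch_variance j :
  itg P (fun w => c w * enorm (batch_sum j w) ^+ 2) /\
  mean P (fun w => c w * enorm (batch_sum j w) ^+ 2) <=
  mean P (fun w => c w * sigma ^+ 2 * (minn j (b w))%:R).
Proof.
elim: j => [|j [IH1 IH2]].
  have e0 w : c w * enorm (batch_sum 0 w) ^+ 2 = 0.
    by rewrite /batch_sum big_ord0 enorm0 expr0n mulr0.
  under [X in itg _ X]funext do rewrite e0.
  under [X in mean _ X <= _]funext do rewrite e0.
  by split; [exact: itg_cst|rewrite mean_cst; apply: mean_ge0 => w; rewrite mulr_ge0// mulr_ge0// sqr_ge0].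
pose h w u := c w * enorm (batch_sum j w + (if (j < b w)%N then e (x w) u else 0)) ^+ 2.
pose H w := c w * enorm (batch_sum j w) ^+ 2 + c w * sigma ^+ 2 * (j < b w)%:R.
have iH : itg P H.
  apply: itgD => //.
  have -> : (fun w => c w * sigma ^+ 2 * (j < b w)%:R) =
      (fun w => c w * sigma ^+ 2 * (minn 1 (b w - j))%:R).
    by apply/funext => w; congr (_ * _%:R); case: ltnP; lia.
  apply: c_min_itg.
  exact: (known_nat_fun (subn^~ j)).
have mh : measurable_fun setT (fun p : alg j * Xi => h p.1 p.2).
  apply: measurable_funM; first exact: fst_known.
  apply: measurable_funX; apply: measurable_enorm; apply: vmeasurableD.
    by apply: fst_vknown; exact: batch_sum_known.
  apply: (@vmeasurable_nat_choice _ _ _ _ (fun p : alg j * Xi => b p.1)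
    (fun m p => if (j < m)%N then e (x p.1) p.2 else 0)); first exact: fst_known.
  by move=> m; case: (j < m)%N; [exact: e_joint|exact: vmeasurable_cst].
have hw w : itg mu (h w) /\ mean mu (h w) <= H w.
  rewrite /h /H; case: (j < b w)%N; last first.
    by rewrite addr0 mulr0 addr0 mean_cst; split=> //; exact: itg_cst.
  have [d1 d2] := e_dot (batch_sum j w) (Xx w).
  have [v1 v2] := e_var (Xx w).
  have hE u : c w * enorm (batch_sum j w + e (x w) u) ^+ 2 =
      c w * enorm (batch_sum j w) ^+ 2 + 2 * c w * dot (e (x w) u) (batch_sum j w) +
      c w * enorm (e (x w) u) ^+ 2.
    by rewrite enorm_sqrD (dotC (batch_sum j w)); ring.
  under [X in itg _ X]funext do rewrite hE.
  under [X in mean _ X <= _]funext do rewrite hE.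
  have i1 : itg mu (fun u => c w * enorm (batch_sum j w) ^+ 2 +
      2 * c w * dot (e (x w) u) (batch_sum j w)).
    by apply: itgD; [exact: itg_cst|exact: itgZ].
  split; first by apply: itgD => //; exact: itgZ.
  rewrite meanD//; last exact: itgZ.
  rewrite meanD; [|exact: itg_cst|exact: itgZ].
  by rewrite mean_cst !meanZ// d2 mulr0 addr0 mulr1 lerD2l ler_wpM2l.
have hE : (fun w => c w * enorm (batch_sum j.+1 w) ^+ 2) = (fun w => h w (Z (idxs j) w)).
  by apply/funext => w; rewrite /h /batch_sum big_ord_recr.
rewrite hE.
have [] := @fresh_mean_le _ Om _ Xi R P mu J Z iidZ (upto j) (idxs j) h
  (@upto_fresh j) mh H _ iH (fun w => (hw w).1) (fun w => (hw w).2).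
  by move=> w u; rewrite mulr_ge0// sqr_ge0.
move=> ih mh'; split=> //; apply: le_trans mh' _.
have i2 : itg P (fun w => c w * sigma ^+ 2 * (j < b w)%:R).
  have -> : (fun w => c w * sigma ^+ 2 * (j < b w)%:R) =
      (fun w => H w - c w * enorm (batch_sum j w) ^+ 2).
    by apply/funext => w; rewrite /H; ring.
  exact: itgB.
rewrite meanD//.
apply: (@le_trans _ _ (mean P (fun w => c w * sigma ^+ 2 * (minn j (b w))%:R) +
  mean P (fun w => c w * sigma ^+ 2 * (j < b w)%:R))); first by rewrite lerD2r.
rewrite -meanD//; last exact: c_min_itg.
rewrite le_eqVlt; apply/orP; left; apply/eqP; apply: eq_mean => w.
rewrite -mulrDr -natrD; congr (_ * _%:R).
by case: ltnP; lia.
Qed.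

(** The sample is integrated out first, with everything known before frozen. *)
Lemma batch_mean (v : Om -> 'rV[R]_n) (V : R) i : vknown Z S0 v -> (forall w, enorm (v w) <= V) ->
  itg P (fun w => c w * dot (e (x w) (Z (idxs i) w)) (v w)) /\
  mean P (fun w => c w * dot (e (x w) (Z (idxs i) w)) (v w)) = 0.
Proof.
move=> kv vV; pose h w u := c w * dot (e (x w) u) (v w).
have kv0 : vknown Z (upto 0) v by exact: vknownW (@upto_sub 0%N) kv.
have mh : measurable_fun setT (fun p : alg 0%N * Xi => h p.1 p.2).
  apply: measurable_funM; first exact: fst_known.
  by apply: measurable_dot; [exact: e_joint|exact: fst_vknown].
have C0 w : 0 <= C := le_trans (c0 w) (cC w).
have fr0 : ~ upto 0 (idxs i) by move=> [/fresh//|[]].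
have hi w : itg mu (h w) by apply: itgZ; case: (e_dot (v w) (Xx w)).
have habs w : mean mu (fun u => `|h w u|) <= C * (sigma ^+ 2 + V ^+ 2).
  have [v1 v2] := e_var (Xx w).
  have V0 : 0 <= V := le_trans (enorm_ge0 _) (vV w).
  have i1 : itg mu (fun u => C * (enorm (e (x w) u) ^+ 2 + V ^+ 2)).
    by apply: itgZ; apply: itgD => //; exact: itg_cst.
  apply: (@le_trans _ _ (mean mu (fun u => C * (enorm (e (x w) u) ^+ 2 + V ^+ 2)))).
    apply: mean_le => //; first exact: itg_norm.
    move=> u; rewrite /h normrM ger0_norm// ler_pM// ?cC//.
    apply: le_trans (normr_dot_le _ _) _.
    exact: mul_le_sqr_sum (enorm_ge0 _) (vV w).
  have i2 : itg mu (fun u => enorm (e (x w) u) ^+ 2 + V ^+ 2) by apply: itgD => //; exact: itg_cst.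
  rewrite meanZ// meanD//; last exact: itg_cst.
  by rewrite mean_cst ler_wpM2l ?C0// lerD2r.
have := @fresh_mean_eq _ Om _ Xi R P mu J Z iidZ (upto 0) (idxs i) h fr0 mh
  (fun=> C * (sigma ^+ 2 + V ^+ 2)) (fun=> 0) (itg_cst P _) hi habs.
rewrite mean_cst; apply=> w.
by rewrite /h; have [d1 d2] := e_dot (v w) (Xx w); rewrite meanZ// d2 mulr0.
Qed.

End WeightedBatch.

Section Concentration.
Context (c : Om -> R) (C : R).
Hypotheses (kc : known Z S0 c) (c0 : forall w, 0 <= c w) (cC : forall w, c w <= C).
Hypothesis sigma0 : 0 < sigma.
Hypothesis e_tail : forall x, X x ->
  itg mu (fun u => expR (enorm (e x u) ^+ 2 / sigma ^+ 2)) /\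
  mean mu (fun u => expR (enorm (e x u) ^+ 2 / sigma ^+ 2)) <= expR 1.

Let S j w := \sum_(i < j) e (x w) (Z (idxs i) w).

Let S_known j : vknown Z (upto j) (S j).
Proof.
elim: j => [|j IH].
  by move=> i; under eq_fun do rewrite /S big_ord0; exact: measurable_cst.
move=> i; rewrite /S; under eq_fun do rewrite big_ord_recr /=.
apply: (@vmeasurableD _ (alg j.+1) R n (S j) (fun w => e (x w) (Z (idxs j) w))).
  exact: vknownW (upto_mono (leqnSn j)) IH.
exact: e_known.
Qed.

Let measurable_ch d1 (T : measurableType d1) (f : T -> R) :
  measurable_fun setT f -> measurable_fun setT (fun w => ch (f w)).
Proof.
move=> mf; apply: measurable_funM; last exact: measurable_cst.
apply: measurable_funD; first exact: (measurableT_comp (@measurable_expR R) mf).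
exact: (measurableT_comp (@measurable_expR R) (measurable_funN mf)).
Qed.

(** Pinelis' argument: the hyperbolic cosine of the norm of the sum is a
supermartingale up to the sub-Gaussian factor of each sample. *)
Lemma batch_cosh (th : R) j : 0 <= th ->
  itg P (fun w => c w * ch (th * enorm (S j w))) /\
  mean P (fun w => c w * ch (th * enorm (S j w))) <=
  mean P c * expR (3 / 4 * (th * sigma) ^+ 2) ^+ j.
Proof.
move=> th0; have ic : itg P c.
  apply: (@itg_bounded _ _ _ _ _ C); first exact: (known_measurable iidZ kc).
  by move=> w; rewrite ger0_norm.
elim: j => [|j [IH1 IH2]].
  have e0 w : c w * ch (th * enorm (S 0 w)) = c w.
    by rewrite /S big_ord0 enorm0 mulr0 ch0 mulr1.
  under [X in itg _ X]funext do rewrite e0.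
  under [X in mean _ X <= _]funext do rewrite e0.
  by rewrite expr0 mulr1.
set E := expR (3 / 4 * (th * sigma) ^+ 2) in IH2 *.
pose h w u := c w * ch (th * enorm (S j w + e (x w) u)).
pose H w := E * (c w * ch (th * enorm (S j w))).
have iH : itg P H by exact: itgZ.
have mh : measurable_fun setT (fun p : alg j * Xi => h p.1 p.2).
  apply: measurable_funM.
    by apply: fst_known; exact: knownW (@upto_sub j) kc.
  apply: measurable_ch; apply: measurable_funM; first exact: measurable_cst.
  by apply: measurable_enorm; apply: vmeasurableD; [exact: fst_vknown|exact: e_joint].
have [q q01 hq] := expR_sub_light_tail (mulr_ge0 th0 (ltW sigma0)).
have hw w : itg mu (h w) /\ mean mu (h w) <= H w.
  pose a := th * enorm (S j w).
  have a0 : 0 <= a by rewrite mulr_ge0 ?enorm_ge0.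
  have [d1 d2] := e_dot (S j w) (Xx w).
  have [t1 t2] := e_tail (Xx w).
  pose B u := c w * (th ^+ 2 * (sh a / a)) * dot (e (x w) u) (S j w) +
    c w * ch a * E * (1 - q) +
    c w * ch a * E * q * expR (- 1) * expR (enorm (e (x w) u) ^+ 2 / sigma ^+ 2).
  have iB1 : itg mu (fun u => c w * (th ^+ 2 * (sh a / a)) * dot (e (x w) u) (S j w)).
    exact: itgZ.
  have iB2 : itg mu (fun u => c w * (th ^+ 2 * (sh a / a)) * dot (e (x w) u) (S j w) +
    c w * ch a * E * (1 - q)) by apply: itgD => //; exact: itg_cst.
  have iB3 : itg mu (fun u => c w * ch a * E * q * expR (- 1) *
    expR (enorm (e (x w) u) ^+ 2 / sigma ^+ 2)) by exact: itgZ.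
  have iB : itg mu B by exact: itgD.
  have cha := ch_ge1 a.
  have E0 : 0 <= E by exact: expR_ge0.
  have h0 u : 0 <= h w u by rewrite mulr_ge0//; exact: le_trans (ch_ge1 _).
  have hB u : h w u <= B u.
    pose z := enorm (e (x w) u).
    have z0 : 0 <= z := enorm_ge0 _.
    have := @ch_step R a (th * z) (th * enorm (S j w + e (x w) u))
      (th ^+ 2 * dot (e (x w) u) (S j w)) a0 (mulr_ge0 th0 z0)
      (mulr_ge0 th0 (enorm_ge0 _)).
    have -> : `|th ^+ 2 * dot (e (x w) u) (S j w)| <= a * (th * z).
      rewrite normrM ger0_norm ?sqr_ge0//.
      have := normr_dot_le (e (x w) u) (S j w); rewrite -/z => hd.
      by have := ler_wpM2l (sqr_ge0 th) hd; rewrite /a; lra.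
    have eqc : (th * enorm (S j w + e (x w) u)) ^+ 2 =
        a ^+ 2 + 2 * (th ^+ 2 * dot (e (x w) u) (S j w)) + (th * z) ^+ 2.
      by rewrite /a 3!exprMn enorm_sqrD (dotC (S j w)) -/z; ring.
    move=> /(_ isT eqc) hs.
    have := hq (z / sigma) (divr_ge0 z0 (ltW sigma0)).
    have -> : th * sigma * (z / sigma) = th * z by field; rewrite gt_eqF.
    rewrite -/E exprMn exprVn expRD => hE.
    rewrite /h /B -/z -/a.
    have r : ch (th * enorm (S j w + e (x w) u)) <=
       (th ^+ 2 * dot (e (x w) u) (S j w)) * (sh a / a) +
       ch a * (E * (1 - q + q * (expR (z ^+ 2 / sigma ^+ 2) * expR (- 1)))).
      apply: le_trans hs _; rewrite -/a.
      have := ler_wpM2l (le_trans ler01 cha) hE; lra.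
    by have := ler_wpM2l (c0 w) r; lra.
  have ih : itg mu (h w).
    apply: itg_le iB => [|u]; last by rewrite ger0_norm.
    apply: measurable_funM; first exact: measurable_cst.
    apply: measurable_ch; apply: measurable_funM; first exact: measurable_cst.
    by apply: measurable_enorm; apply: vmeasurableD; [exact: vmeasurable_cst|exact: me1].
  split=> //; apply: le_trans (mean_le ih iB hB) _.
  rewrite meanD// meanD//; last exact: itg_cst.
  rewrite mean_cst !meanZ// d2 mulr0 add0r /H -/a.
  have k0 : 0 <= c w * ch a * E * q.
    have /andP[q0 _] := q01; rewrite !mulr_ge0//; exact: le_trans cha.
  have e1 : expR (- 1) * expR 1 = 1 :> R by rewrite -expRD addNr expR0.
  have k1 : 0 <= c w * ch a * E * q * expR (- 1) by rewrite mulr_ge0 ?expR_ge0.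
  have := ler_wpM2l k1 t2; rewrite -[X in _ <= X]mulrA e1 mulr1.
  lra.
have hE : (fun w => c w * ch (th * enorm (S j.+1 w))) = (fun w => h w (Z (idxs j) w)).
  by apply/funext => w; rewrite /h /S big_ord_recr.
rewrite hE.
have [] := @fresh_mean_le _ Om _ Xi R P mu J Z iidZ (upto j) (idxs j) h
  (@upto_fresh j) mh H _ iH (fun w => (hw w).1) (fun w => (hw w).2).
  by move=> w u; rewrite mulr_ge0//; exact: le_trans (ch_ge1 _).
move=> ih mh'; split=> //; apply: le_trans mh' _.
rewrite meanZ// exprS [leRHS]mulrCA ler_wpM2l//.
exact: expR_ge0.
Qed.

(** Markov's inequality for cosh(th |S|), at the th that minimizes the bound. *)
Lemma batch_tail (K : nat) (s : R) : (0 < K)%N -> 0 <= s ->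
  mean P (fun w => c w * (s * sigma / Num.sqrt K%:R < enorm (K%:R^-1 *: S K w))%R%:R) <=
  2 * expR (- (s ^+ 2 / 3)) * mean P c.
Proof.
move=> K0 s0; have K0' : (0 : R) < K%:R by rewrite ltr0n.
have sK : 0 < Num.sqrt (K%:R : R) by rewrite sqrtr_gt0.
have sK2 : Num.sqrt K%:R ^+ 2 = K%:R :> R by rewrite sqr_sqrtr// ltW.
pose th : R := 2 * s / (3 * sigma * Num.sqrt K%:R).
have th0 : 0 <= th by rewrite divr_ge0 ?mulr_ge0// ltW.
have [i1 m1] := batch_cosh K th0.
pose k : R := 2 * expR (- (2 * s ^+ 2 / 3)).
have k0 : 0 <= k by rewrite mulr_ge0// expR_ge0.
have mS : measurable_fun setT (fun w => enorm (K%:R^-1 *: S K w)).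
  apply: measurable_enorm; apply: vmeasurableZ; first exact: measurable_cst.
  by move=> i; apply: (known_measurable iidZ (S := upto K)); exact: S_known.
have mc : measurable_fun setT c by exact: (known_measurable iidZ kc).
apply: (@le_trans _ _ (mean P (fun w => k * (c w * ch (th * enorm (S K w)))))).
  apply: mean_le.
  - apply: (@itg_bounded _ _ _ _ _ C) => [|w].
      apply: measurable_funM => //.
      apply: (measurableT_comp (f := fun t : bool => t%:R : R)) => //.
      by apply: measurable_fun_ltr => //; exact: measurable_cst.
    rewrite ger0_norm ?mulr_ge0//; case: (_ < _); rewrite ?mulr1 ?mulr0 ?cC//.
    exact: le_trans (cC w).
  - exact: itgZ.
  move=> w; rewrite mulrCA ler_wpM2l//; case: ltP => [lt_s|_]; last first.
    by rewrite mulr_ge0//; exact: le_trans (ch_ge1 _).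
  have big : 2 * s ^+ 2 / 3 <= th * enorm (S K w).
    have : s * sigma * Num.sqrt K%:R <= enorm (S K w).
      have := ltW lt_s; rewrite enormZ ger0_norm ?invr_ge0 ?(ltW K0')//.
      move=> h; have := ler_wpM2l (ltW K0') h.
      rewrite mulVKf ?gt_eqF//; apply: le_trans.
      rewrite -[X in _ <= X * _]sK2 le_eqVlt; apply/orP; left; apply/eqP; field.
      by rewrite gt_eqF.
    move=> h; have := ler_wpM2l th0 h; apply: le_trans.
    rewrite /th le_eqVlt; apply/orP; left; apply/eqP; field.
    by rewrite !gt_eqF.
  rewrite /k /ch mulr1n.
  have e1 : expR (- (2 * s ^+ 2 / 3)) * expR (2 * s ^+ 2 / 3) = 1 :> R.
    by rewrite -expRD addNr expR0.
  have e2 : expR (2 * s ^+ 2 / 3) <= expR (th * enorm (S K w)) by rewrite ler_expR.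
  have e3 := expR_ge0 (- (th * enorm (S K w))).
  have e4 := expR_ge0 (- (2 * s ^+ 2 / 3)).
  have := ler_wpM2l e4 e2; rewrite e1 => e5.
  have := mulr_ge0 e4 e3; lra.
rewrite meanZ//; apply: le_trans (ler_wpM2l k0 m1) _.
have -> : expR (3 / 4 * (th * sigma) ^+ 2) ^+ K = expR (s ^+ 2 / 3).
  rewrite -expRM_natl; congr expR; rewrite -sK2 /th; field.
  by rewrite !gt_eqF.
have -> : expR (- (s ^+ 2 / 3)) = expR (- (2 * s ^+ 2 / 3)) * expR (s ^+ 2 / 3).
  by rewrite -expRD; congr expR; field.
by rewrite /k le_eqVlt; apply/orP; left; apply/eqP; ring.
Qed.

End Concentration.

End BatchNoise.

(** * Numerical bounds *)

(** Logarithms to the base 1/b; for b = 0 they vanish, and m > 0 suffices. *)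
Lemma pow_le_inv_sqr (R : realType) (b : R) (m k : nat) : 0 <= b < 1 -> (0 < m)%N ->
  2 * (ln (k%:R + 1) / ln (1 / b)) <= m%:R -> b ^+ m <= ((k%:R + 1) ^+ 2)^-1.
Proof.
move=> /andP[b0 b1] m0; have k1 : (0 : R) < k%:R + 1 by rewrite ltr_wpDl.
have [->|bn0] := eqVneq b 0.
  by rewrite expr0n eqn0Ngt m0 /= invr_ge0 exprn_ge0// ltW.
have {bn0}b0 : 0 < b by rewrite lt_neqAle eq_sym bn0.
have x0 : 0 < - ln b by rewrite oppr_gt0 ln_lt0// b0.
rewrite div1r lnV ?posrE// => h.
rewrite -[b in leLHS]lnK ?posrE// -[_ + 1 in leRHS]lnK ?posrE//.
rewrite -!expRM_natl -expRN ler_expR.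
move: h; rewrite mulrA ler_pdivrMr//; lra.
Qed.

Lemma sum_le_sqr (R : realType) (k : nat) :
  \sum_(t < k) t.+1%:R / (k%:R + 1) ^+ 2 <= 1 / 2 :> R.
Proof.
have k1 : (0 : R) < (k%:R + 1) ^+ 2 by rewrite exprn_gt0// ltr_wpDl.
rewrite -mulr_suml ler_pdivrMr//.
suff -> : \sum_(t < k) (t.+1%:R : R) = k%:R * (k%:R + 1) / 2.
  have := ler0n R k; rewrite expr2; move: (k%:R) => x x0; nra.
elim: k {k1} => [|k IH]; first by rewrite big_ord0 !mul0r.
by rewrite big_ord_recr /= IH -natr1; field.
Qed.

Lemma runs_bound_ge (R : realType) (nr : nat) (Q M : 'I_nr -> R) (x c : R) :
  (forall r, 0 < Q r) ->
  (x%:E <= runs_bound Q M + c%:E)%E =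
  [exists r, (M r == 0) || (x <= 8 * Q r / M r + c)%R].
Proof.
move=> Q0; rewrite -leeBlDr// -EFinB /runs_bound.
have termE r : ((x - c)%:E <= (8 * Q r)%:E / (M r)%:E)%E =
    ((M r == 0) || (x <= 8 * Q r / M r + c)%R).
  rewrite inver; case: eqP => [_|_] /=; last by rewrite -EFinM lee_fin lerBlDr.
  by rewrite gt0_muley ?leey// lte_fin mulr_gt0.
apply/bigmax_geP/existsP => [[//|[r _]]|[r hr]].
  by rewrite termE; exists r.
by right; exists r => //; rewrite termE.
Qed.

(** The hypothesis forces lambda >= 1, and then (1 + lambda)^2 - lambda^2 >= 3, so
that the gain exp(-1) beats the factor 2. *)
Lemma exp_tail_le (R : realType) (lambda : R) : 0 <= lambda ->
  expR (- (lambda ^+ 2 / 3)) < 1 / 2 ->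
  2 * expR (- ((1 + lambda) ^+ 2 / 3)) <= expR (- (lambda ^+ 2 / 3)).
Proof.
move=> l0 h; have [l1|l1] := leP 1 lambda; last first.
  have := expR_ge1Dx (- (lambda ^+ 2 / 3)).
  have : lambda ^+ 2 <= 1 by rewrite expr_le1// ltW.
  lra.
have -> : - ((1 + lambda) ^+ 2 / 3) = - ((1 + 2 * lambda) / 3) + - (lambda ^+ 2 / 3) by field.
rewrite expRD mulrA ler_piMl ?expR_ge0// expRN ler_pdivrMr ?expR_gt0// mul1r.
apply: (@le_trans _ _ (expR 1)); first by have := expR_ge1Dx (1 : R); lra.
by rewrite ler_expR; lra.
Qed.

(** Comparing noisy norms costs twice the noise; the constant 12 is what the
square of a sum gives when the main term is multiplied by 3/2. *)
Lemma noisy_argmin_sqr (R : realType) (n : nat) (g g' h h' : 'rV[R]_n) (e : R) :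
  enorm (g - g') <= e -> enorm (h - h') <= e -> enorm g' <= enorm h' ->
  enorm g ^+ 2 <= 3 / 2 * enorm h ^+ 2 + 12 * e ^+ 2.
Proof.
move=> d1 d2 gh; have e0 := le_trans (enorm_ge0 _) d1.
have tri (x y : 'rV[R]_n) : enorm x <= enorm y + enorm (x - y).
  by rewrite -[x in leLHS](subrK y) addrC; exact: enormD.
have h1 := tri g g'; have h2 := tri h' h; rewrite (enormB h') in h2.
have h0 := enorm_ge0 h.
have : enorm g ^+ 2 <= (enorm h + 2 * e) ^+ 2.
  by apply: lerXn2r; rewrite ?nnegrE ?enorm_ge0 ?addr_ge0 ?mulr_ge0//; lra.
have := sqr_ge0 (enorm h - 4 * e).
rewrite !expr2; move: (enorm g * _) (enorm h) => y x; lra.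
Qed.

Lemma half_pow_nb_runs (R : realType) (delta : R) : 0 < delta < 1 ->
  (0 < nb_runs delta)%N /\ (1 / 2) ^+ nb_runs delta <= delta / 2.
Proof.
move=> /andP[d0 d1]; have l2 : (0 : R) < ln 2 by rewrite ln_gt0// ltr1n.
have y1 : 1 < 2 / delta by rewrite ltr_pdivlMr//; lra.
have x0 : 0 < ln (2 / delta) / ln 2 by rewrite divr_gt0// ln_gt0.
have hx : ln (2 / delta) / ln 2 <= (nb_runs delta)%:R.
  rewrite /nb_runs natr_absz; apply: le_trans (ceil_ge _) _.
  by rewrite ler_int ler_norm.
split; first by rewrite -(ltr0n R); exact: lt_le_trans x0 hx.
rewrite -[1 / 2]lnK ?posrE// -expRM_natl.
rewrite -[leRHS]lnK ?posrE ?divr_gt0// ler_expR div1r lnV ?posrE//.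
have -> : delta / 2 = (2 / delta)^-1 by rewrite invf_div.
rewrite lnV ?posrE ?divr_gt0// mulrN lerN2.
by rewrite -ler_pdivrMr.
Qed.

Lemma confidence_split (R : realType) (delta : R) : 0 < delta < 1 ->
  (1 / 2) ^+ nb_runs delta +
    (nb_runs delta)%:R * expR (- (lambda_of delta ^+ 2 / 3)) <= delta.
Proof.
move=> d01; have [n0 _] := half_pow_nb_runs d01; have /andP[d0 d1] := d01.
have n1 : (1 : R) <= (nb_runs delta)%:R by rewrite (ler_nat _ 1).
set m := (nb_runs delta)%:R in n1 *; have m0 : 0 < m := lt_le_trans ltr01 n1.
have y1 : 1 <= 2 * m / delta by rewrite ler_pdivlMr//; lra.
have y0 : 0 < 2 * m / delta := lt_le_trans ltr01 y1.
rewrite /lambda_of sqr_sqrtr; last by rewrite mulr_ge0// ln_ge0.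
rewrite -/m [3 * _]mulrC mulfK// -lnV ?posrE// lnK ?posrE ?invr_gt0//.
have -> : m * (2 * m / delta)^-1 = delta / 2 by field; rewrite !gt_eqF.
have [_ h] := half_pow_nb_runs d01.
by apply: le_trans (lerD h (lexx _)) _; rewrite -splitr.
Qed.

(** The bound on the failure probability is void when e, the failure probability
of one noise estimate, is allowed to reach 1/2. *)
Lemma half_pow_union_ge1 (R : realType) (nr : nat) (e : R) : (0 < nr)%N -> 1 / 2 <= e ->
  1 <= (1 / 2) ^+ nr + nr%:R * e.
Proof.
case: nr => [//|[|nr]] _ he; first by rewrite expr1 mul1r; lra.
have p0 : 0 <= (1 / 2) ^+ nr.+2 :> R by rewrite exprn_ge0.
have : 2 * (1 / 2) <= nr.+2%:R * e :> R by apply: ler_pM => //; rewrite (ler_nat _ 2).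
by move: (_ ^+ _) p0 (_ * e) => x x0 y; lra.
Qed.

(** * The two-phase method *)

Section Method.
Context (R : realType) (n : nat).
Context dXi (Xi : measurableType dXi) (mu : probability Xi R).
Context dOm (Om : measurableType dOm) (P : probability Om R).
Context (D : acspg R n Xi) (f : 'rV[R]_n -> R) (gf : 'rV[R]_n -> 'rV[R]_n).
Context (L l sigma Lmax Lbar : R) (Lxi : Xi -> R) (nr : nat).
Context (xi xi' : 'I_nr -> nat -> nat -> Om -> Xi) (zeta : nat -> Om -> Xi).
Let X := domain D.
Let F := val_oracle D.
Let G := grad_oracle D.
Let Z := all_samples xi xi' zeta.
Hypotheses (cvX : convex_set X) (cpX : compact X) (X_start : X (start D)).
Hypothesis grad_f : is_gradient_on X f gf.
Hypothesis lip_gf : forall x y, X x -> X y -> enorm (gf x - gf y) <= L * enorm (x - y).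
Hypothesis l0 : 0 <= l.
Hypothesis lower_curv : forall x y, X x -> X y ->
  - (l / 2) * enorm (x - y) ^+ 2 <= f x - f y - dot (gf y) (x - y).
Hypothesis grad_F : forall u, is_gradient_on X (F ^~ u) (G ^~ u).
Hypothesis F_mean : forall x, X x ->
  mu.-integrable setT (EFin \o F x) /\ ('E_mu[F x] = (f x)%:E)%E.
Hypothesis G_mean : forall x i, X x ->
  mu.-integrable setT (fun u => (G x u 0 i)%:E) /\
  ('E_mu[fun u => (G x u 0 i)%R] = (gf x 0 i)%:E)%E.
Hypothesis sigma0 : 0 < sigma.
Hypothesis G_var : forall x, X x ->
  ('E_mu[fun u => (enorm (G x u - gf x) ^+ 2)%R] <= (sigma ^+ 2)%:E)%E.
Hypotheses (mLxi : measurable_fun setT Lxi) (Lxi0 : forall u, 0 <= Lxi u).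
Hypothesis lip_G : forall u x y, X x -> X y ->
  enorm (G x u - G y u) <= Lxi u * enorm (x - y).
Hypothesis upper_F : forall u x y, X x -> X y ->
  F x u - F y u - dot (G y u) (x - y) <= Lxi u / 2 * enorm (x - y) ^+ 2.
Hypothesis Lxi_Lmax : {ae mu, forall u, Lxi u <= Lmax}.
Hypothesis Lxi_sqr : ('E_mu[fun u => (Lxi u ^+ 2)%R] <= (Lbar ^+ 2)%:E)%E.
Hypothesis G_tail : forall x, X x ->
  ('E_mu[fun u => expR (enorm (G x u - gf x) ^+ 2 / sigma ^+ 2)%R] <= (expR 1)%:E)%E.
Hypotheses (L0_gt0 : 0 < Lbar0 D) (L0_le : Lbar0 D <= Lmax) (alpha0 : 0 < alpha D).
Hypothesis iidZ : iid P mu Z.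

Lemma domain_neq0 : X !=set0. Proof. by exists (start D). Qed.
Let X0 := domain_neq0.

Lemma Lmax_gt0 : 0 < Lmax. Proof. exact: lt_le_trans L0_gt0 L0_le. Qed.

Let F_itg x : X x -> itg mu (F x) /\ mean mu (F x) = f x.
Proof.
move=> Xx; have [iF eF] := F_mean Xx; split=> //.
by move: eF; rewrite unlock int_mean// => -[].
Qed.

Let G_itg x i : X x -> itg mu (fun u => G x u 0 i) /\ mean mu (fun u => G x u 0 i) = gf x 0 i.
Proof.
move=> Xx; have [iG eG] := G_mean i Xx; split=> //.
by move: eG; rewrite unlock int_mean// => -[].
Qed.

Let mF x : X x -> measurable_fun setT (F x).
Proof. by move=> /F_itg[/itg_measurable]. Qed.

Let mG x i : X x -> measurable_fun setT (fun u => G x u 0 i).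
Proof. by move=> /(G_itg i)[/itg_measurable]. Qed.

Definition noise x u := G x u - gf x.

Lemma noise_measurable d1 (T : measurableType d1) (x : T -> 'rV[R]_n) (u : T -> Xi) :
  vmeasurable x -> (forall w, X (x w)) -> measurable_fun setT u ->
  vmeasurable (fun w => noise (x w) (u w)).
Proof.
move=> mx Xx mu'; apply: vmeasurableB.
  exact: (vmeasurable_grad_oracle cvX cpX X0 mG lip_G).
exact: (vmeasurable_lipschitz cvX cpX X0 mx Xx lip_gf).
Qed.

Let noise1 x : X x -> vmeasurable (noise x).
Proof.
by move=> Xx; apply: (@noise_measurable _ Xi (fun=> x) id).
Qed.

Lemma noise_mean0 x i : X x ->
  itg mu (fun u => noise x u 0 i) /\ mean mu (fun u => noise x u 0 i) = 0.
Proof.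
move=> Xx; have [h1 h2] := G_itg i Xx.
have e : (fun u => noise x u 0 i) = (fun u => G x u 0 i - gf x 0 i).
  by apply/funext => u; rewrite /noise !mxE.
rewrite e; split; first by apply: itgB => //; exact: itg_cst.
by rewrite meanB ?h2 ?mean_cst ?subrr//; exact: itg_cst.
Qed.

Lemma noise_var x : X x ->
  itg mu (fun u => enorm (noise x u) ^+ 2) /\
  mean mu (fun u => enorm (noise x u) ^+ 2) <= sigma ^+ 2.
Proof.
move=> Xx; apply: itg_ge0_le; last by have := G_var Xx; rewrite unlock.
  by apply: measurable_funX; apply: measurable_enorm; exact: noise1.
by move=> u; exact: sqr_ge0.
Qed.

Lemma noise_tail x : X x ->
  itg mu (fun u => expR (enorm (noise x u) ^+ 2 / sigma ^+ 2)) /\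
  mean mu (fun u => expR (enorm (noise x u) ^+ 2 / sigma ^+ 2)) <= expR 1.
Proof.
move=> Xx; apply: itg_ge0_le; last by have := G_tail Xx; rewrite unlock.
  apply: (measurableT_comp (@measurable_expR R)); apply: measurable_funM; last exact: measurable_cst.
  by apply: measurable_funX; apply: measurable_enorm; exact: noise1.
by move=> u; exact: expR_ge0.
Qed.

Lemma Lxi_itg : itg mu Lxi.
Proof.
have [i2 _] : itg mu (fun u => Lxi u ^+ 2) /\ mean mu (fun u => Lxi u ^+ 2) <= Lbar ^+ 2.
  apply: itg_ge0_le; last by have := Lxi_sqr; rewrite unlock.
    exact: measurable_funX.
  by move=> u; exact: sqr_ge0.
apply: (@itg_le _ _ _ _ _ (fun u => 1 + Lxi u ^+ 2)) => //.
  move=> u; rewrite ger0_norm//; have := sqr_ge0 (Lxi u - 1); have := sqr_ge0 (Lxi u).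
  by rewrite !expr2; lra.
by apply: itgD => //; exact: itg_cst.
Qed.

Lemma mean_Lxi : mean mu Lxi <= Lmax.
Proof.
rewrite -(mean_cst mu Lmax); apply: mean_le_ae => //; first exact: Lxi_itg.
exact: itg_cst.
Qed.

(** Its mean is the curvature of [f] ([sample_curv_mean]). *)
Definition sample_curv x y u := curv (F ^~ u) (G ^~ u) x y.

Lemma sample_curv_le x y u : X x -> X y -> sample_curv x y u <= Lxi u * enorm (x - y) ^+ 2.
Proof.
move=> Xx Xy; have := upper_F u Xx Xy; rewrite /sample_curv /curv; lra.
Qed.

Let diam_sqr x y : X x -> X y -> enorm (x - y) ^+ 2 <= diam X ^+ 2.
Proof.
move=> Xx Xy; apply: lerXn2r; rewrite ?nnegrE ?enorm_ge0 ?(diam_ge0 cpX Xx)//.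
exact: enorm_le_diam.
Qed.

Lemma sample_curv_abs x y u : X x -> X y ->
  `|sample_curv x y u| <= 3 * diam X ^+ 2 * Lxi u.
Proof.
move=> Xx Xy; have h1 := upper_F u Xx Xy; have h2 := upper_F u Xy Xx.
have h3 := dot_le_enorm (G x u - G y u) (y - x).
have h4 : enorm (G x u - G y u) * enorm (y - x) <= Lxi u * enorm (x - y) ^+ 2.
  by rewrite (enormB y) expr2 mulrA ler_wpM2r ?enorm_ge0// lip_G.
have h5 : Lxi u * enorm (x - y) ^+ 2 <= Lxi u * diam X ^+ 2.
  by rewrite ler_wpM2l// diam_sqr.
have e1 : dot (G x u - G y u) (y - x) = dot (G x u) (y - x) + dot (G y u) (x - y).
  by rewrite dotDl dotNl -dotNr opprB.
have h6 : 0 <= Lxi u * diam X ^+ 2 by rewrite mulr_ge0// sqr_ge0.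
move: h1 h2 h3 h4; rewrite (enormB y) e1 /sample_curv /curv => h1 h2 h3 h4.
rewrite ler_norml; apply/andP; split; lra.
Qed.

Lemma sample_curv_mean x y : X x -> X y ->
  itg mu (sample_curv x y) /\ mean mu (sample_curv x y) = curv f gf x y.
Proof.
move=> Xx Xy; have [ix ex] := F_itg Xx; have [iy ey] := F_itg Xy.
have gi i : itg mu (fun u => G y u 0 i * (x - y) 0 i) /\
    mean mu (fun u => G y u 0 i * (x - y) 0 i) = gf y 0 i * (x - y) 0 i.
  have [h1 h2] := G_itg i Xy.
  under [X in itg _ X]funext do rewrite mulrC.
  under [X in mean _ X]funext do rewrite mulrC.
  by split; [exact: itgZ|rewrite meanZ// h2 mulrC].
have id : itg mu (fun u => dot (G y u) (x - y)) by apply: itg_sum => i; case: (gi i).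
have ed : mean mu (fun u => dot (G y u) (x - y)) = dot (gf y) (x - y).
  rewrite mean_sum => [|i]; last by case: (gi i).
  by apply: eq_bigr => i _; case: (gi i).
have i1 : itg mu (fun u => F x u - F y u) by exact: itgB.
have i2 : itg mu (fun u => F x u - F y u - dot (G y u) (x - y)) by exact: itgB.
split; first exact: itgZ.
by rewrite /sample_curv /curv meanZ// !meanB// ex ey ed.
Qed.

(** The almost sure bound on the sampled curvatures passes to their mean. *)
Lemma curv_le x y : X x -> X y -> curv f gf x y <= Lmax * enorm (x - y) ^+ 2.
Proof.
move=> Xx Xy; have [i1 <-] := sample_curv_mean Xx Xy.
rewrite -(mean_cst mu (Lmax * _)); apply: mean_le_ae => //; first exact: itg_cst.
apply: filterS Lxi_Lmax => u hu; apply: le_trans (sample_curv_le u Xx Xy) _.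
by rewrite ler_wpM2r ?sqr_ge0.
Qed.

Lemma local_curvE (g : 'rV[R]_n -> R) (gg : 'rV[R]_n -> 'rV[R]_n) x y :
  local_curv g gg x y * enorm (x - y) ^+ 2 = curv g gg x y.
Proof.
rewrite /local_curv /curv; have [e0|e0] := eqVneq (enorm (x - y)) 0; last first.
  by rewrite mulfVK// sqrf_eq0.
have xy : x = y by apply/eqP; rewrite -subr_eq0; apply/eqP; exact: enorm_eq0.
by rewrite xy !subrr dot0r subrr mulr0 !mul0r.
Qed.

Lemma local_curv_le x y u : X x -> X y -> local_curv (F ^~ u) (G ^~ u) x y <= Lxi u.
Proof.
move=> Xx Xy; have [e0|e0] := eqVneq (enorm (x - y)) 0.
  by rewrite /local_curv e0 expr0n /= invr0 mulr0.
have d0 : 0 < enorm (x - y) ^+ 2 by rewrite exprn_gt0// lt_neqAle eq_sym e0 enorm_ge0.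
by rewrite -(ler_pM2r d0) local_curvE; exact: sample_curv_le.
Qed.

(** ** Trajectories *)
Let T := traj D xi xi'.
Let xs r t w := iterate (T r w t).

Definition grad_avg r t w :=
  avg_grad G (grad_batch D (idx (T r w t.-1)) (stepsize (T r w) t))
    (fun j => xi r t j w) (xs r t.-1 w).

Definition batch_noise r t w := grad_avg r t w - gf (xs r t.-1 w).

Definition Lb r t w :=
  local_estimate D (est_batch D t) (fun j => xi' r t j w) (xs r t w) (xs r t.-1 w).

Definition new_seg r w t := (1 < t)%N && (3 / 2 * Lhat (T r w t.-1) < Lb r t w).

Lemma T_iterate r w t : iterate (T r w t.+1) =
  prox X (xs r t w) (gf (xs r t w) + batch_noise r t.+1 w) (stepsize (T r w) t.+1).
Proof. by rewrite /batch_noise addrC subrK. Qed.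

Lemma T_Lhat r w t : Lhat (T r w t.+1) = Num.max (Lhat (T r w t)) (Lb r t.+1 w).
Proof. by []. Qed.

Lemma T_idx r w t :
  idx (T r w t.+1) = if new_seg r w t.+1 then 1%N else (idx (T r w t)).+1.
Proof. by []. Qed.

Lemma T_seg r w t :
  seg (T r w t.+1) = if new_seg r w t.+1 then (seg (T r w t)).+1 else seg (T r w t).
Proof. by []. Qed.

Lemma xs_in r t w : X (xs r t w).
Proof. by case: t => [//|t]; rewrite /xs T_iterate; exact: prox_in. Qed.

Lemma Lhat_ge r w t : Lbar0 D <= Lhat (T r w t).
Proof. by elim: t => [//|t IH]; rewrite T_Lhat le_max IH. Qed.

Lemma T_Lhat_gt0 r w t : 0 < Lhat (T r w t).
Proof. exact: lt_le_trans L0_gt0 (Lhat_ge r w t). Qed.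

Let J := ('I_nr * nat * nat + 'I_nr * nat * nat + nat)%type.

Definition past r t : set J := [set j | match j with
  | inl (inl (r', t', _)) => r' = r /\ (t' <= t)%N
  | inl (inr (r', t', _)) => r' = r /\ (t' <= t)%N
  | inr _ => False end].

(** What determines the iterate t + 1: the gradient samples of that iteration are
included, those of its Lipschitz estimator are not. *)
Definition past_iterate r t : set J := [set j | match j with
  | inl (inl (r', t', _)) => r' = r /\ (t' <= t.+1)%N
  | inl (inr (r', t', _)) => r' = r /\ (t' <= t)%N
  | inr _ => False end].

Lemma past_sub_iterate r t : past r t `<=` past_iterate r t.
Proof.
by move=> [[[[r' t'] i]|[[r' t'] i]]|i] //= [-> tt]; split=> //; exact: leq_trans tt (leqnSn _).
Qed.


Lemma past_mono r s t : (s <= t)%N -> past r s `<=` past r t.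
Proof.
by move=> st [[[[r' t'] i]|[[r' t'] i]]|i] //= [-> tt]; split=> //; exact: leq_trans tt st.
Qed.

Let gidx r t i : J := inl (inl (r, t, i)).
Let eidx r t i : J := inl (inr (r, t, i)).

Definition state_known S (st : Om -> state R n) :=
  @state_measurable R n _ (g_sigma_algebraType (gen Z S)) st.

Lemma traj_known r t : state_known (past r t) (fun w => T r w t).
Proof.
elim: t => [|t IH].
  by split; [exact: vmeasurable_cst|exact: measurable_cst..].
apply: (@acspg_step_measurable R n _ Xi D cvX cpX X0 mF mG grad_F Lxi lip_G _
  (g_sigma_algebraType (gen Z (past r t.+1))) t.+1 (xi r t.+1) (xi' r t.+1)
  (fun w => T r w t)).
- by move=> j; exact: (@known_sample _ _ _ _ _ Z _ (gidx r t.+1 j)).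
- by move=> j; exact: (@known_sample _ _ _ _ _ Z _ (eidx r t.+1 j)).
- by move=> w; exact: xs_in.
- by move=> w; exact: T_Lhat_gt0.
- have sub := past_mono (r := r) (leqnSn t); case: IH => h1 h2 h3 h4; split.
  + exact: (vknownW sub h1).
  + exact: (knownW sub h2).
  + exact: (knownW sub h3).
  + exact: (knownW sub h4).
Qed.

Lemma xs_known r t : vknown Z (past r t) (xs r t).
Proof. by case: (traj_known r t). Qed.

Lemma Lhat_known r t : known Z (past r t) (fun w => Lhat (T r w t)).
Proof. by case: (traj_known r t). Qed.

Lemma idx_known r t : known Z (past r t) (fun w => idx (T r w t)).
Proof. by case: (traj_known r t). Qed.

Lemma seg_known r t : known Z (past r t) (fun w => seg (T r w t)).
Proof. by case: (traj_known r t). Qed.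

Lemma stepsize_known r t : known Z (past r t) (fun w => stepsize (T r w) t.+1).
Proof. by apply: measurable_funM; [exact: measurable_cst|exact: Lhat_known]. Qed.

(** The iterate does not depend on the samples of its Lipschitz estimator, so the
step can be run with a constant in their place. *)
Lemma xs_known_iterate r t : vknown Z (past_iterate r t) (xs r t.+1).
Proof.
have [] := @acspg_step_measurable R n _ Xi D cvX cpX X0 mF mG grad_F Lxi lip_G _
  (g_sigma_algebraType (gen Z (past_iterate r t))) t.+1 (xi r t.+1) (fun _ _ => point)
  (fun w => T r w t); last by [].
- by move=> j; exact: (@known_sample _ _ _ _ _ Z _ (gidx r t.+1 j)).
- by move=> j; exact: measurable_cst.
- by move=> w; exact: xs_in.
- by move=> w; exact: T_Lhat_gt0.
- have sub := @past_sub_iterate r t; case: (traj_known r t) => h1 h2 h3 h4; split.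
  + exact: (vknownW sub h1).
  + exact: (knownW sub h2).
  + exact: (knownW sub h3).
  + exact: (knownW sub h4).
Qed.


(** ** Gradient noise of an iteration *)
Definition nbatch r t w := grad_batch D (idx (T r w t)) (stepsize (T r w) t.+1).
(* The position is at most t and the stepsize at least its initial value. *)
Let maxbatch t := grad_batch D t (4 * Lbar0 D).

Lemma nbatch_gt0 r t w : (0 < nbatch r t w)%N.
Proof. by rewrite /nbatch /grad_batch leq_max. Qed.

Lemma nbatch_known r t : known Z (past r t) (nbatch r t).
Proof.
have := @measurable_grad_batch _ _ _ _ D _ (g_sigma_algebraType (gen Z (past r t)))
  (fun w => idx (T r w t)) (fun w => stepsize (T r w) t.+1).
by apply; [exact: idx_known|exact: stepsize_known].
Qed.

Lemma stepsize_ge r t w : 4 * Lbar0 D <= stepsize (T r w) t.+1.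
Proof. by rewrite ler_pM2l// Lhat_ge. Qed.

Lemma T_stepsize_gt0 r t w : 0 < stepsize (T r w) t.+1.
Proof. by rewrite mulr_gt0// T_Lhat_gt0. Qed.

Lemma T_idx_le r t w : (idx (T r w t) <= t)%N.
Proof. exact: (@idx_le _ _ (T r w) (new_seg r w)). Qed.

Let coef_ge0 (i : nat) : (0 : R) <= 11 * i%:R / 8 + 7 / 8.
Proof. by rewrite addr_ge0// mulr_ge0. Qed.

Lemma nbatch_le r t w : (nbatch r t w <= maxbatch t)%N.
Proof.
rewrite /nbatch /maxbatch /grad_batch geq_max leq_max /= leq_max; apply/orP; right.
have h (i : nat) (g : R) : 0 < g ->
    0 <= (11 * i%:R / 8 + 7 / 8) * (alpha D / g).
  by move=> g0; rewrite mulr_ge0// divr_ge0// ltW.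
have g1 : 0 < 4 * Lbar0 D by rewrite mulr_gt0.
rewrite -lez_nat !gez0_abs; last 2 first.
- by rewrite ceil_ge0 (lt_le_trans (ltrN10 R))// h.
- by rewrite ceil_ge0 (lt_le_trans (ltrN10 R))// h// T_stepsize_gt0.
apply: le_ceil; apply: ler_pM => //.
- by rewrite divr_ge0 ?ltW ?T_stepsize_gt0.
- by rewrite lerD2r ler_wpM2r// ler_wpM2l// ler_nat T_idx_le.
by rewrite ler_pM2l// lef_pV2 ?posrE ?T_stepsize_gt0// stepsize_ge.
Qed.

(** The batch sizes are chosen for this inequality: it makes an iteration
contribute sigma^2/alpha, whatever its weight and stepsize. *)
Lemma coef_le_nbatch r t w :
  batch_coef (T r w) t.+1 * (alpha D / stepsize (T r w) t.+1) <= (nbatch r t w)%:R.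
Proof.
apply: le_trans (ceil_ge _) _; rewrite /nbatch /grad_batch /batch_coef /=.
set c := Num.ceil _; apply: (@le_trans _ _ (`|c|%N%:R : R)); last by rewrite ler_nat leq_maxr.
by rewrite natr_absz ler_int ler_norm.
Qed.

Let gidx_inj r t : injective (gidx r t).
Proof. by move=> i j [->]. Qed.

Let gidx_fresh r t i : ~ past r t (gidx r t.+1 i).
Proof. by move=> [_]; rewrite ltnn. Qed.

Let eidx_fresh r t i : ~ past_iterate r t (eidx r t.+1 i).
Proof. by move=> [_]; rewrite ltnn. Qed.

Let noise_sum r t m w := batch_sum Z noise (gidx r t.+1) (xs r t) (nbatch r t) m w.

Lemma batch_noiseE r t w :
  batch_noise r t.+1 w = (nbatch r t w)%:R^-1 *: noise_sum r t (maxbatch t) w.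
Proof.
have b0 := nbatch_gt0 r t w.
rewrite /noise_sum /batch_sum -big_mkcond /=.
rewrite -(big_ord_widen _ (fun i => noise (xs r t w) (Z (gidx r t.+1 i) w)) (nbatch_le r t w)).
rewrite /batch_noise /grad_avg /avg_grad /= -/(nbatch r t w).
rewrite [X in _ = _ *: X](eq_bigr (fun i : 'I_(nbatch r t w) =>
  G (xs r t w) (xi r t.+1 i w) - gf (xs r t w)))// sumrB scalerBr; congr (_ - _).
by rewrite sumr_const card_ord -[gf _ *+ _]scaler_nat scalerA mulVf ?scale1r// pnatr_eq0 -lt0n.
Qed.

Section KnownWeight.
Context (r : 'I_nr) (t : nat) (a : Om -> R) (A : R).
Hypotheses (ka : known Z (past r t) a) (a0 : forall w, 0 <= a w) (aA : forall w, a w <= A).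

Let A0 : Om -> 0 <= A. Proof. by move=> w; exact: le_trans (a0 w) (aA w). Qed.

(** The batch size is known before the batch is drawn, so the average is a sum of
centred fresh terms with known coefficients. *)
Lemma noise_dot_mean u : X u ->
  itg P (fun w => a w * dot (batch_noise r t.+1 w) (xs r t w - u)) /\
  mean P (fun w => a w * dot (batch_noise r t.+1 w) (xs r t w - u)) = 0.
Proof.
move=> Xu.
pose c (i : nat) w := a w * (if (i < nbatch r t w)%N then (nbatch r t w)%:R^-1 else 0).
have E w : a w * dot (batch_noise r t.+1 w) (xs r t w - u) =
    \sum_(i < maxbatch t) c i w * dot (noise (xs r t w) (Z (gidx r t.+1 i) w)) (xs r t w - u).
  rewrite batch_noiseE dotZl /noise_sum /batch_sum.
  rewrite (big_morph (fun v => dot v (xs r t w - u)) (fun v v' => dotDl v v' _) (dot0l _)).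
  rewrite mulrA mulr_sumr; apply: eq_bigr => i _; rewrite /c; case: ifP => _.
    by [].
  by rewrite dot0l !mulr0 mul0r.
have h i : itg P (fun w => c i w * dot (noise (xs r t w) (Z (gidx r t.+1 i) w)) (xs r t w - u)) /\
   mean P (fun w => c i w * dot (noise (xs r t w) (Z (gidx r t.+1 i) w)) (xs r t w - u)) = 0.
  have w01 w : 0 <= (if (i < nbatch r t w)%N then (nbatch r t w)%:R^-1 else 0 : R) <= 1.
    case: ifP => _; rewrite ?lexx ?ler01// invr_ge0 ler0n /= invf_le1 ?ltr0n ?nbatch_gt0//.
    by rewrite (ler_nat _ 1) nbatch_gt0.
  have H := batch_mean iidZ noise_measurable noise_mean0 noise_var
    (@gidx_fresh r t) (@xs_known r t) (xs_in r t).
  apply: (H (c i) A _ _ _ (fun w => xs r t w - u) (diam X) i).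
  - apply: measurable_funM => //.
    exact: (known_nat_fun (fun q : nat => if (i < q)%N then q%:R^-1 else 0 : R) (@nbatch_known r t)).
  - by move=> w; have /andP[q0 _] := w01 w; rewrite mulr_ge0.
  - move=> w; have /andP[q0 q1] := w01 w; apply: le_trans (aA w).
    by rewrite ler_piMr.
  - by apply: vmeasurableB; [exact: xs_known|exact: vmeasurable_cst].
  - by move=> w; apply: enorm_le_diam => //; exact: xs_in.
under [X in itg _ X]funext do rewrite E.
under [X in mean _ X]funext do rewrite E.
split; first by apply: itg_sum => i; case: (h i).
rewrite mean_sum => [|i]; last by case: (h i).
by rewrite big1// => i _; case: (h i).
Qed.

(** The factor 1/b of the variance of an average cancels the coefficient. *)
Lemma noise_sqr_mean :
  itg P (fun w => a w * (batch_coef (T r w) t.+1 *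
    (enorm (batch_noise r t.+1 w) ^+ 2 / stepsize (T r w) t.+1))) /\
  mean P (fun w => a w * (batch_coef (T r w) t.+1 *
    (enorm (batch_noise r t.+1 w) ^+ 2 / stepsize (T r w) t.+1))) <=
  mean P a * (sigma ^+ 2 / alpha D).
Proof.
pose c w := a w * batch_coef (T r w) t.+1 / stepsize (T r w) t.+1 / (nbatch r t w)%:R ^+ 2.
have b0 w : (0 : R) < (nbatch r t w)%:R by rewrite ltr0n nbatch_gt0.
have b1 w : (1 : R) <= (nbatch r t w)%:R by rewrite (ler_nat _ 1) nbatch_gt0.
have cf0 w : 0 <= batch_coef (T r w) t.+1 by exact: coef_ge0.
have g0 w := T_stepsize_gt0 r t w.
have E w : a w * (batch_coef (T r w) t.+1 *
    (enorm (batch_noise r t.+1 w) ^+ 2 / stepsize (T r w) t.+1)) =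
    c w * enorm (noise_sum r t (maxbatch t) w) ^+ 2.
  rewrite batch_noiseE enormZ ger0_norm ?invr_ge0 ?ler0n// exprMn exprVn /c.
  by field; rewrite !lt0r_neq0.
have c0 w : 0 <= c w.
  apply: divr_ge0; last exact: sqr_ge0.
  by apply: divr_ge0; [exact: mulr_ge0|exact/ltW].
have cb w : c w * (nbatch r t w)%:R <= a w / alpha D.
  have -> : c w * (nbatch r t w)%:R = a w * (batch_coef (T r w) t.+1 *
     (alpha D / stepsize (T r w) t.+1) / (nbatch r t w)%:R) / alpha D.
    by rewrite /c; field; rewrite !lt0r_neq0.
  rewrite ler_pM2r ?invr_gt0// ler_piMr// ler_pdivrMr// mul1r.
  exact: coef_le_nbatch.
have cC w : c w <= A / alpha D.
  apply: (@le_trans _ _ (a w / alpha D)); last by rewrite ler_wpM2r// invr_ge0 ltW.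
  by apply: le_trans (cb w); rewrite ler_peMr.
have kc : known Z (past r t) c.
  apply: measurable_fun_div; last first.
    exact: (known_nat_fun (fun q : nat => q%:R ^+ 2 : R) (@nbatch_known r t)).
  apply: measurable_fun_div; last exact: stepsize_known.
  apply: measurable_funM => //.
  exact: (known_nat_fun (fun q : nat => 11 * q%:R / 8 + 7 / 8 : R) (@idx_known r t)).
have [i1 m1] := batch_variance iidZ noise_measurable noise_mean0 noise_var
  (@gidx_fresh r t) (@gidx_inj r t.+1) (@xs_known r t) (xs_in r t) kc c0 cC (@nbatch_known r t)
  (maxbatch t).
under [X in itg _ X]funext do rewrite E.
under [X in mean _ X <= _]funext do rewrite E.
split=> //; apply: le_trans m1 _.
have ia : itg P a.
  apply: (@itg_bounded _ _ _ _ _ A); first exact: (known_measurable iidZ ka).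
  by move=> w; rewrite ger0_norm.
rewrite mulrC -meanZ//; apply: mean_le.
- apply: (@itg_bounded _ _ _ _ _ (A / alpha D * sigma ^+ 2 * (maxbatch t)%:R)).
    apply: (known_measurable iidZ (S := past r t)).
    apply: measurable_funM; last first.
      exact: (known_nat_fun (fun q : nat => (minn (maxbatch t) q)%:R : R) (@nbatch_known r t)).
    by apply: measurable_funM => //; exact: measurable_cst.
  have s0 : 0 <= sigma ^+ 2 by exact: sqr_ge0.
  move=> w; have cs : 0 <= c w * sigma ^+ 2 by exact: mulr_ge0.
  rewrite ger0_norm; last exact: mulr_ge0.
  apply: ler_pM => //; last by rewrite ler_nat geq_minl.
  by rewrite ler_wpM2r.
- exact: itgZ.
- move=> w; rewrite (minn_idPr (nbatch_le r t w)) mulrAC.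
  rewrite [leRHS](_ : _ = a w / alpha D * sigma ^+ 2); last by ring.
  by rewrite ler_wpM2r// sqr_ge0.
Qed.

End KnownWeight.

(** ** Estimators of the Lipschitz constant *)
Lemma measurable_curv d1 (U : measurableType d1) (x y : U -> 'rV[R]_n) :
  vmeasurable x -> vmeasurable y -> (forall w, X (x w)) -> (forall w, X (y w)) ->
  measurable_fun setT (fun w => curv f gf (x w) (y w)).
Proof.
move=> mx my Xx Xy; apply: measurable_funM; first exact: measurable_cst.
apply: measurable_funB; first apply: measurable_funB.
- exact: (measurable_gradient_fun cvX cpX X0 mx Xx grad_f).
- exact: (measurable_gradient_fun cvX cpX X0 my Xy grad_f).
- apply: measurable_dot; last exact: vmeasurableB.
  exact: (vmeasurable_lipschitz cvX cpX X0 my Xy lip_gf).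
Qed.

Lemma measurable_sample_curv d1 (U : measurableType d1) (x y : U -> 'rV[R]_n) (u : U -> Xi) :
  vmeasurable x -> vmeasurable y -> (forall w, X (x w)) -> (forall w, X (y w)) ->
  measurable_fun setT u ->
  measurable_fun setT (fun w => sample_curv (x w) (y w) (u w)).
Proof.
move=> mx my Xx Xy mu'; apply: measurable_funM; first exact: measurable_cst.
apply: measurable_funB; first apply: measurable_funB.
- exact: (measurable_val_oracle cvX cpX X0 mF grad_F mx Xx mu').
- exact: (measurable_val_oracle cvX cpX X0 mF grad_F my Xy mu').
- apply: measurable_dot; last exact: vmeasurableB.
  exact: (vmeasurable_grad_oracle cvX cpX X0 mG lip_G).
Qed.

Let dd r t w := enorm (xs r t.+1 w - xs r t w) ^+ 2.
Let cv r t w := curv f gf (xs r t.+1 w) (xs r t w).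

Let dd_ge0 r t w : 0 <= dd r t w. Proof. exact: sqr_ge0. Qed.

Let xs_it r t : vknown Z (past_iterate r t) (xs r t).
Proof. exact: vknownW (@past_sub_iterate r t) (@xs_known r t). Qed.

Let cv_known r t : known Z (past_iterate r t) (cv r t).
Proof.
by apply: measurable_curv; [exact: xs_known_iterate|exact: xs_it|move=> w; exact: xs_in..].
Qed.

Let cv_abs r t w : `|cv r t w| <= (Lmax + l) * diam X ^+ 2.
Proof.
have h1 := curv_le (xs_in r t.+1 w) (xs_in r t w).
have h2 := lower_curv (xs_in r t.+1 w) (xs_in r t w).
have h3 : dd r t w <= diam X ^+ 2 by apply: diam_sqr; exact: xs_in.
have h4 : Lmax * dd r t w <= Lmax * diam X ^+ 2 by rewrite ler_wpM2l// ltW// Lmax_gt0.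
have h5 : l * dd r t w <= l * diam X ^+ 2 by rewrite ler_wpM2l.
have h6 : 0 <= l * dd r t w by rewrite mulr_ge0.
have h7 : 0 <= Lmax * dd r t w by rewrite mulr_ge0// ltW// Lmax_gt0.
move: h1 h2 h4 h5 h6 h7; rewrite -/(cv r t w) -/(dd r t w) ler_norml => h1 h2.
have : - (l * dd r t w) <= cv r t w by rewrite /cv /curv; move: h2; lra.
by move: h1 => {h2}; move: (cv r t w) (dd r t w) => c d; lra.
Qed.

Let alg2 r t := (g_sigma_algebraType (gen Z (past_iterate r t)) * Xi)%type.

(** The average of the sampled curvatures estimates the curvature without
bias, because its samples are drawn after the iterate. *)
Lemma avg_estimate_mean r t (a : Om -> R) (A : R) :
  known Z (past r t) a -> (forall w, 0 <= a w) -> (forall w, a w <= A) ->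
  est D = EstimatorI -> (0 < est_batch D t.+1)%N ->
  itg P (fun w => a w * (cv r t w - Lb r t.+1 w * dd r t w)) /\
  mean P (fun w => a w * (cv r t w - Lb r t.+1 w * dd r t w)) = 0.
Proof.
move=> ka a0 aA eI b0; set b := est_batch D t.+1 in b0 *.
have ka' : known Z (past_iterate r t) a by exact: knownW (@past_sub_iterate r t) ka.
pose h w u := a w * sample_curv (xs r t.+1 w) (xs r t w) u.
pose D2 := diam X ^+ 2.
have D20 : 0 <= D2 by exact: sqr_ge0.
have A0 w : 0 <= A := le_trans (a0 w) (aA w).
have mh : measurable_fun setT (fun p : alg2 r t => h p.1 p.2).
  apply: measurable_funM; first exact: (measurableT_comp ka' measurable_fst).
  apply: (@measurable_sample_curv _ (alg2 r t) (fun p => xs r t.+1 p.1) (fun p => xs r t p.1) snd).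
  - exact: (vmeasurable_comp (@xs_known_iterate r t) measurable_fst).
  - exact: (vmeasurable_comp (@xs_it r t) measurable_fst).
  - by move=> p; exact: xs_in.
  - by move=> p; exact: xs_in.
  - exact: measurable_snd.
have hj j : itg P (fun w => h w (Z (eidx r t.+1 j) w)) /\
    mean P (fun w => h w (Z (eidx r t.+1 j) w)) = mean P (fun w => a w * cv r t w).
  apply: (fresh_mean_eq iidZ (@eidx_fresh r t j) mh (itg_cst P (A * (3 * D2 * Lmax)))).
  - move=> w; apply: itgZ.
    by case: (sample_curv_mean (xs_in r t.+1 w) (xs_in r t w)).
  - move=> w.
    apply: (@le_trans _ _ (mean mu (fun u => A * (3 * D2) * Lxi u))).
      apply: mean_le.
      + apply: itg_norm; apply: itgZ.
        by case: (sample_curv_mean (xs_in r t.+1 w) (xs_in r t w)).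
      + by apply: itgZ; exact: Lxi_itg.
      + move=> u; rewrite normrM ger0_norm// -mulrA ler_pM//.
        by apply: sample_curv_abs; exact: xs_in.
    rewrite meanZ; last exact: Lxi_itg.
    rewrite [leRHS]mulrA ler_wpM2l ?mean_Lxi//.
    by apply: mulr_ge0; [exact: (A0 w)|exact: mulr_ge0].
  - move=> w; have [i1 e1] := sample_curv_mean (xs_in r t.+1 w) (xs_in r t w).
    by rewrite meanZ// e1.
have E w : a w * (cv r t w - Lb r t.+1 w * dd r t w) =
    a w * cv r t w - b%:R^-1 * \sum_(j < b) h w (Z (eidx r t.+1 j) w).
  rewrite mulrBr; congr (_ - _).
  rewrite /Lb /local_estimate eI -/b -[_ * dd _ _ _]mulrA mulrCA; congr (_ * _).
  rewrite mulr_suml mulr_sumr; apply: eq_bigr => j _.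
  by rewrite /h /sample_curv -local_curvE mulrCA.
have ic : itg P (fun w => a w * cv r t w).
  apply: (@itg_bounded _ _ _ _ _ (A * ((Lmax + l) * D2))).
    apply: (known_measurable iidZ (S := past_iterate r t)).
    by apply: measurable_funM; [exact: ka'|exact: cv_known].
  by move=> w; rewrite normrM ger0_norm// ler_pM// cv_abs.
have isum : itg P (fun w => b%:R^-1 * \sum_(j < b) h w (Z (eidx r t.+1 j) w)).
  by apply: itgZ; apply: itg_sum => j; case: (hj j).
under [X in itg _ X]funext do rewrite E.
under [X in mean _ X]funext do rewrite E.
split; first exact: itgB.
rewrite meanB// meanZ; last by apply: itg_sum => j; case: (hj j).
rewrite mean_sum => [|j]; last by case: (hj j).
rewrite (eq_bigr (fun=> mean P (fun w => a w * cv r t w))) => [|j _]; last by case: (hj j).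
rewrite sumr_const card_ord -[X in _ * X]mulr_natl mulrA mulVf ?mul1r ?subrr//.
by rewrite pnatr_eq0 -lt0n.
Qed.

Let alg1 r t m := (g_sigma_algebraType (gen Z (upto (past_iterate r t) (eidx r t.+1) m)) * Xi)%type.

Let beta := beta_fail mu X f gf F G (Lbar0 D).

(** The event whose largest probability is [beta_fail]. *)
Definition underest x y u :=
  (Num.max (Lbar0 D) (local_curv (F ^~ u) (G ^~ u) x y) <= 1 / 2 * local_curv f gf x y)%R.

Lemma measurable_underest d1 (U : measurableType d1) (x y : U -> 'rV[R]_n) (u : U -> Xi) :
  vmeasurable x -> vmeasurable y -> (forall w, X (x w)) -> (forall w, X (y w)) ->
  measurable_fun setT u -> measurable [set w | underest (x w) (y w) (u w)].
Proof.
move=> mx my Xx Xy mu'; apply: measurable_set_le.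
  apply: measurable_maxr; first exact: measurable_cst.
  apply: measurable_fun_div; first exact: measurable_sample_curv.
  by apply: measurable_funX; apply: measurable_enorm; exact: vmeasurableB.
apply: measurable_funM; first exact: measurable_cst.
apply: measurable_fun_div; first exact: measurable_curv.
by apply: measurable_funX; apply: measurable_enorm; exact: vmeasurableB.
Qed.

Let measurable_underest1 x y : X x -> X y -> measurable [set u | underest x y u].
Proof.
move=> Xx Xy; apply: (@measurable_underest _ Xi (fun=> x) (fun=> y) id) => //;
  exact: vmeasurable_cst.
Qed.

Lemma underest_prob x y : X x -> X y ->
  itg mu (fun u => (underest x y u)%:R) /\ mean mu (fun u => (underest x y u)%:R) <= beta.
Proof.
move=> Xx Xy; have [i1 ->] := mean_indic mu (measurable_underest1 Xx Xy); split=> //.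
apply: ub_le_sup; last by exists x, y.
exists 1 => _ [x' [y' [Xx' Xy' ->]]].
have mE := measurable_underest1 Xx' Xy'.
rewrite -[leRHS]/(fine 1%E); apply: fine_le; [exact: fin_num_measure|by []|].
exact: probability_le1.
Qed.

Lemma beta_ge0 : 0 <= beta.
Proof.
have [_] := underest_prob X_start X_start; apply: le_trans.
by apply: mean_ge0 => u; rewrite ler0n.
Qed.

Let underests r t m w :=
  \prod_(j < m) (underest (xs r t.+1 w) (xs r t w) (Z (eidx r t.+1 j) w))%:R : R.

(** The pair of iterates is known before the estimation samples are drawn, so each
of these contributes a factor beta. *)
Lemma underests_mean r t m :
  itg P (underests r t m) /\ mean P (underests r t m) <= beta ^+ m.
Proof.
have sub q : past_iterate r t `<=` upto (past_iterate r t) (eidx r t.+1) q by move=> ?; left.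
have kU q : known Z (upto (past_iterate r t) (eidx r t.+1) q) (underests r t q).
  apply: measurable_prod => j _; apply: measurable_bool_nat; apply: measurable_underest.
  - exact: (vknownW (sub q) (@xs_known_iterate r t)).
  - exact: (vknownW (sub q) (@xs_it r t)).
  - by move=> w; exact: xs_in.
  - by move=> w; exact: xs_in.
  - by apply: (known_sample (Z := Z)); right; exists j => //=.
have U01 q w : 0 <= underests r t q w <= 1.
  apply/andP; split; first by apply: prodr_ge0 => j _.
  by apply: prodr_ile1 => j _; rewrite ler0n lern1; case: underest.
have iU q : itg P (underests r t q).
  apply: (@itg_bounded _ _ _ _ _ 1); first exact: (known_measurable iidZ (kU q)).
  by move=> w; have /andP[u0 u1] := U01 q w; rewrite ger0_norm.
split=> //; elim: m => [|m IH].
  rewrite expr0 (eq_mean P (g := fun=> 1)) ?mean_cst// => w.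
  by rewrite /underests big_ord0.
pose h w u := underests r t m w * (underest (xs r t.+1 w) (xs r t w) u)%:R.
have mh : measurable_fun setT (fun p : alg1 r t m => h p.1 p.2).
  apply: measurable_funM; first exact: (measurableT_comp (kU m) measurable_fst).
  apply: measurable_bool_nat.
  apply: (@measurable_underest _ (alg1 r t m) (fun p => xs r t.+1 p.1) (fun p => xs r t p.1) snd).
  - exact: (vmeasurable_comp (vknownW (sub m) (@xs_known_iterate r t)) measurable_fst).
  - exact: (vmeasurable_comp (vknownW (sub m) (@xs_it r t)) measurable_fst).
  - by move=> p; exact: xs_in.
  - by move=> p; exact: xs_in.
  - exact: measurable_snd.
have fr : ~ upto (past_iterate r t) (eidx r t.+1) m (eidx r t.+1 m).
  by move=> [/eidx_fresh//|[i /= im [ei]]]; rewrite ei ltnn in im.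
have u1 w : itg mu (fun u => (underest (xs r t.+1 w) (xs r t w) u)%:R : R) /\
    mean mu (fun u => (underest (xs r t.+1 w) (xs r t w) u)%:R) <= beta.
  by apply: underest_prob; exact: xs_in.
have h0 w u : 0 <= h w u by rewrite mulr_ge0//; have /andP[] := U01 m w.
have [||i1 m1] := fresh_mean_le iidZ fr mh h0 (itgZ beta (iU m)).
- by move=> w; apply: itgZ; case: (u1 w).
- move=> w; have [i1 m1] := u1 w; rewrite meanZ// mulrC ler_wpM2r//.
  by have /andP[] := U01 m w.
rewrite (eq_mean P (g := fun w => h w (Z (eidx r t.+1 m) w))) => [|w]; last first.
  by rewrite /underests big_ord_recr.
apply: le_trans m1 _; rewrite meanZ// exprS ler_wpM2l//.
exact: beta_ge0.
Qed.

(** The estimator can only fail to reach half of the curvature if each of its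
samples does. *)
Lemma max_estimate_fail r t : est D = EstimatorII ->
  itg P (fun w => (2 * Lb r t.+1 w * dd r t w < cv r t w)%R%:R) /\
  mean P (fun w => (2 * Lb r t.+1 w * dd r t w < cv r t w)%R%:R) <= beta ^+ est_batch D t.+1.
Proof.
move=> eII; set b := est_batch D t.+1.
have [iU mU] := underests_mean r t b.
have mL : measurable_fun setT (Lb r t.+1).
  apply: (@measurable_local_estimate _ _ _ Xi D cvX cpX X0 mF mG grad_F Lxi lip_G _ Om b
    (fun j => xi' r t.+1 j)).
  - by move=> j; case: iidZ => + _ _ => /(_ (eidx r t.+1 j)).
  - by move=> i; exact: (known_measurable iidZ (@xs_known_iterate r t i)).
  - by move=> i; exact: (known_measurable iidZ (@xs_known r t i)).
  - by move=> w; exact: xs_in.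
  - by move=> w; exact: xs_in.
have mdd : measurable_fun setT (dd r t).
  apply: measurable_funX; apply: measurable_enorm; apply: vmeasurableB.
    by move=> i; exact: (known_measurable iidZ (@xs_known_iterate r t i)).
  by move=> i; exact: (known_measurable iidZ (@xs_known r t i)).
have iF : itg P (fun w => (2 * Lb r t.+1 w * dd r t w < cv r t w)%R%:R).
  apply: (@itg_bounded _ _ _ _ _ 1).
    apply: measurable_bool_nat; apply: measurable_set_lt.
      by do 2! apply: measurable_funM => //; exact: measurable_cst.
    exact: (known_measurable iidZ (@cv_known r t)).
  by move=> w; case: (_ < _)%R; rewrite ?normr1 ?normr0.
split=> //; apply: le_trans mU; apply: mean_le => // w.
case: ltP => fail; last by apply: prodr_ge0 => j _.
suff -> : underests r t b w = 1 by [].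
apply: big1 => j _; suff -> : underest (xs r t.+1 w) (xs r t w) (Z (eidx r t.+1 j) w) by [].
have d0 : 0 < dd r t w.
  rewrite lt_neqAle eq_sym dd_ge0 andbT; apply/eqP => d0; move: fail.
  by rewrite -[cv r t w]local_curvE -/(dd r t w) d0 !mulr0 ltxx.
move: fail; rewrite -[cv r t w]local_curvE -/(dd r t w) ltr_pM2r// => fail.
apply: (@le_trans _ _ (Lb r t.+1 w)); last by move: fail; move: (local_curv _ _ _ _) => c; lra.
rewrite /Lb /local_estimate eII -/b ge_max; apply/andP; split.
  exact: bigmax_ge_id.
exact: (le_bigmax_cond _ (fun j : 'I_b => local_curv (F ^~ (xi' r t.+1 j w)) (G ^~ (xi' r t.+1 j w)) (xs r t.+1 w) (xs r t w))).
Qed.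

Lemma sample_le_ae i : {ae P, forall w, Lxi (Z i w) <= Lmax}.
Proof.
have mA : measurable [set u | Lmax < Lxi u].
  by apply: measurable_set_lt => //; exact: measurable_cst.
exists (Z i @^-1` [set u | Lmax < Lxi u]); split.
- by rewrite -[X in measurable X]setTI; case: iidZ => + _ _ => /(_ i); apply.
- case: iidZ => _ -> // _; apply/negligibleP => //.
  by apply: negligibleS Lxi_Lmax => u /=; rewrite ltNge => /negP.
- by move=> w /= /negP; rewrite -ltNge.
Qed.

Lemma Lhat_le_ae r : {ae P, forall w, forall t, Lhat (T r w t) <= Lmax}.
Proof.
have : {ae P, forall w, forall t j, Lxi (xi' r t j w) <= Lmax}.
  apply: ae_foralln => t; apply: ae_foralln => j; exact: (sample_le_ae (eidx r t j)).
apply: filterS => w hw; elim=> [//|t IH]; rewrite T_Lhat ge_max IH /=.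
have hj j : local_curv (F ^~ (xi' r t.+1 j w)) (G ^~ (xi' r t.+1 j w)) (xs r t.+1 w) (xs r t w) <= Lmax.
  by apply: le_trans (hw t.+1 j); apply: local_curv_le; exact: xs_in.
rewrite /Lb /local_estimate; case: (est D).
  have [->|b0] := posnP (est_batch D t.+1).
    by rewrite invr0 mul0r ltW// Lmax_gt0.
  rewrite ler_pdivrMl ?ltr0n// mulr_natl -[X in _ *+ X](card_ord (est_batch D t.+1)) -sumr_const.
  by apply: ler_sum => j _; exact: hj.
apply: bigmax_le => //.
Qed.

(** ** Expected error of a run *)
Lemma exists_minimizer : exists2 u, X u & forall x, X x -> f u <= f x.
Proof.
have cf : continuous (fun v => f (proj X v)).
  exact: continuous_enormP (gradient_econtinuous cvX cpX X0 grad_f).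
have [u uX umin] := compact_EVT_min X0 cpX (continuous_subspaceT cf).
rewrite inE in uX; exists u => // x Xx; have := umin x.
by rewrite inE !proj_id//; exact.
Qed.

Lemma weight_known r t : known Z (past r t) (fun w => weight (T r w) t).
Proof.
exact: (known_nat_fun (fun q : nat => if (2 <= q)%N then 3 * q%:R / 16 - 1 / 4 else 0 : R) (@idx_known r t)).
Qed.

Lemma iter_grad_known r t : vknown Z (past r t) (fun w => iter_grad X gf (T r w) t).
Proof.
apply: vmeasurableZ; first exact: stepsize_known.
apply: vmeasurableB; first exact: xs_known.
apply: (vmeasurable_prox cvX cpX X0); first exact: xs_known.
- apply: (vmeasurable_lipschitz cvX cpX X0 _ _ lip_gf); first exact: xs_known.
  by move=> w; exact: xs_in.
- exact: stepsize_known.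
- by move=> w; exact: T_stepsize_gt0.
Qed.

Lemma grad_sq_known r t : known Z (past r t.+1) (fun w => grad_sq_term X gf (T r w) t.+1).
Proof.
have sub := @past_mono r _ _ (leqnSn t).
apply: measurable_funM.
  apply: measurable_fun_div; first exact: weight_known.
  exact: (knownW sub (@stepsize_known r t)).
apply: measurable_funX; apply: measurable_enorm.
exact: (vknownW sub (@iter_grad_known r t)).
Qed.

Lemma grad_sq_ge0 r t w : 0 <= grad_sq_term X gf (T r w) t.+1.
Proof.
rewrite mulr_ge0 ?sqr_ge0// divr_ge0 ?weight_ge0//.
by rewrite ltW// T_stepsize_gt0.
Qed.

Lemma step_mean r t (a : Om -> R) (A : R) u :
  known Z (past r t) a -> (forall w, 0 <= a w) -> (forall w, a w <= A) -> X u ->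
  let er w := a w * (l / 2 * diam X ^+ 2 - dot (batch_noise r t.+1 w) (xs r t w - u) +
    31 / 22 * batch_coef (T r w) t.+1 *
      (enorm (batch_noise r t.+1 w) ^+ 2 / stepsize (T r w) t.+1)) in
  itg P er /\ mean P er <= A * (l / 2 * diam X ^+ 2 + 31 / 22 * (sigma ^+ 2 / alpha D)).
Proof.
move=> ka a0 aA Xu er.
have [i1 m1] := noise_dot_mean ka a0 aA Xu; have [i2 m2] := noise_sqr_mean ka a0 aA.
have ia : itg P a.
  apply: (@itg_bounded _ _ _ _ _ A); first exact: (known_measurable iidZ ka).
  by move=> w; rewrite ger0_norm.
have mA : mean P a <= A.
  by rewrite -(mean_cst P A); apply: mean_le => //; exact: itg_cst.
pose e1 w := l / 2 * diam X ^+ 2 * a w.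
pose e2 w := a w * dot (batch_noise r t.+1 w) (xs r t w - u).
pose e3 w := a w * (batch_coef (T r w) t.+1 *
    (enorm (batch_noise r t.+1 w) ^+ 2 / stepsize (T r w) t.+1)).
have E : er = fun w => e1 w - e2 w + 31 / 22 * e3 w.
  by apply/funext => w; rewrite /er /e1 /e2 /e3; ring.
have j1 : itg P e1 by exact: itgZ.
have j12 : itg P (fun w => e1 w - e2 w) by exact: itgB.
have j3 : itg P (fun w => 31 / 22 * e3 w) by exact: itgZ.
rewrite E; split; first exact: itgD.
rewrite meanD// meanB// !meanZ// m1 subr0 mulrDr; apply: lerD.
  rewrite mulrC ler_wpM2r// mulr_ge0 ?sqr_ge0//.
  by rewrite divr_ge0.
rewrite mulrCA ler_wpM2l//; apply: le_trans m2 _.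
by rewrite ler_wpM2r// divr_ge0 ?sqr_ge0// ltW.
Qed.

Section RunBound.
Context (k' : nat) (r : 'I_nr).
Let k := k'.+1.
Hypothesis batch_gt0 : forall t, (1 <= t <= k)%N -> (1 <= est_batch D t)%N.
Hypothesis batch_ge : est D = EstimatorII -> forall t, (1 <= t <= k)%N ->
  2 * (ln (k%:R + 1) / ln (1 / beta)) <= (est_batch D t)%:R.
Hypothesis beta_lt1 : beta < 1.

Definition run_grad_sq k0 w := \sum_(1 <= t < k0.+1) grad_sq_term X gf (T r w) t.
Definition run_Qk k0 w :=
  Qk (est D) Lmax (diam X) l sigma (alpha D) k0 (nb_segs (T r w) k0).

Let D2 := diam X ^+ 2.
Let D20 : 0 <= D2. Proof. exact: sqr_ge0. Qed.
Let sa : 0 < sigma ^+ 2 / alpha D. Proof. by rewrite divr_gt0// exprn_gt0. Qed.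
Let B := k%:R * l * D2 / 2 + k%:R * sigma ^+ 2 / alpha D.
Let k0 : (0 : R) < k%:R. Proof. by rewrite ltr0n. Qed.
Let B_gt0 : 0 < B.
Proof. 
rewrite /B ltr_wpDl//; last by rewrite -mulrA mulr_gt0.
apply: divr_ge0 => //; apply: mulr_ge0 => //; exact: mulr_ge0.
Qed.

Let seg_le_k w : (nb_segs (T r w) k <= k)%N.
Proof. by rewrite /nb_segs; apply: (@seg_le _ _ (T r w) (new_seg r w)). Qed.

Lemma run_Qk_gt0 w : 0 < run_Qk k w.
Proof.
rewrite /run_Qk /Qk -addrA -/D2 -/B ltr_wpDl//; case: (est D).
  apply: divr_ge0 => //; apply: mulr_ge0 => //; apply: mulr_ge0; last exact/ltW/Lmax_gt0.
  have : (nb_segs (T r w) k)%:R <= k%:R :> R by rewrite ler_nat.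
  by lra.
apply: divr_ge0 => //; apply: mulr_ge0 => //; apply: mulr_ge0 => //.
exact/ltW/Lmax_gt0.
Qed.

Lemma run_grad_sq_ge0 w : 0 <= run_grad_sq k w.
Proof.
rewrite /run_grad_sq big_add1 /=; apply: sumr_ge0 => t _; exact: grad_sq_ge0.
Qed.

Lemma run_grad_sq_known : known Z (past r k) (run_grad_sq k).
Proof.
rewrite /run_grad_sq; under eq_fun do rewrite big_add1 /= big_mkord.
apply: measurable_sum => t.
exact: (knownW (@past_mono r _ _ (ltn_ord t)) (@grad_sq_known r t)).
Qed.

Lemma run_Qk_known : known Z (past r k) (run_Qk k).
Proof.
exact: (known_nat_fun (fun q : nat => Qk (est D) Lmax (diam X) l sigma (alpha D) k q) (@seg_known r k)).
Qed.

Let ratio_known : known Z (past r k) (fun w => run_grad_sq k w / run_Qk k w).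
Proof. exact: measurable_fun_div run_grad_sq_known run_Qk_known. Qed.

Let ratio_ge0 w : 0 <= run_grad_sq k w / run_Qk k w.
Proof. by rewrite divr_ge0 ?run_grad_sq_ge0// ltW// run_Qk_gt0. Qed.

(** The weights [bound_inv] are known before each iteration, so the noise and the
estimation error have mean zero.  The constant is 3/5 (3 + 31/22) <= 8/3. *)
Lemma run_ratio_avg : est D = EstimatorI ->
  itg P (fun w => run_grad_sq k w / run_Qk k w) /\
  mean P (fun w => run_grad_sq k w / run_Qk k w) <= 8 / 3.
Proof.
move=> eI; have [u Xu umin] := exists_minimizer.
pose a := Lmax * D2 / 2; pose A := 10 * a + B.
have Lm0 := Lmax_gt0.
have a0 : 0 <= a by rewrite divr_ge0// mulr_ge0// ltW.
have A0 : 0 < A by rewrite ltr_wpDl// mulr_ge0.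
pose bi t w := bound_inv X (T r w) Lmax B t.+1.
have bi0 t w : 0 <= bi t w by rewrite ltW// bound_inv_gt0.
have biA t w : bi t w <= A^-1 by apply: bound_inv_le => //; exact: ltW.
have kbi t : known Z (past r t) (bi t).
  exact: (known_nat_fun (fun q : nat => (10 * a + B + a * (t - q)%:R)^-1) (@seg_known r t)).
pose e1 t w := bi t w * (l / 2 * D2 - dot (batch_noise r t.+1 w) (xs r t w - u) +
    31 / 22 * batch_coef (T r w) t.+1 *
      (enorm (batch_noise r t.+1 w) ^+ 2 / stepsize (T r w) t.+1)).
pose p t w : R := bi t w * ((idx (T r w t)).+1%:R / 2).
pose e2 t w := p t w * (cv r t w - Lb r t.+1 w * dd r t w).
have h1 t : itg P (e1 t) /\ mean P (e1 t) <= A^-1 * (l / 2 * D2 + 31 / 22 * (sigma ^+ 2 / alpha D)).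
  exact: step_mean.
have h2 t : (t < k)%N -> itg P (e2 t) /\ mean P (e2 t) = 0.
  move=> tk; apply: (@avg_estimate_mean r t (p t) (A^-1 * (t.+1%:R / 2))) => //.
  - apply: measurable_funM; first exact: kbi.
    exact: (known_nat_fun (fun q : nat => q.+1%:R / 2 : R) (@idx_known r t)).
  - by move=> w; rewrite mulr_ge0// divr_ge0.
  - move=> w; rewrite ler_pM// ?divr_ge0// ler_pM2r// ler_nat ltnS.
    exact: T_idx_le.
  - exact: batch_gt0.
pose bound w := A^-1 * (4 * a) + 3 + \sum_(t < k) (e1 t w + e2 t w).
have iE (t : 'I_k) : itg P (fun w => e1 t w + e2 t w).
  by have [i1 _] := h1 t; have [i2 _] := h2 t (ltn_ord t); exact: itgD.
have iS : itg P (fun w => \sum_(t < k) (e1 t w + e2 t w)) by exact: itg_sum.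
have ib : itg P bound by apply: itgD => //; exact: itg_cst.
have mb : mean P bound <= 97 / 22.
  rewrite meanD ?mean_cst//; last exact: itg_cst.
  rewrite mean_sum//.
  have : \sum_(t < k) mean P (fun w => e1 t w + e2 t w) <=
     \sum_(t < k) A^-1 * (l / 2 * D2 + 31 / 22 * (sigma ^+ 2 / alpha D)).
    apply: ler_sum => t _; have [i1 m1] := h1 t; have [i2 m2] := h2 t (ltn_ord t).
    by rewrite meanD// m2 addr0.
  rewrite sumr_const card_ord -[X in _ <= X]mulr_natl.
  set s := \sum_(t < k) _ => hs.
  suff : A^-1 * (4 * a) + k%:R * (A^-1 * (l / 2 * D2 + 31 / 22 * (sigma ^+ 2 / alpha D))) <= 31 / 22.
    by move: hs; set q := k%:R * _; move: (A^-1 * (4 * a)) => z; lra.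
  rewrite [k%:R * _]mulrCA -mulrDr ler_pdivrMl// /A.
  have kl0 : 0 <= k%:R * l * D2 by apply: mulr_ge0 => //; exact: mulr_ge0.
  have -> : k%:R * (l / 2 * D2 + 31 / 22 * (sigma ^+ 2 / alpha D)) =
    k%:R * l * D2 / 2 + 31 / 22 * (k%:R * sigma ^+ 2 / alpha D) by ring.
  by rewrite /B; move: kl0 a0; move: (k%:R * l * D2) (k%:R * sigma ^+ 2 / alpha D) (a) => x y z; lra.
have [ir mr] : itg P (fun w => run_grad_sq k w / run_Qk k w) /\
    mean P (fun w => run_grad_sq k w / run_Qk k w) <= mean P (fun w => 3 / 5 * bound w).
  apply: itg_le_ae => //.
  - exact: (known_measurable iidZ ratio_known).
  - exact: itgZ.
  apply: filterS (Lhat_le_ae r) => w hw.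
  have := path_bound_avg cvX cpX l0 lower_curv (tr := T r w) (ns := new_seg r w)
    (dlt := fun t => batch_noise r t w) (Lb := fun t => Lb r t w) X_start
    (T_iterate r w) (T_Lhat r w) (fun=> erefl) erefl erefl (T_idx r w) (T_seg r w) L0_gt0
    Lm0 (ltW B_gt0) A0 Xu umin (hw k).
  have -> : bound_inv X (T r w) Lmax B k'.+2 = (run_Qk k w)^-1.
    rewrite /bound_inv /run_Qk /Qk eI -/k -/D2 natrB; last exact: seg_le_k.
    by congr (_ ^-1); rewrite /B /nb_segs; field; rewrite gt_eqF.
  rewrite -/k -/D2 -/a -/A -/(run_grad_sq k w).
  rewrite [X in _ <= _ + _ + X -> _](_ : _ = \sum_(t < k) (e1 t w + e2 t w)); last first.
    rewrite big_add1 -[k'.+2.-1]/k big_mkord; apply: eq_bigr => t _.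
    by rewrite /e1 /e2 /p -[bi t w * _ * _]mulrA -mulrDr.
  by rewrite -/(bound w) -mulrA; move: (run_grad_sq k w / run_Qk k w) (bound w) => x y; lra.
split=> //; apply: le_trans mr _; rewrite meanZ//; lra.
Qed.

(** The failures cost Lmax D^2/2 times the sum of t/(k+1)^2, which is at most 1/2;
this turns the constant 5 of [path_bound_max] into 21/4. *)
Lemma run_ratio_max : est D = EstimatorII ->
  itg P (fun w => run_grad_sq k w / run_Qk k w) /\
  mean P (fun w => run_grad_sq k w / run_Qk k w) <= 8 / 3.
Proof.
move=> eII; have [u Xu umin] := exists_minimizer.
have Lm0 := Lmax_gt0.
pose a := Lmax / 2 * D2.
have a0 : 0 <= a by rewrite mulr_ge0// divr_ge0// ltW.
pose Q := 21 / 2 * a + B.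
have Q0 : 0 < Q by rewrite ltr_wpDl// mulr_ge0.
have QE w : run_Qk k w = Q.
  by rewrite /run_Qk /Qk eII -/D2 /Q /B /a; field; rewrite gt_eqF.
pose e1 t w := 1 * (l / 2 * D2 - dot (batch_noise r t.+1 w) (xs r t w - u) +
    31 / 22 * batch_coef (T r w) t.+1 *
      (enorm (batch_noise r t.+1 w) ^+ 2 / stepsize (T r w) t.+1)).
pose fail t w : R := (2 * Lb r t.+1 w * dd r t w < cv r t w)%R%:R.
have h1 t : itg P (e1 t) /\ mean P (e1 t) <= 1 * (l / 2 * D2 + 31 / 22 * (sigma ^+ 2 / alpha D)).
  by apply: step_mean => //; exact: measurable_cst.
have h2 t : (t < k)%N -> itg P (fail t) /\ mean P (fail t) <= ((k%:R + 1) ^+ 2)^-1.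
  move=> tk; have [i1 m1] := max_estimate_fail r t eII; split=> //.
  apply: le_trans m1 _; apply: pow_le_inv_sqr; last exact: batch_ge.
    by rewrite beta_ge0.
  exact: batch_gt0.
pose er t w := e1 t w + t.+1%:R * a * fail t w.
have iE (t : 'I_k) : itg P (er t).
  have [i1 _] := h1 t; have [i2 _] := h2 t (ltn_ord t).
  by apply: itgD => //; exact: itgZ.
pose bound w := 10 * a + \sum_(t < k) er t w.
have iS : itg P (fun w => \sum_(t < k) er t w) by exact: itg_sum.
have ib : itg P bound by apply: itgD => //; exact: itg_cst.
have mb : mean P bound <= 31 / 22 * Q.
  rewrite meanD ?mean_cst//; last exact: itg_cst.
  rewrite mean_sum//.
  have : \sum_(t < k) mean P (er t) <=
     \sum_(t < k) ((l / 2 * D2 + 31 / 22 * (sigma ^+ 2 / alpha D)) +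
       a * (t.+1%:R / (k%:R + 1) ^+ 2)).
    apply: ler_sum => t _; have [i1 m1] := h1 t; have [i2 m2] := h2 t (ltn_ord t).
    rewrite meanD//; last exact: itgZ.
    rewrite meanZ//; apply: lerD; first by rewrite mul1r in m1.
    by rewrite [leLHS](mulrAC) mulrC ler_wpM2l// ler_wpM2l.
  rewrite big_split /= sumr_const card_ord -[X in _ <= X + _ -> _]mulr_natl -mulr_sumr.
  have := sum_le_sqr R k; move/(ler_wpM2l a0).
  have kl0 : 0 <= k%:R * l * D2 by apply: mulr_ge0 => //; exact: mulr_ge0.
  have -> : k%:R * (l / 2 * D2 + 31 / 22 * (sigma ^+ 2 / alpha D)) =
    k%:R * l * D2 / 2 + 31 / 22 * (k%:R * sigma ^+ 2 / alpha D) by ring.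
  rewrite /Q /B; move: kl0 a0; move: (k%:R * l * D2) (k%:R * sigma ^+ 2 / alpha D) (a).
  move: (\sum_(t < k) mean P _) (\sum_(_ < _) _) => s s' x y z; lra.
have [ir mr] : itg P (fun w => run_grad_sq k w / run_Qk k w) /\
    mean P (fun w => run_grad_sq k w / run_Qk k w) <= mean P (fun w => Q^-1 * bound w).
  apply: itg_le_ae => //.
  - exact: (known_measurable iidZ ratio_known).
  - exact: itgZ.
  apply: filterS (Lhat_le_ae r) => w hw; rewrite QE mulrC ler_wpM2l ?invr_ge0 ?(ltW Q0)//.
  have Lb0 t : (0 < t)%N -> 0 < Lb r t w.
    move=> _; apply: (lt_le_trans L0_gt0); rewrite /Lb /local_estimate eII.
    exact: bigmax_ge_id.
  have cvL t : (0 < t)%N -> curv f gf (iterate (T r w t)) (iterate (T r w t.-1)) <=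
      Lmax * enorm (iterate (T r w t) - iterate (T r w t.-1)) ^+ 2.
    by move=> _; apply: curv_le; exact: xs_in.
  have := path_bound_max cvX cpX l0 lower_curv (tr := T r w) (ns := new_seg r w)
    (dlt := fun t => batch_noise r t w) (Lb := fun t => Lb r t w) X_start
    (T_iterate r w) (T_Lhat r w) (fun=> erefl) erefl erefl (T_idx r w) (T_seg r w) L0_gt0
    Xu umin (hw k) Lb0 (ltW Lm0) cvL.
  rewrite -/k -/D2 -/(run_grad_sq k w).
  have -> : 5 * Lmax * D2 = 10 * a by rewrite /a; field.
  rewrite [X in _ <= _ + X -> _](_ : _ = \sum_(t < k) er t w)//.
  rewrite big_add1 -[k'.+2.-1]/k big_mkord; apply: eq_bigr => t _.
  rewrite /er /e1 mul1r; congr (_ + _); rewrite /fail -/a.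
  by rewrite -[LHS]/(if (2 * Lb r t.+1 w * dd r t w < cv r t w)%R then _ else _);
     case: ifP => _; rewrite ?mulr1 ?mulr0.
split=> //; apply: le_trans mr _; rewrite meanZ// ler_pdivrMl//; lra.
Qed.

Lemma run_ratio :
  itg P (fun w => run_grad_sq k w / run_Qk k w) /\
  mean P (fun w => run_grad_sq k w / run_Qk k w) <= 8 / 3.
Proof.
by case eD: (est D); [exact: run_ratio_avg|exact: run_ratio_max].
Qed.

End RunBound.

(** ** Random outputs *)
Lemma gen_setT : <<s gen Z setT >> = sigma_generated Z.
Proof.
congr (<<s _ >>); apply/seteqP; split=> B [i [A]].
  by move=> [_ mA ->]; exists i, A.
by move=> [mA ->]; exists i, A.
Qed.

Section Outputs.
Context (k' : nat) (Rout : 'I_nr -> Om -> nat).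
Let k := k'.+1.
Hypothesis outR : random_outputs P (sigma_generated Z) k T Rout.

Let steps_total r w : weight_total (T r w) k =
  \sum_(j < k) weight (T r w) j.+1 / stepsize (T r w) j.+1.
Proof. by rewrite /weight_total big_add1 big_mkord. Qed.

Let step_weight_ge0 r j w : 0 <= weight (T r w) j.+1 / stepsize (T r w) j.+1.
Proof. by rewrite divr_ge0 ?weight_ge0// ltW// T_stepsize_gt0. Qed.

Let step_weight_known r j : (j < k)%N ->
  known Z (past r k) (fun w => weight (T r w) j.+1 / stepsize (T r w) j.+1).
Proof.
move=> jk; apply: measurable_fun_div.
  exact: (knownW (@past_mono r _ _ jk) (@weight_known r j.+1)).
exact: (knownW (@past_mono r _ _ (ltnW jk)) (@stepsize_known r j)).
Qed.

Lemma weight_total_known r : known Z (past r k) (fun w => weight_total (T r w) k).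
Proof.
under eq_fun do rewrite steps_total.
by apply: measurable_sum => j; exact: step_weight_known.
Qed.

Lemma weight_total_ge0 r w : 0 <= weight_total (T r w) k.
Proof. by rewrite steps_total; apply: sumr_ge0. Qed.

Definition live r w := (0 < weight_total (T r w) k)%R.

Lemma live_known r : <<s gen Z (past r k) >> [set w | live r w].
Proof.
apply: (@measurable_set_lt _ (g_sigma_algebraType (gen Z (past r k)))).
  exact: measurable_cst.
exact: weight_total_known.
Qed.

(** The conditional law of the output of a run, extended by zero to the runs
without an output law. *)
Definition output_weight r j w : R := (live r w)%:R * output_prob (T r w) k j.

Lemma output_weight_ge0 r j w : 0 <= output_weight r j w.
Proof.
apply: mulr_ge0 => //; apply: mulr_ge0 => //.
by rewrite invr_ge0 weight_total_ge0.
Qed.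

Lemma output_weight_known r j : (j < k)%N -> known Z (past r k) (output_weight r j).
Proof.
move=> jk; apply: measurable_funM.
  by apply: measurable_bool_nat; exact: live_known.
apply: measurable_funM; last exact: step_weight_known.
by apply: measurable_funV; exact: weight_total_known.
Qed.

Lemma output_weight_sum r w : \sum_(j < k) output_weight r j w = (live r w)%:R.
Proof.
rewrite -mulr_sumr /output_prob -mulr_sumr -steps_total /live.
by case: ltP => [wt0|_]; rewrite ?mul0r// mul1r mulVf ?gt_eqF.
Qed.

Lemma output_weight_le1 r j w : (j < k)%N -> output_weight r j w <= 1.
Proof.
move=> jk; apply: (@le_trans _ _ (live r w)%:R); last by case: live.
rewrite -output_weight_sum (bigD1 (Ordinal jk))//= lerDl.
by apply: sumr_ge0 => i _; exact: output_weight_ge0.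
Qed.

Lemma Rout_lt r w : (Rout r w < k)%N.
Proof. by case: outR => /(_ r w)/andP[]. Qed.

Section Event.
Context (A : 'I_nr -> nat -> Om -> bool).
Hypothesis kA : forall r j, (j < k)%N -> <<s gen Z setT >> [set w | A r j w].

(** The probability that all the random outputs satisfy prescribed properties
of the samples is computed by first averaging over the outputs. *)
Lemma outputs_prob :
  let hit w := [forall r, live r w && A r (Rout r w) w] in
  itg P (fun w => (hit w)%:R) /\
  mean P (fun w => (hit w)%:R) <=
  mean P (fun w => \prod_r \sum_(j < k) output_weight r j w * (A r j w)%:R).
Proof.
move=> hit.
(* The event is split according to the values i of the outputs. *)
pose pick (i : {ffun 'I_nr -> 'I_k}) w := [forall r, live r w && A r (i r) w].
pose E i w := pick i w && [forall r, Rout r w == i r].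
have kP i : <<s gen Z setT >> [set w | pick i w].
  apply: (@measurable_forall _ (g_sigma_algebraType (gen Z setT))) => r.
  apply: (@measurable_andb _ (g_sigma_algebraType (gen Z setT))).
    exact: (sub_sigma_gen (@subsetT _ _) (@live_known r)).
  exact: kA.
have mP i : measurable [set w | pick i w] := sigma_gen_measurable iidZ (kP i).
have mR i : measurable [set w | [forall r, Rout r w == i r :> nat]].
  apply: measurable_forall => r; case: outR => _ /(_ r (i r)) + _.
  by congr measurable; apply/seteqP; split=> w /= /eqP.
have mE i : measurable [set w | E i w] by exact: measurable_andb.
have hitE w : (hit w)%:R = \sum_i (E i w)%:R :> R.
  pose i0 := [ffun r => Ordinal (Rout_lt r w)].
  rewrite (bigD1 i0)//= big1 ?addr0.
    congr (nat_of_bool _)%:R; rewrite /E /pick /hit.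
    rewrite [X in _ = _ && X](_ : _ = true) ?andbT.
      by apply: eq_forallb => r; rewrite ffunE.
    by apply/forallP => r; rewrite ffunE.
  move=> i ii0; rewrite /E; case: forallP => [h|]; last by rewrite andbF.
  case/eqP: ii0; apply/ffunP => r; apply/val_inj; rewrite ffunE /=.
  by apply/esym/eqP.
under [X in itg _ X]funext do rewrite hitE.
under [X in mean _ X <= _]funext do rewrite hitE.
have iE i : itg P (fun w => (E i w)%:R : R) by case: (mean_indic P (mE i)).
split; first exact: itg_sum.
pose v (i : {ffun 'I_nr -> 'I_k}) w : R := \prod_r (output_weight r (i r) w * (A r (i r) w)%:R).
have v01 i w : 0 <= v i w <= 1.
  apply/andP; split; first by apply: prodr_ge0 => r _; rewrite mulr_ge0// output_weight_ge0.
  apply: prodr_ile1 => r _; rewrite mulr_ge0 ?output_weight_ge0//=.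
  case: (A _ _ _); rewrite ?mulr0 ?ler01// mulr1.
  exact: output_weight_le1.
have iv i : itg P (v i).
  apply: (@itg_bounded _ _ _ _ _ 1); last first.
    by move=> w; have /andP[v0 v1] := v01 i w; rewrite ger0_norm.
  apply: measurable_prod => r _; apply: measurable_funM.
    apply: (known_measurable iidZ (S := past r k)).
    exact: (@output_weight_known r (i r) (ltn_ord _)).
  apply: measurable_bool_nat; apply: (sigma_gen_measurable iidZ (S := setT)); exact: kA.
have hE i : mean P (fun w => (E i w)%:R) <= mean P (v i).
  have [_ ->] := mean_indic P (mE i).
  have [/forallP ipos|] := boolP [forall r, (0 < i r)%N]; last first.
    rewrite negb_forall => /existsP[r]; rewrite -eqn0Ngt => /eqP ir0.
    have -> : [set w | E i w] = set0.
      apply/seteqP; split=> // w /= /andP[_ /forallP/(_ r)]; rewrite ir0 => /eqP e.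
      by case: outR => /(_ r w); rewrite e.
    by rewrite measure0; apply: mean_ge0 => w; case/andP: (v01 i w).
  rewrite -lee_fin fineK; last exact: fin_num_measure.
  case: outR => _ _ /(_ [set w | pick i w] (fun r => i r)) h.
  have -> : [set w | E i w] = [set w | pick i w] `&` [set w | forall r, Rout r w = i r].
    apply/seteqP; split=> w /=.
      by move=> /andP[pw /forallP h']; split=> // r; apply/eqP; exact: h'.
    by move=> [pw h']; apply/andP; split=> //; apply/forallP => r; apply/eqP; exact: h'.
  rewrite h; last 3 first.
  - by rewrite -gen_setT; exact: kP.
  - by move=> w /forallP pw r /=; case/andP: (pw r).
  - by move=> r; rewrite ipos ltn_ord.
  rewrite integral_mkcond -int_mean// le_eqVlt; apply/orP; left; apply/eqP.
  apply: eq_integral => w _; rewrite /patch /=; case: ifPn => pw.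
    rewrite inE /= in pw; congr EFin; apply: eq_bigr => r _.
    by have /andP[lr Ar] := forallP pw r; rewrite /output_weight lr Ar mul1r mulr1.
  congr EFin; apply/esym.
  have : ~~ pick i w by apply: contraNN pw; rewrite inE.
  rewrite /pick negb_forall => /existsP[r]; rewrite negb_and => hr.
  rewrite /v (bigD1 r)//= /output_weight.
  by case/orP: hr => /negbTE->; rewrite ?mulr0 ?mul0r.
rewrite mean_sum//.
rewrite [leRHS](_ : _ = \sum_i mean P (v i)); first by apply: ler_sum.
rewrite -mean_sum//; apply: eq_mean => w.
by rewrite bigA_distr_bigA.
Qed.

End Event.

Hypothesis batch_gt0 : forall t, (1 <= t <= k)%N -> (1 <= est_batch D t)%N.
Hypothesis batch_ge : est D = EstimatorII -> forall t, (1 <= t <= k)%N ->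
  2 * (ln (k%:R + 1) / ln (1 / beta)) <= (est_batch D t)%:R.
Hypothesis beta_lt1 : beta < 1.

(** The constant 16/3 is twice the bound of [run_ratio], so that Markov's inequality
gives 1/2. *)
Definition far r j w :=
  (16 / 3 * run_Qk r k w < weight_total (T r w) k * enorm (iter_grad X gf (T r w) j) ^+ 2)%R.

Lemma far_known r j : (j < k)%N -> <<s gen Z (past r k) >> [set w | far r j w].
Proof.
move=> jk; apply: (@measurable_set_lt _ (g_sigma_algebraType (gen Z (past r k)))).
  by apply: measurable_funM; [exact: measurable_cst|exact: run_Qk_known].
apply: measurable_funM; first exact: weight_total_known.
apply: measurable_funX; apply: measurable_enorm.
exact: (vknownW (@past_mono r _ _ (ltnW jk)) (@iter_grad_known r j)).
Qed.

Let far_weight r w := \sum_(j < k) output_weight r j w * (far r j w)%:R.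

Let hit_weight_known S r (A : nat -> Om -> bool) : past r k `<=` S ->
  (forall j, (j < k)%N -> <<s gen Z S >> [set w | A j w]) ->
  known Z S (fun w => \sum_(j < k) output_weight r j w * (A j w)%:R).
Proof.
move=> sub kA; apply: measurable_sum => j; apply: measurable_funM.
  exact: (knownW sub (@output_weight_known r j (ltn_ord j))).
by apply: measurable_bool_nat; exact: kA.
Qed.

Let hit_weight_01 r (A : nat -> Om -> bool) w :
  0 <= \sum_(j < k) output_weight r j w * (A j w)%:R <= 1.
Proof.
apply/andP; split; first by apply: sumr_ge0 => j _; rewrite mulr_ge0// output_weight_ge0.
apply: (@le_trans _ _ (\sum_(j < k) output_weight r j w)).
  apply: ler_sum => j _; rewrite ler_piMr ?output_weight_ge0//.
  by case: (A j w).
by rewrite output_weight_sum; case: live.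
Qed.

(** Markov's inequality for the random output, given the run. *)
Lemma far_weight_mean r : mean P (far_weight r) <= 1 / 2.
Proof.
have [i1 m1] := run_ratio r batch_gt0 batch_ge beta_lt1.
suff : mean P (far_weight r) <= mean P (fun w => 3 / 16 * (run_grad_sq r k w / run_Qk r k w)).
  by rewrite meanZ// => h; apply: le_trans h _; lra.
apply: mean_le.
- apply: (@itg_bounded _ _ _ _ _ 1); last first.
    move=> w; have /andP[v0 v1] := hit_weight_01 r (far r) w.
    by rewrite ger0_norm.
  apply: (known_measurable iidZ (S := past r k)).
  by apply: hit_weight_known => // j; exact: far_known.
- exact: itgZ.
- move=> w; have Q0 := run_Qk_gt0 k' r w.
  rewrite /far_weight /run_grad_sq big_add1 -[k.+1.-1]/k big_mkord.
  rewrite mulr_suml mulr_sumr; apply: ler_sum => j _.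
  have g0 := grad_sq_ge0 r j w.
  have rhs0 : 0 <= 3 / 16 * (grad_sq_term X gf (T r w) j.+1 / run_Qk r k w).
    by rewrite mulr_ge0// divr_ge0// ltW.
  rewrite /output_weight; case lw: (live r w); last by rewrite !mul0r.
  rewrite mul1r; case fw: (far r j w); last by rewrite mulr0.
  rewrite mulr1 /output_prob; move: fw; rewrite /far => fw.
  have v0 := step_weight_ge0 r j w.
  rewrite /grad_sq_term [j.+1.-1]/=; move: fw v0 => {g0 rhs0}.
  set v := weight _ _ / _; set g := enorm _ ^+ 2.
  move: lw; rewrite /live; move: (weight_total _ _) => M M0 fw v0.
  rewrite ler_pdivrMl//.
  have -> : M * (3 / 16 * (v * g / run_Qk r k w)) = v * (3 / 16 * (M * g) / run_Qk r k w).
    by field; rewrite gt_eqF.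
  rewrite ler_peMr// ler_pdivlMr//; lra.
Qed.

(** The runs use disjoint sets of samples, so the expectation of the product over
the runs factorizes. *)
Lemma far_prob :
  let hit w := [forall r, live r w && far r (Rout r w) w] in
  itg P (fun w => (hit w)%:R) /\ mean P (fun w => (hit w)%:R) <= (1 / 2) ^+ nr.
Proof.
have [|i1 m1] := @outputs_prob far.
  by move=> r j jk; apply: (sub_sigma_gen (@subsetT _ (past r k))); exact: far_known.
split=> //; apply: le_trans m1 _.
rewrite (eq_mean P (g := fun w => \prod_(r <- index_enum 'I_nr) far_weight r w))//.
have k1 r : known Z (past r k) (far_weight r).
  by apply: hit_weight_known => // j; exact: far_known.
have w0 r w : 0 <= far_weight r w by case/andP: (hit_weight_01 r (far r) w).
have w1 r w : far_weight r w <= 1 by case/andP: (hit_weight_01 r (far r) w).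
have iw r : itg P (far_weight r).
  apply: (@itg_bounded _ _ _ _ _ 1); first exact: (known_measurable iidZ (k1 r)).
  by move=> w; rewrite ger0_norm.
have ip : itg P (fun w => \prod_(r <- index_enum 'I_nr) far_weight r w).
  apply: (@itg_bounded _ _ _ _ _ 1).
    by apply: measurable_prod => r _; exact: (known_measurable iidZ (k1 r)).
  move=> w; rewrite ger0_norm; first by apply: prodr_ile1 => r _; rewrite w0 w1.
  by apply: prodr_ge0 => r _.
rewrite -lee_fin -int_mean//.
rewrite (known_prod_expectation iidZ (S := fun r => past r k)) //; last 2 first.
- exact: index_enum_uniq.
- move=> r r' rr'; apply/seteqP; split=> // j [].
  by case: j => [[[[q t] i]|[[q t] i]]|i] //= [-> _] [e _]; rewrite e eqxx in rr'.
rewrite (eq_bigr (fun r => (mean P (far_weight r))%:E)) => [|r _]; last exact: int_mean.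
rewrite prodEFin lee_fin.
rewrite -[X in _ <= _ ^+ X](card_ord nr) -prodr_const; apply: ler_prod => r _.
by rewrite mean_ge0//= far_weight_mean.
Qed.

Section Noisy.
Context (K : nat) (s : R).
Hypotheses (K0 : (0 < K)%N) (s0 : 0 <= s).

Definition post_noise r j w := K%:R^-1 *: \sum_(i < K) noise (xs r j w) (zeta i w).

Definition noisy r j w := (s * sigma / Num.sqrt K%:R < enorm (post_noise r j w))%R.

Lemma noisy_known r j : <<s gen Z setT >> [set w | noisy r j w].
Proof.
apply: (@measurable_set_lt _ (g_sigma_algebraType (gen Z setT))); first exact: measurable_cst.
apply: measurable_enorm; apply: vmeasurableZ; first exact: measurable_cst.
apply: vmeasurable_sum => i; apply: noise_measurable.
- exact: (vknownW (@subsetT _ (past r j)) (@xs_known r j)).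
- by move=> w; exact: xs_in.
- exact: (@known_sample _ _ _ _ _ Z setT (inr (i : nat) : J) I).
Qed.

(** The post-optimization samples are fresh whatever the output of the run, and the
tail bound survives averaging over the output. *)
Lemma noisy_prob r :
  let hit w := [forall r', live r' w && ((r' != r) || noisy r' (Rout r' w) w)] in
  itg P (fun w => (hit w)%:R) /\ mean P (fun w => (hit w)%:R) <= 2 * expR (- (s ^+ 2 / 3)).
Proof.
pose A r' j w := (r' != r) || noisy r' j w.
have kA r' j : <<s gen Z setT >> [set w | A r' j w].
  rewrite /A; case: eqP => _ /=; first exact: noisy_known.
  have -> : [set w : Om | true] = setT by apply/seteqP; split.
  exact: (@measurableT _ (g_sigma_algebraType (gen Z setT))).
have [|i1 m1] := @outputs_prob A; first by move=> r' j _; exact: kA.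
split=> //; apply: le_trans m1 _.
pose y (j : nat) w := output_weight r j w * (noisy r j w)%:R.
have yA w : \sum_(j < k) output_weight r j w * (A r j w)%:R = \sum_(j < k) y j w.
  by apply: eq_bigr => j _; rewrite /A eqxx.
have iy (j : 'I_k) : itg P (y j).
  apply: (@itg_bounded _ _ _ _ _ 1).
    apply: measurable_funM.
      exact: (known_measurable iidZ (@output_weight_known r j (ltn_ord j))).
    by apply: measurable_bool_nat; apply: (sigma_gen_measurable iidZ (S := setT)); exact: noisy_known.
  move=> w; rewrite ger0_norm; last by rewrite mulr_ge0// output_weight_ge0.
  rewrite /y; case: noisy; rewrite ?mulr0 ?ler01// mulr1.
  exact: output_weight_le1.
have iw (j : 'I_k) : itg P (output_weight r j).
  apply: (@itg_bounded _ _ _ _ _ 1).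
    exact: (known_measurable iidZ (@output_weight_known r j (ltn_ord j))).
  move=> w; rewrite ger0_norm; last by rewrite output_weight_ge0.
  exact: output_weight_le1.
apply: (@le_trans _ _ (mean P (fun w => \sum_(j < k) y j w))).
  apply: mean_le; last 2 first.
  - exact: itg_sum.
  - move=> w; rewrite (bigD1 r)//= yA ler_piMr//.
      by rewrite -yA; case/andP: (hit_weight_01 r (A r) w).
    by apply: prodr_ile1 => r' _; exact: hit_weight_01.
  apply: (@itg_bounded _ _ _ _ _ 1).
    apply: measurable_prod => r' _; apply: (known_measurable iidZ (S := setT)).
    by apply: hit_weight_known => // j _; exact: kA.
  move=> w; rewrite ger0_norm; first by apply: prodr_ile1 => r' _; exact: hit_weight_01.
  by apply: prodr_ge0 => r' _; case/andP: (hit_weight_01 r' (A r') w).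
rewrite mean_sum//.
have fresh i : ~ past r k (inr i : J) by [].
have tail (j : 'I_k) : mean P (y j) <= 2 * expR (- (s ^+ 2 / 3)) * mean P (output_weight r j).
  have inj : injective (inr : nat -> J) by move=> ? ? [].
  exact: (batch_tail iidZ noise_measurable noise_mean0 fresh inj
    (vknownW (@past_mono r _ _ (ltnW (ltn_ord j))) (@xs_known r j)) (xs_in r j)
    (@output_weight_known r j (ltn_ord j)) (output_weight_ge0 r j)
    (fun w => output_weight_le1 r w (ltn_ord j)) sigma0 noise_tail K0 s0).
apply: le_trans (ler_sum _ (fun j _ => tail j)) _.
rewrite -mulr_sumr -mean_sum//.
apply: ler_piMr; first by rewrite mulr_ge0// expR_ge0.
rewrite -[leRHS](mean_cst P 1); apply: mean_le; [exact: itg_sum|exact: itg_cst|].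
by move=> w; rewrite output_weight_sum; case: live.
Qed.

End Noisy.

Section Best.
Context (K : nat) (best : Om -> 'I_nr) (lambda : R).
Hypotheses (K0 : (0 < K)%N) (lambda0 : 0 <= lambda).
Let g_X r w := iter_grad X gf (T r w) (Rout r w).
Let gbar_X r w :=
  iter_grad X (avg_grad G K (fun j => zeta j w)) (T r w) (Rout r w).
Hypothesis mbest : forall r, measurable [set w | best w = r].
Hypothesis best_min : forall w r, enorm (gbar_X (best w) w) <= enorm (gbar_X r w).
Let s := 1 + lambda.
Let c := 12 * s ^+ 2 * sigma ^+ 2 / K%:R.

Let s0 : 0 <= s. Proof. by rewrite addr_ge0. Qed.

Lemma post_grad_err r w :
  enorm (g_X r w - gbar_X r w) <= enorm (post_noise K r (Rout r w) w).
Proof.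
apply: le_trans (enorm_proj_grad_lip cvX cpX X0 _ _ _ (T_stepsize_gt0 _ _ _)) _.
rewrite enormB le_eqVlt; apply/orP; left; apply/eqP; congr enorm; rewrite /post_noise /avg_grad.
rewrite [X in _ = _ *: X](eq_bigr (fun i : 'I_K =>
  G (xs r (Rout r w) w) (zeta i w) - gf (xs r (Rout r w) w)))//.
rewrite sumrB scalerBr; congr (_ - _).
by rewrite sumr_const card_ord -[gf _ *+ _]scaler_nat scalerA mulVf ?scale1r// pnatr_eq0 -lt0n.
Qed.

(** The factor 3/2 of [noisy_argmin_sqr] turns 16/3 into 8. *)
Lemma best_le r w : live r w -> ~~ far r (Rout r w) w ->
  ~~ noisy K s r (Rout r w) w -> ~~ noisy K s (best w) (Rout (best w) w) w ->
  enorm (g_X (best w) w) ^+ 2 <= 8 * run_Qk r k w / weight_total (T r w) k + c.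
Proof.
rewrite /live /far /noisy -!leNgt => M0 hf n1 n2.
set e := s * sigma / Num.sqrt K%:R in n1 n2.
have K0' : (0 : R) < K%:R by rewrite ltr0n.
have cE : c = 12 * e ^+ 2.
  by rewrite /c /e exprMn exprVn sqr_sqrtr ?(ltW K0')//; ring.
have d1 := le_trans (post_grad_err r w) n1.
have d2 := le_trans (post_grad_err (best w) w) n2.
rewrite cE; apply: le_trans (noisy_argmin_sqr d2 d1 (best_min w r)) _.
rewrite lerD2r; move: hf; rewrite mulrC -ler_pdivlMr// => hf.
rewrite (_ : 8 * run_Qk r k w / weight_total (T r w) k =
  3 / 2 * (16 / 3 * run_Qk r k w / weight_total (T r w) k)).
  by rewrite ler_wpM2l.
by field; rewrite gt_eqF.
Qed.

Let Q r w := Qk (est D) Lmax (diam X) l sigma (alpha D) k (nb_segs (T r w) k).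
Let M r w := Mk (T r w) k.
Let good := [set w | ((enorm (g_X (best w) w) ^+ 2)%:E <=
    runs_bound (Q ^~ w) (M ^~ w) + c%:E)%E].

Let goodb w := [exists r, (weight_total (T r w) k == 0) ||
  (enorm (g_X (best w) w) ^+ 2 <= 8 * run_Qk r k w / weight_total (T r w) k + c)%R].

Lemma T_Mk r w : M r w = weight_total (T r w) k.
Proof. exact: (@Mk_weight_total _ _ (T r w) (new_seg r w)). Qed.

Lemma T_Mk_ge r w :
  (k%:R - (nb_segs (T r w) k)%:R) ^+ 2 / (128 * Lhat (T r w k')) <= M r w.
Proof.
rewrite T_Mk; apply: (@weight_total_ge _ _ (T r w) (new_seg r w)) => // t.
  by rewrite T_Lhat le_max lexx.
by move=> /andP[_ /ltW h]; rewrite T_Lhat le_max h orbT.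
Qed.

Let goodE : good = [set w | goodb w].
Proof.
have Q0 w r : 0 < Q r w by exact: run_Qk_gt0.
rewrite /good; apply/seteqP; split=> w; rewrite /mkset (runs_bound_ge _ _ _ (Q0 w)).
  by move=> /existsP[r]; rewrite T_Mk => h; apply/existsP; exists r.
by move=> /existsP[r h]; apply/existsP; exists r; rewrite T_Mk.
Qed.

Let best_norm_measurable : measurable_fun setT (fun w => enorm (g_X (best w) w)).
Proof.
apply: (measurable_countable_choice (h := fun r w => enorm (g_X r w))) => // r.
apply: (measurable_countable_choice (h := fun j w => enorm (iter_grad X gf (T r w) j))) => j.
  by case: outR => _ /(_ r j).
by apply: measurable_enorm => i; exact: (known_measurable iidZ (@iter_grad_known r j i)).
Qed.

Let good_measurable : measurable [set w | goodb w].
Proof.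
apply: measurable_exists => r.
have mM := known_measurable iidZ (@weight_total_known r).
have mQ := known_measurable iidZ (@run_Qk_known k' r).
have -> : [set w | (weight_total (T r w) k == 0) ||
    (enorm (g_X (best w) w) ^+ 2 <= 8 * run_Qk r k w / weight_total (T r w) k + c)] =
  [set w | weight_total (T r w) k <= 0] `|`
  [set w | enorm (g_X (best w) w) ^+ 2 <= 8 * run_Qk r k w / weight_total (T r w) k + c].
  apply/seteqP; split=> w /=.
    by case/orP => [/eqP->|h]; [left|right].
  case=> [h|->]; last by rewrite orbT.
  by rewrite (_ : _ == 0)// eq_le h weight_total_ge0.
apply: measurableU; apply: measurable_set_le => //.
  exact: measurable_funX.
apply: measurable_funD; last exact: measurable_cst.
apply: measurable_fun_div => //; apply: measurable_funM => //; exact: measurable_cst.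
Qed.

(** If some run has no output law the bound is infinite.  Otherwise a large output
requires that all the runs are far or that some gradient estimate is noisy. *)
Lemma good_prob :
  ((1 - (1 / 2) ^+ nr - nr%:R * (2 * expR (- ((1 + lambda) ^+ 2 / 3))))%:E <= P good)%E.
Proof.
rewrite goodE; have [ig eg] := mean_indic P good_measurable.
have -> : P [set w | goodb w] = (fine (P [set w | goodb w]))%:E.
  by rewrite fineK//; exact: fin_num_measure.
rewrite -eg lee_fin.
have [i1 m1] := far_prob; have h2 r := noisy_prob K0 s0 r.
pose b1 w := [forall r, live r w && far r (Rout r w) w].
pose b2 r w := [forall r', live r' w && ((r' != r) || noisy K s r' (Rout r' w) w)].
have i2 : itg P (fun w => \sum_r (b2 r w)%:R) by apply: itg_sum => r; case: (h2 r).
have i12 : itg P (fun w => 1 - (b1 w)%:R) by apply: itgB => //; exact: itg_cst.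
apply: (@le_trans _ _ (mean P (fun w => 1 - (b1 w)%:R - \sum_r (b2 r w)%:R))).
  rewrite meanB// meanB ?mean_cst//; last exact: itg_cst.
  apply: lerB; first by rewrite lerD2l lerN2.
  rewrite mean_sum => [|r]; last by case: (h2 r).
  apply: (@le_trans _ _ (\sum_(r < nr) (2 * expR (- (s ^+ 2 / 3))))).
    by apply: ler_sum => r _; case: (h2 r).
  by rewrite sumr_const card_ord -[leLHS]mulr_natl.
apply: mean_le => // [|w]; first exact: itgB.
case gw: (goodb w).
  rewrite lerBlDr; apply: (@le_trans _ _ 1); first by rewrite lerBlDr lerDl.
  by rewrite lerDl; apply: sumr_ge0.
move: gw => /negbT; rewrite negb_exists => /forallP gw.
have lw r : live r w.
  have := gw r; rewrite negb_or /live lt_neqAle weight_total_ge0 andbT eq_sym.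
  by case/andP.
have [/existsP[r nr1]|] := boolP [exists r, noisy K s r (Rout r w) w].
  have b2r : b2 r w.
    apply/forallP => r'; rewrite lw /=; case: eqP => //= ->; exact: nr1.
  rewrite (bigD1 r)//= b2r opprD addrA lerBlDr.
  apply: (@le_trans _ _ 0); last by apply: addr_ge0 => //; apply: sumr_ge0.
  by rewrite subr_le0 lerBlDr lerDl.
rewrite negb_exists => /forallP nn.
have b1w : b1 w.
  apply/forallP => r; rewrite lw /=; apply: contraT => nf.
  have := gw r; rewrite negb_or => /andP[_ /negP[]].
  by apply: best_le.
by rewrite b1w subrr sub0r oppr_le0; apply: sumr_ge0.
Qed.

End Best.

End Outputs.

End Method.

(** * High-probability bound for the selected output *)

Unset Implicit Arguments.
Set Printing Implicit Defensive.

Theorem proposition1 (R : realType) (n : nat)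
  (dXi : measure_display) (Xi : measurableType dXi) (mu : probability Xi R)
  (dOm : measure_display) (Omega : measurableType dOm)
  (P : probability Omega R)
  (D : acspg R n Xi)
  (f : 'rV[R]_n -> R) (gf : 'rV[R]_n -> 'rV[R]_n) (L l : R)
  (sigma Lmax Lbar : R) (Lxi : Xi -> R)
  (nr k K : nat)
  (xi xi' : 'I_nr -> nat -> nat -> Omega -> Xi) (zeta : nat -> Omega -> Xi)
  (Rout : 'I_nr -> Omega -> nat) (best : Omega -> 'I_nr) :
  let X := domain D in
  let F := val_oracle D in
  let G := grad_oracle D in
  let T := traj D xi xi' in
  let beta := beta_fail mu X f gf F G (Lbar0 D) in
  let Z := all_samples xi xi' zeta in
  let g_X r w := iter_grad X gf (T r w) (Rout r w) in
  let gbar_X r w :=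
    iter_grad X (avg_grad G K (fun j => zeta j w)) (T r w) (Rout r w) in
  let Q r w := Qk (est D) Lmax (diam X) l sigma (alpha D) k
                 (nb_segs (T r w) k) in
  let M r w := Mk (T r w) k in
  let good lambda := [set w | ((enorm (g_X (best w) w) ^+ 2)%:E <=
      runs_bound (Q ^~ w) (M ^~ w) +
      (12 * (1 + lambda) ^+ 2 * sigma ^+ 2 / K%:R)%:E)%E] in
  (* feasible set and objective *)
  convex_set X -> compact X -> X (start D) ->
  is_gradient_on X f gf ->
  (forall x y, X x -> X y -> enorm (gf x - gf y) <= L * enorm (x - y)) ->
  0 <= l <= L ->
  (forall x y, X x -> X y ->
     - (l / 2) * enorm (x - y) ^+ 2 <= f x - f y - dot (gf y) (x - y)) ->
  (* stochastic oracle *)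
  (forall u, is_gradient_on X (F ^~ u) (G ^~ u)) ->
  (forall x, X x ->
     mu.-integrable setT (EFin \o F x) /\ ('E_mu[F x] = (f x)%:E)%E) ->
  (forall x i, X x ->
     mu.-integrable setT (fun u => (G x u 0 i)%:E) /\
     ('E_mu[fun u => (G x u 0 i)%R] = (gf x 0 i)%:E)%E) ->
  0 < sigma ->
  (forall x, X x ->
     ('E_mu[fun u => (enorm (G x u - gf x) ^+ 2)%R] <= (sigma ^+ 2)%:E)%E) ->
  measurable_fun setT Lxi -> (forall u, 0 <= Lxi u) ->
  (forall u x y, X x -> X y ->
     enorm (G x u - G y u) <= Lxi u * enorm (x - y)) ->
  (forall u x y, X x -> X y ->
     F x u - F y u - dot (G y u) (x - y) <= Lxi u / 2 * enorm (x - y) ^+ 2) ->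
  {ae mu, forall u, Lxi u <= Lmax} ->
  ('E_mu[fun u => (Lxi u ^+ 2)%R] <= (Lbar ^+ 2)%:E)%E ->
  (forall x, X x ->
     ('E_mu[fun u => expR (enorm (G x u - gf x) ^+ 2 / sigma ^+ 2)%R]
        <= (expR 1)%:E)%E) ->
  (* parameters *)
  0 < Lbar0 D <= Lmax -> 0 < alpha D -> beta < 1 ->
  (forall t, (1 <= t <= k)%N -> (1 <= est_batch D t)%N) ->
  (est D = EstimatorII -> forall t, (1 <= t <= k)%N ->
     2 * (ln (k%:R + 1) / ln (1 / beta)) <= (est_batch D t)%:R) ->
  (0 < K)%N ->
  (* samples, random outputs of the runs, output of the method *)
  iid P mu Z ->
  random_outputs P (sigma_generated Z) k T Rout ->
  (forall r, measurable [set w | best w = r]) ->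
  (forall w r, enorm (gbar_X (best w) w) <= enorm (gbar_X r w)) ->
  [/\ forall r w, (k%:R - (nb_segs (T r w) k)%:R) ^+ 2 /
                  (128 * Lhat (T r w k.-1)) <= M r w,
      forall lambda, 0 <= lambda ->
        ((1 - (1 / 2) ^+ nr - nr%:R * expR (- (lambda ^+ 2 / 3)))%:E
           <= P (good lambda))%E &
      forall delta, 0 < delta < 1 -> nr = nb_runs delta ->
        ((1 - delta)%:E <= P (good (lambda_of delta)))%E].
Proof.
move=> X F G T beta Z g_X gbar_X Q M good cvX cpX Xs grad_f lip_gf /andP[l0 lL]
  lower_curv grad_F F_mean G_mean sigma0 G_var mLxi Lxi0 lip_G upper_F Lxi_Lmax
  Lxi_sqr G_tail /andP[L00 L0L] alpha0 beta1 b0 bII K0 iidZ outR mbest best_min.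
have nr0 : (0 < nr)%N := leq_ltn_trans (leq0n _) (ltn_ord (best point)).
(* The outputs range strictly between 0 and k, so k is positive. *)
have k0 : (0 < k)%N.
  case: outR => /(_ (best point) point)/andP[h1 h2] _ _.
  exact: ltn_trans h1 h2.
case: k k0 @Q @M @good b0 bII outR => [//|k'] _ Q M good b0 bII outR.
have main lambda : 0 <= lambda ->
    ((1 - (1 / 2) ^+ nr - nr%:R * (2 * expR (- ((1 + lambda) ^+ 2 / 3))))%:E
       <= P (good lambda))%E.
  move=> lambda0.
  exact: (good_prob cvX cpX Xs grad_f lip_gf l0 lower_curv grad_F F_mean G_mean sigma0
    G_var mLxi Lxi0 lip_G upper_F Lxi_Lmax Lxi_sqr G_tail L00 L0L alpha0 iidZ outR b0 bII
    beta1 K0 lambda0 mbest best_min).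
have simple lambda : 0 <= lambda ->
    ((1 - (1 / 2) ^+ nr - nr%:R * expR (- (lambda ^+ 2 / 3)))%:E <= P (good lambda))%E.
  move=> lambda0; have [small|large] := ltP (expR (- (lambda ^+ 2 / 3))) (1 / 2).
    apply: le_trans (main _ lambda0); rewrite lee_fin lerD2l lerN2 ler_wpM2l//.
    exact: exp_tail_le.
  apply: le_trans (measure_ge0 P _); rewrite lee_fin.
  by have := half_pow_union_ge1 nr0 large; lra.
split=> // [r w|delta d01 nrE].
  exact: (T_Mk_ge xi xi' L00 k' r w).
apply: le_trans (simple _ (sqrtr_ge0 _)); rewrite lee_fin nrE.
rewrite -addrA -opprD lerD2l lerN2; exact: confidence_split.
Qed.
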